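(* Let $n\ge 2$, let $\Omega\subset\mathbb{R}^n$, and let $1\le q<p<q^*$, where $q^*=\frac{qn}{n-q}$ if $1\le q<n$ and $q^*=\infty$ if $q\ge n$. If $\Omega$ is a bounded $(W^{1,p},W^{1,q})$-extension domain, then $|\partial\Omega|=0$.
   Context: $|\cdot|$ denotes $n$-dimensional Lebesgue measure and $\partial\Omega$ the topological boundary of $\Omega$. A domain is a nonempty connected open set. For an open set $G\subset\mathbb{R}^n$ and $1\le p<\infty$, $W^{1,p}(G)$ is the space of weakly differentiable $u\in L^p(G)$ with weak gradient $\nabla u\in L^p(G;\mathbb{R}^n)$, with norm $\|u\|_{W^{1,p}(G)}=\left(\int_G |u|^p+|\nabla u|^p\,dx\right)^{1/p}$. For $1\le q\le p<\infty$ and $n\ge2$, a bounded domain $\Omega\subset\mathbb{R}^n$ is a $(W^{1,p},W^{1,q})$-extension domain (also called a Sobolev $(p,q)$-extension domain) if there exist a map $E:W^{1,p}(\Omega)\to W^{1,q}(\mathbb{R}^n)$ (not required to be linear) and a constant $C>0$ such that $Eu|_\Omega=u$ and $\|Eu\|_{W^{1,q}(\mathbb{R}^n)}\le C\|u\|_{W^{1,p}(\Omega)}$ for every $u\in W^{1,p}(\Omega)$. *)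

(* Defs.v *)
From HB Require Import structures.
From mathcomp Require Import all_boot all_order all_algebra.
From mathcomp Require Import all_classical all_reals all_analysis.
From mathcomp Require Import measurable_realfun lra.
Set Implicit Arguments.
Unset Strict Implicit.
Unset Printing Implicit Defensive.
Import Order.TTheory GRing.Theory Num.Theory.
Import numFieldNormedType.Exports.
Local Open Scope classical_set_scope.
Local Open Scope ring_scope.

(* R^n is 'rV[R]_n, with the library's (sup-norm) topology and the product of
   the Borel sigma-algebras of the coordinates, which is the Borel sigma-algebra
   of R^n (cf. open_measurable_rV).  Working with Borel rather than
   Lebesgue-measurable functions is harmless: every Lebesgue-measurable function
   is a.e. equal to a Borel one, and Sobolev functions matter only up to a.e.
   equality. *)
Section measurable_rV.
Variables (R : realType) (n : nat).

Definition rV_coord (i : 'I_n) (x : 'rV[R]_n) : R := x ord0 i.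

Let rV_set0 : g_sigma_preimage rV_coord set0.
Proof. exact: sigma_algebra0. Qed.

Let rV_setC A : g_sigma_preimage rV_coord A -> g_sigma_preimage rV_coord (~` A).
Proof. exact: sigma_algebraC. Qed.

Let rV_bigcup (F : (set 'rV[R]_n)^nat) :
  (forall i, g_sigma_preimage rV_coord (F i)) ->
  g_sigma_preimage rV_coord (\bigcup_i (F i)).
Proof. exact: sigma_algebra_bigcup. Qed.

HB.instance Definition _ := @isMeasurable.Build default_measure_display
  'rV[R]_n (g_sigma_preimage rV_coord) rV_set0 rV_setC rV_bigcup.

Lemma measurable_rV_coord i : measurable_fun [set: 'rV[R]_n] (rV_coord i).
Proof.
move=> _ Y mY; rewrite setTI; apply: sub_sigma_algebra => /=.
rewrite -bigcup_seq/=; exists i => /=; first by rewrite mem_index_enum.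
by exists Y => //; rewrite setTI.
Qed.

Lemma measurable_fun_rVP d (T : measurableType d) (f : T -> 'rV[R]_n) :
  (forall i, measurable_fun [set: T] (rV_coord i \o f)) ->
  measurable_fun [set: T] f.
Proof.
move=> mf _ Y mY; rewrite setTI.
pose M := [set A : set 'rV[R]_n | measurable (f @^-1` A)].
suff : g_sigma_preimage rV_coord `<=` M by exact.
apply: smallest_sub.
  split; rewrite /M.
  - by change (measurable (f @^-1` set0)); rewrite preimage_set0.
  - move=> A mA; change (measurable (f @^-1` (setT `\` A))).
    by rewrite setTD preimage_setC; exact: (measurableC mA).
  - move=> F mF; change (measurable (f @^-1` \bigcup_k F k)).
    by rewrite preimage_bigcup; apply: bigcupT_measurable => k; exact: mF.
move=> A; rewrite -bigcup_seq => -[i _ [B mB <-]].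
change (measurable (f @^-1` (setT `&` rV_coord i @^-1` B))).
by rewrite setTI -comp_preimage -[X in measurable X]setTI; exact: mf.
Qed.

End measurable_rV.

Lemma open_measurable_rV (R : realType) n (U : set 'rV[R]_n) :
  open U -> measurable U.
Proof.
move=> oU.
pose B (ck : 'rV[rat]_n * nat) : set 'rV[R]_n :=
  \bigcap_(i in [set: 'I_n])
    rV_coord i @^-1` ball (ratr (ck.1 ord0 i) : R) ck.2.+1%:R^-1.
have mB ck : measurable (B ck).
  apply: fin_bigcap_measurable => [|i _]; first exact: finite_finset.
  rewrite -[X in measurable X]setTI; apply: measurable_rV_coord => //.
  exact: measurable_ball.
have -> : U = \bigcup_ck (if pselect (B ck `<=` U) then B ck else set0).
  apply/seteqP; split=> [x Ux|x [ck _]]; last by case: pselect => // BU /BU.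
  have /nbhs_ballP[e /= e0 eU] : nbhs x U by exact: open_nbhs_nbhs.
  have [k ke] : exists k, k.+1%:R^-1 < e / 2.
    have e20 : 0 < e / 2 by rewrite divr_gt0.
    exists (Num.truncn (e / 2)^-1); rewrite invf_plt ?posrE//.
    by rewrite truncnS_gt// ltW// invr_gt0.
  pose r : R := k.+1%:R^-1.
  have r0 : 0 < r by rewrite /r invr_gt0.
  have /choice[c cE] (i : 'I_n) : exists c : rat, ball (ratr c : R) r (x ord0 i).
    have /rat_in_itvoo[c] : x ord0 i - r < x ord0 i + r.
      by rewrite ltrBlDr -addrA ltrDl addr_gt0.
    rewrite in_itv/= => /andP[c1 c2]; exists c.
    by rewrite /ball/= ltr_norml ltrBlDr ltrNl opprB ltrBlDr; apply/andP; split;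
      lra.
  exists (\row_i c i, k) => //; case: pselect => [_ i _|[]]; rewrite /B/=.
    by rewrite mxE; exact: cE.
  move=> y By; apply: eU; split=> // j i; rewrite (ord1 j).
  have := By i I; rewrite /= mxE => cy; have := cE i; rewrite -/r in cy *.
  rewrite /ball/= in cy * => cx.
  have tri (a b z : R) : a - b = (z - b) - (z - a) by lra.
  rewrite (tri _ _ (ratr (c i))).
  apply: le_lt_trans (ler_normB _ _) _.
  by apply: lt_trans (ltrD cy cx) _; rewrite [ltRHS]splitr ltrD.
apply: countable_bigcupT_measurable => // ck.
by case: (pselect (B ck `<=` U)) => /= BU; [exact: mB|exact: measurable0].
Qed.

Definition rV_cons (R : realType) n (x : R * 'rV[R]_n) : 'rV[R]_n.+1 :=
  \row_i oapp (x.2 ord0) x.1 (unlift ord0 i).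

Lemma measurable_rV_cons (R : realType) n :
  measurable_fun [set: measurableTypeR R * 'rV[R]_n] (@rV_cons R n).
Proof.
apply: measurable_fun_rVP => i.
case: (unliftP ord0 i) => [j ->|->].
  rewrite (_ : _ \o _ = rV_coord j \o snd); last first.
    by apply/funext => x; rewrite /rV_coord /rV_cons /= mxE liftK.
  by apply: measurableT_comp => //; exact: measurable_rV_coord.
rewrite (_ : _ \o _ = fst) //.
by apply/funext => x; rewrite /rV_coord /rV_cons /= mxE unlift_none.
Qed.

Local Open Scope ereal_scope.

(* n-dimensional Lebesgue measure, as an iterated product measure. *)
Fixpoint lebesgue_rV (R : realType) (n : nat) : set 'rV[R]_n -> \bar R :=
  match n with
  | 0 => \d_ (0%R : 'rV[R]_0)
  | m.+1 => pushforward (@lebesgue_measure R \x @lebesgue_rV R m) (@rV_cons R m)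
  end.

Section rV_cons_measure.
Variables (R : realType) (m : nat).
Variable nu : {sigma_finite_measure set 'rV[R]_m -> \bar R}.

Let pi := pushforward (@lebesgue_measure R \x nu) (@rV_cons R m).

Let pi0 : pi set0 = 0.
Proof. by rewrite /pi /pushforward preimage_set0 measure0. Qed.

Let pi_ge0 A : 0 <= pi A.
Proof. by rewrite /pi /pushforward; exact: measure_ge0. Qed.

Let pi_sigma_additive : semi_sigma_additive pi.
Proof.
have mpre A : measurable A -> measurable (@rV_cons R m @^-1` A).
  by move=> mA; rewrite -[X in measurable X]setTI; exact: measurable_rV_cons.
move=> F mF tF mUF; rewrite /pi /pushforward preimage_bigcup.
apply: measure_semi_sigma_additive; [by move=> k; exact: mpre| |].
  by move=> i j _ _ [x [Fi Fj]]; apply: tF => //; exists (@rV_cons R m x).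
by rewrite -preimage_bigcup; exact: mpre.
Qed.

HB.instance Definition _ := isMeasure.Build _ _ _ pi pi0 pi_ge0 pi_sigma_additive.

Let pi_sigma_finite : sigma_finite setT pi.
Proof.
have [F FT mF] : sigma_finite setT (@lebesgue_measure R \x nu).
  have /sigma_finiteP[F [TF ndF Foo]] := sigma_finiteT (@lebesgue_measure R).
  have /sigma_finiteP[G [TG ndG Goo]] := sigma_finiteT nu.
  exists (fun k => F k `*` G k) => [|k]; last first.
    have [? ?] := Foo k; have [? ?] := Goo k; split; first exact: measurableX.
    by rewrite product_measure1E// lte_mul_pinfty// ge0_fin_numE.
  apply/seteqP; split=> // -[x y] _.
  have [i _ Fx] : (\bigcup_i F i) x by rewrite -TF.
  have [j _ Gy] : (\bigcup_i G i) y by rewrite -TG.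
  exists (maxn i j) => //; split => /=.
    by move: x Fx; exact/subsetPset/ndF/leq_maxl.
  by move: y Gy; exact/subsetPset/ndG/leq_maxr.
pose h (y : 'rV[R]_m.+1) : measurableTypeR R * 'rV[R]_m :=
  (rV_coord ord0 y, \row_j y ord0 (lift ord0 j)).
have hK x : h (@rV_cons R m x) = x.
  case: x => a b; rewrite /h /rV_cons /rV_coord !mxE unlift_none/=; congr pair.
  by apply/rowP => j; rewrite !mxE liftK.
have mh : measurable_fun setT h.
  apply/measurable_fun_pairP; split; first exact: measurable_rV_coord.
  apply: measurable_fun_rVP => i; rewrite (_ : _ \o _ = rV_coord (lift ord0 i)).
    exact: measurable_rV_coord.
  by apply/funext => y; rewrite /rV_coord /= mxE.
exists (fun k => h @^-1` F k).
  by rewrite -preimage_bigcup -FT preimage_setT.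
move=> k; have [mFk Fk] := mF k; split.
  by rewrite -[X in measurable X]setTI; exact: mh.
rewrite /pi /pushforward -comp_preimage (_ : _ \o _ = id)//.
by apply/funext => x /=; rewrite hK.
Qed.

HB.instance Definition _ := Measure_isSigmaFinite.Build _ _ _ pi pi_sigma_finite.

Definition rV_cons_measure : {sigma_finite_measure set 'rV[R]_m.+1 -> \bar R} := pi.

End rV_cons_measure.

Lemma lebesgue_rV_sigma_finite (R : realType) n :
  exists nu : {sigma_finite_measure set 'rV[R]_n -> \bar R},
    nu = @lebesgue_rV R n :> (_ -> _).
Proof.
elim: n => [|n [nu nuE]]; first by exists (\d_ (0%R : 'rV[R]_0)).
by exists (rV_cons_measure nu); rewrite /= -nuE.
Qed.

Section lebesgue_rV_measure.
Variables (R : realType) (n : nat).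
Local Notation mu := (@lebesgue_rV R n).

Let mu0 : mu set0 = 0.
Proof. by have [nu <-] := lebesgue_rV_sigma_finite R n; exact: measure0. Qed.

Let mu_ge0 A : 0 <= mu A.
Proof. by have [nu <-] := lebesgue_rV_sigma_finite R n; exact: measure_ge0. Qed.

Let mu_sigma_additive : semi_sigma_additive mu.
Proof.
have [nu <-] := lebesgue_rV_sigma_finite R n.
exact: measure_semi_sigma_additive.
Qed.

HB.instance Definition _ := isMeasure.Build _ _ _ mu
  mu0 mu_ge0 mu_sigma_additive.

Let mu_sigma_finite : sigma_finite setT mu.
Proof. by have [nu <-] := lebesgue_rV_sigma_finite R n; exact: sigma_finiteT. Qed.

HB.instance Definition _ := Measure_isSigmaFinite.Build _ _ _ mu
  mu_sigma_finite.

End lebesgue_rV_measure.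

Lemma lebesgue_rV_box (R : realType) n (A : 'I_n -> set (measurableTypeR R)) :
  (forall i, measurable (A i)) ->
  lebesgue_rV [set x : 'rV[R]_n | forall i, A i (x ord0 i)] =
  \prod_(i < n) lebesgue_measure (A i).
Proof.
elim: n A => [|n IH] A mA.
  by rewrite big_ord0 /= diracE mem_set// => -[].
rewrite big_ord_recl -IH// -product_measure1E//; last first.
  rewrite (_ : mkset _ = \bigcap_(i in [set: 'I_n]) rV_coord i @^-1` A (lift ord0 i)).
    apply: fin_bigcap_measurable => [|i _]; first exact: finite_finset.
    rewrite -[X in measurable X]setTI; apply: measurable_rV_coord => //.
    exact: mA.
  by apply/seteqP; split=> x Ax i => [_|]; exact: Ax.
rewrite /= /pushforward; congr (_ \x _); apply/seteqP; split=> [[a b] /= H|[a b] /= [Aa Ab] i].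
  split; first by have := H ord0; rewrite mxE unlift_none.
  by move=> i; have := H (lift ord0 i); rewrite mxE liftK.
by rewrite mxE; case: unliftP => [j|] ->.
Qed.

Section sobolev.
Variables (R : realType) (n : nat).
Local Notation V := 'rV[R]_n.
Local Notation mu := (@lebesgue_rV R n).
Implicit Types (G : set V) (u f phi : V -> R) (g : V -> V) (p : R).

Local Open Scope ring_scope.

Definition eucl_norm (v : V) : R := Num.sqrt (\sum_i v ord0 i ^+ 2).

Definition partial (i : 'I_n) f : V -> R := 'D_(delta_mx ord0 i) f.

Definition smooth f := forall s : seq 'I_n,
  continuous (foldr partial f s) /\
  forall i x, derivable (foldr partial f s) x (delta_mx ord0 i).

Definition test_function G phi :=
  let supp := closure [set x | phi x != 0] in
  [/\ smooth phi, compact supp & supp `<=` G].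

Definition loc_integrable G f := measurable_fun G f /\
  forall K, compact K -> K `<=` G -> mu.-integrable K (EFin \o f).

Definition is_weak_gradient G u g := forall i : 'I_n,
  loc_integrable G (fun x => g x ord0 i) /\
  forall phi, test_function G phi ->
    \int[mu]_(x in G) (u x * partial i phi x) =
    - \int[mu]_(x in G) (g x ord0 i * phi x).

Definition weakly_differentiable G u :=
  loc_integrable G u /\ exists g, is_weak_gradient G u g.

(* The weak gradient is unique up to a.e. equality in G. *)
Definition weak_gradient G u : V -> V := xget (cst 0) [set g | is_weak_gradient G u g].

(* The elements of W^{1,p}(G) are represented by functions on R^n whose values
   outside of G are irrelevant, whence the extensions by zero f \_ G below. *)
Definition in_Lp p G f := f \_ G \in Lfun mu p%:E.

Definition sobolev p G : set (V -> R) :=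
  [set u | [/\ weakly_differentiable G u, in_Lp p G u &
    forall i, in_Lp p G (fun x => weak_gradient G u x ord0 i)]].

Definition sobolev_norm p G u : \bar R :=
  ((\int[mu]_(x in G)
      (`|u x| `^ p + eucl_norm (weak_gradient G u x) `^ p)%:E) `^ p^-1)%E.

Definition domain G := [/\ G !=set0, connected G & open G].

(* The second clause says that E is well defined on a.e. classes. *)
Definition sobolev_extension_domain p q G :=
  [/\ domain G, bounded_set G &
    exists (E : (V -> R) -> (V -> R)) (C : R), [/\ 0 < C,
      forall u v, sobolev p G u -> sobolev p G v ->
        u = v %[ae mu in G] -> E u = E v %[ae mu] &
      forall u, sobolev p G u ->
        [/\ sobolev q setT (E u), E u = u %[ae mu in G] &
          (sobolev_norm q setT (E u) <= C%:E * sobolev_norm p G u)%E]]].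

End sobolev.

Definition boundary (T : topologicalType) (A : set T) := closure A `\` interior A.

Definition sobolev_conjugate (R : realType) (n : nat) (q : R) : \bar R :=
  if (q < n%:R)%R then (q * n%:R / (n%:R - q))%R%:E else +oo.

(* Main.v *)
(* Let A be the boundary of Omega, and suppose |A| > 0.  Work with sup-norm balls
   Q(x, r), that is cubes, and write F(x, r) = |Omega \cap Q(x, r)|, positive for
   x in A.

   Since n >= 2 and F(x, r) <= (2 r)^n, each x in A has arbitrarily small radii rho
   with F(x, rho / 2) <= F(x, rho) / 2; the cubes Q(x, 2 rho) of finitely many such
   points can be taken disjoint with \sum rho^n >= |A| / 12^n.  In each cube choose
   r2 < r1 < rho / 2 with F(x, r1) <= 2 F(x, r2), where r1 - r2 is controlled from
   below by a power of F(x, r1) / rho^n, and let u be the sum of the cut-off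
   functions that are 1 on Q(x, r2) and 0 off Q(x, r1), with heights
   a = (r1 - r2) (rho^n / F(x, r1))^(1/p).  Then ||u||_{1,p}^p <= C \sum rho^n.

   An extension v of u is equal to a on a set of measure at least F(x, r1) / 2 and to
   0 on a set of measure at least F(x, rho) / 2 in Q(x, rho).  Telescoping the averages
   of v over cubes of radii rho / 2^k gives, for max(0, 1 - q/n) < l < q/p,
   a^q rho^(n - q) (F(x, r1) / rho^n)^l <= C \int_{Q(x, 2 rho)} |\nabla v|^q.
   Summing over the disjoint cubes and using the extension property,
   \sum rho^n (F(x, rho) / rho^n)^(l - q/p) is bounded.  The negative exponent makes
   this absurd: \sum F(x, rho) is at most the measure of Omega near A, which tends to
   0 as the radii do, while \sum rho^n >= |A| / 12^n. *)

Require Import Defs.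
From mathcomp Require Import all_boot all_order all_algebra.
From mathcomp Require Import all_classical all_reals all_analysis.
From mathcomp Require Import measurable_realfun ring lra.
Set Implicit Arguments.
Unset Strict Implicit.
Unset Printing Implicit Defensive.
Import Order.TTheory GRing.Theory Num.Theory.
Import numFieldNormedType.Exports.
Local Open Scope classical_set_scope.
Local Open Scope ring_scope.

(** * A smooth step function *)

(** The extension [v] is known only through its weak gradient and its values almost everywhere. Its
    averages are therefore taken against smooth product kernels supported in cubes: the difference
    of two such kernels is a sum of partial derivatives of test functions, and pairing it with [v]
    brings in the weak gradient directly. The condition p < q* is exactly what leaves room for l:
    for q < n, 1 - q/n < q/p is equivalent to p < nq/(n - q). The lower bound on l makes gamma = q -
    n + n l positive, so that the increments between successive scales are summable; the upper bound
    makes e = q/p - l positive, so that a small volume fraction F(x, rho)/rho^n is costly. The power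
    l itself comes from interpolating two estimates of a double integral, one good for cubes smaller
    than the set where [v] is constant and one for larger cubes. The volume fractions are small only
    on average over the cubes. An affine lower bound for t^(-e) is summed instead, and all constants
    must be independent of the number and the size of the cubes, because the bound r0 on the radii
    is fixed last. *)

Section smooth_line.
Variable R : realType.
Implicit Types (f g : R -> R) (k : nat).

Lemma is_derive_ext (f g : R -> R) (x a b : R) :
  is_derive x 1 f a -> f =1 g -> a = b -> is_derive x 1 g b.
Proof. by move=> fa /funext <- <-. Qed.

(** The derivative is an existential witness rather than a term in [derive1], so that closure under
    sums, products, affine substitution and inverses is a plain induction on [k]. The last
    derivative need not be continuous; continuity of all derivatives follows once every [k] is asked
    for. *)
Fixpoint Cn k f : Prop :=
  if k is k'.+1 then exists2 g : R -> R, (forall x : R, is_derive x 1 f (g x)) & Cn k' g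
  else True.

Definition smooth_line f := forall k, Cn k f.

Lemma CnS k f : Cn k.+1 f -> Cn k f.
Proof.
elim: k f => // k IH f [g fg Cg]; exists g => //; exact: IH.
Qed.

Lemma Cn_ext k f g : f =1 g -> Cn k f -> Cn k g.
Proof. by move=> /funext ->. Qed.

Lemma CnD k f g : Cn k f -> Cn k g -> Cn k (fun x => f x + g x).
Proof.
elim: k f g => // k IH f g [f' ff' Cf'] [g' gg' Cg'].
exists (fun x => f' x + g' x); last exact: IH.
by move=> x; apply: is_deriveD.
Qed.

Lemma CnZ k c f : Cn k f -> Cn k (fun x => c * f x).
Proof.
elim: k f => // k IH f [f' ff' Cf'].
exists (fun x => c * f' x); last exact: IH.
by move=> x; exact: is_deriveZ.
Qed.

Lemma CnM k f g : Cn k f -> Cn k g -> Cn k (fun x => f x * g x).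
Proof.
elim: k f g => // k IH f g /[dup] Cf [f' ff' Cf'] /[dup] Cg [g' gg' Cg'].
exists (fun x => f' x * g x + f x * g' x).
  move=> x; have := is_deriveM (ff' x) (gg' x).
  by move=> /is_derive_ext; apply=> //; rewrite addrC [g x *: _]mulrC.
by apply: CnD; apply: IH => //; exact: CnS.
Qed.

Lemma Cn_affine k f a b : Cn k f -> Cn k (fun x => f (a * x + b)).
Proof.
elim: k f => // k IH f [f' ff' Cf'].
exists (fun x => a * f' (a * x + b)); last exact/CnZ/IH.
move=> x.
have dA : is_derive x 1 (fun x : R => a * x + b) a.
  have := is_deriveD (is_deriveZ a (is_derive_id x (1 : R))) (is_derive_cst b x (1 : R)).
  by move=> /is_derive_ext; apply=> //; rewrite addr0 [_ *: _]mulr1.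
have := @is_derive1_comp _ f (fun x => a * x + b) _ _ _ (ff' (a * x + b)) dA.
by move=> /is_derive_ext; apply=> //; rewrite mulrC.
Qed.

(** The derivative of 1/f is a polynomial in f' and 1/f, and the induction hypothesis covers 1/f at
    the lower order. *)
Lemma CnV k f : (forall x, f x != 0) -> Cn k f -> Cn k (fun x => (f x)^-1).
Proof.
move=> f0; elim: k => // k IH /[dup] Cf [f' ff' Cf'].
have Cif := IH (CnS Cf).
exists (fun x => -1 * (f' x * ((f x)^-1 * (f x)^-1))).
  move=> x; have := is_deriveV (f0 x) (ff' x).
  by move=> /is_derive_ext; apply=> //; rewrite /GRing.scale/=; field.
by apply/CnZ/CnM => //; exact: CnM.
Qed.

End smooth_line.

Section flat.
Variable R : realType.
Implicit Types x h : R.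

(** The classical flat function exp(-1/x) with the extra factors x^(-k): up to linear combinations
    this family is closed under differentiation, which makes smoothness an induction. *)
Definition flat k x : R := if 0 < x then x ^- k * expR (- x^-1) else 0.

Lemma flat_ge0 k x : 0 <= flat k x.
Proof.
rewrite /flat; case: ifP => // x0.
by rewrite mulr_ge0 ?expR_ge0// invr_ge0 exprn_ge0// ltW.
Qed.

Lemma flat0_gt0 x : 0 < x -> 0 < flat 0 x.
Proof. by move=> x0; rewrite /flat x0 expr0 invr1 mul1r expR_gt0. Qed.

Lemma flat_le0 k x : x <= 0 -> flat k x = 0.
Proof. by rewrite /flat ltNge => ->. Qed.

(** With y = 1/x, this is exp(y) >= y^(k+2) / (k+2)!. The quadratic decay gives derivative 0 at the
    origin. *)
Lemma flat_bound k x : `|flat k x| <= (k.+2)`!%:R * x ^+ 2.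
Proof.
rewrite ger0_norm ?flat_ge0// /flat; case: ifPn => [x0|_]; last first.
  by rewrite mulr_ge0// sqr_ge0.
have y0 : 0 <= x^-1 by rewrite invr_ge0 ltW.
have := expR_ge1Dxn k.+1 y0.
rewrite expRN => H.
rewrite ler_pdivrMr ?expR_gt0//.
have : x^-1 ^+ k.+2 / k.+2`!%:R <= expR x^-1 by apply: le_trans H; rewrite lerDr.
rewrite ler_pdivrMr ?ltr0n ?fact_gt0//.
move=> {}H.
have x2 : 0 < x ^+ 2 by rewrite exprn_gt0.
have -> : x ^- k = x^-1 ^+ k.+2 * x ^+ 2.
  by rewrite exprVn -addn2 exprD; field; rewrite expf_neq0 ?gt_eqF.
by rewrite [leRHS]mulrAC [_%:R * _]mulrC ler_pM2r.
Qed.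

Lemma is_derive_flat k x :
  is_derive x 1 (flat k) (flat k.+2 x - k%:R * flat k.+1 x).
Proof.
have [x0|x0|->] := ltgtP x 0.
- rewrite !flat_le0 ?ltW// mulr0 subr0.
  apply: (@near_eq_is_derive _ _ _ (cst 0)).
  near=> y; rewrite flat_le0//; apply: ltW; near: y.
  exact: lt_nbhsl.
- apply: (@near_eq_is_derive _ _ _ (fun x => (x^-1) ^+ k * expR (- x^-1))).
    near=> y; have y0 : 0 < y by near: y; exact: lt_nbhsr.
    by rewrite /flat y0 exprVn.
  have xn0 : x != 0 by rewrite gt_eqF.
  have dV : is_derive x 1 (fun x : R => x^-1) (- x ^- 2).
    have := is_deriveV xn0 (is_derive_id x 1).
    by move=> /is_derive_ext; apply=> //; rewrite [_ *: _]mulr1.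
  have dE : is_derive x 1 (fun x => expR (- x^-1)) (x ^- 2 * expR (- x^-1)).
    have dN : is_derive x 1 (fun x : R => - x^-1) (x ^- 2).
      by have := is_deriveN dV => /is_derive_ext; apply=> //; rewrite opprK.
    have := @is_derive1_comp _ expR (fun x => - x^-1) x _ _ (is_derive_expR _) dN.
    by move=> /is_derive_ext; apply=> //; rewrite mulrC.
  have := is_deriveM (is_deriveX k dV) dE.
  move=> /is_derive_ext; apply=> [z|].
    rewrite [LHS](_ : _ = ((fun x : R => x^-1) ^+ k) z * expR (- z^-1))//; congr (_ * _).
    by elim: (k) => // m IHm; rewrite !exprS -IHm.
  rewrite /flat x0.
  rewrite /GRing.scale/= -[x ^- k.+1]exprVn -[x ^- k.+2]exprVn -[x ^- 2]exprVn.
  have -> : ((fun x : R => x^-1) ^+ k) x = x^-1 ^+ k.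
    by elim: (k) => // m IHm; rewrite !exprS -IHm.
  rewrite /=; move: (expR (- x^-1)) (x^-1) => E y;  case: k => [|k]; first by ring.
  rewrite /= !exprS -natr1; move: (y ^+ k) => Y; ring.
rewrite !flat_le0// mulr0 subr0.
(* At the origin the difference quotient is at most (k+2)! |h| in absolute value, by
   [flat_bound]. *)
suff H : (fun h => h^-1 *: ((flat k \o shift 0) (h *: 1) - flat k 0)) @ 0^' --> (0 : R).
  by apply: DeriveDef; [apply/cvg_ex; exists 0|exact/cvg_lim].
apply/cvgrPdist_lt => e e0.
near=> h.
rewrite sub0r normrN /= addr0 [flat k 0]flat_le0// subr0.
rewrite [h%:A](mulr1) normrM.
have hn0 : h != 0 by near: h; exact: nbhs_dnbhs_neq.
have h0 : 0 < `|h| by rewrite normr_gt0.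
rewrite normfV mulrC ltr_pdivrMr//.
apply: le_lt_trans (flat_bound _ _) _.
have -> : h ^+ 2 = `|h| * `|h| by rewrite -normrM -expr2 ger0_norm ?sqr_ge0.
rewrite mulrA ltr_pM2r // -ltr_pdivlMl ?ltr0n ?fact_gt0 //.
near: h; apply: dnbhs0_lt.
by rewrite mulr_gt0 ?invr_gt0 ?ltr0n ?fact_gt0.
Unshelve. all: by end_near. Qed.

Lemma smooth_line_flat k : smooth_line (flat k).
Proof.
move=> m; elim: m k => // m IH k.
exists (fun x => flat k.+2 x + (- k%:R) * flat k.+1 x).
  by move=> x; have := is_derive_flat k x; move=> /is_derive_ext; apply=> //; rewrite mulNr.
by apply: CnD => //; exact: CnZ.
Qed.

(** A smooth transition from 0 on x <= -1 to 1 on x >= 1. The denominator never vanishes because 1 +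
    x and 1 - x cannot both be nonpositive. *)
Definition step x : R := flat 0 (1 + x) / (flat 0 (1 + x) + flat 0 (1 - x)).

Lemma step_den_gt0 x : 0 < flat 0 (1 + x) + flat 0 (1 - x).
Proof.
have [x0|x0] := lerP 0 x.
  by rewrite ltr_pwDl ?flat_ge0// flat0_gt0// ltr_pwDl.
by rewrite ltr_wpDl ?flat_ge0// flat0_gt0// subr_gt0 (lt_trans x0).
Qed.

Lemma smooth_line_step : smooth_line step.
Proof.
move=> k; apply: CnM.
  apply: Cn_ext (Cn_affine 1 1 (smooth_line_flat 0 k)) => x.
  by rewrite mul1r addrC.
apply: CnV => [x|]; first by rewrite gt_eqF// step_den_gt0.
apply: CnD.
  apply: Cn_ext (Cn_affine 1 1 (smooth_line_flat 0 k)) => x.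
  by rewrite mul1r addrC.
apply: Cn_ext (Cn_affine (-1) 1 (smooth_line_flat 0 k)) => x.
by rewrite mulN1r addrC.
Qed.

Lemma step_ge0 x : 0 <= step x.
Proof. by rewrite divr_ge0 ?flat_ge0// ltW// step_den_gt0. Qed.

Lemma step_le1 x : step x <= 1.
Proof. by rewrite ler_pdivrMr ?step_den_gt0// mul1r lerDl flat_ge0. Qed.

Lemma step0 x : x <= -1 -> step x = 0.
Proof. by move=> x1; rewrite /step flat_le0 ?mul0r//; lra. Qed.

Lemma step1 x : 1 <= x -> step x = 1.
Proof.
move=> x1; have := step_den_gt0 x; rewrite /step [flat 0 (1 - x)]flat_le0; last lra.
by rewrite addr0 => /lt0r_neq0/divff.
Qed.

End flat.

Section smooth_line_derive.
Variable R : realType.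
Implicit Types f : R -> R.

Lemma smooth_line_is_derive f : smooth_line f ->
  forall x : R, is_derive x 1 f (f^`()%classic x).
Proof.
move=> /(_ 1)[g fg _] x.
have [df _] := fg x; by split => //; rewrite derive1E.
Qed.

Lemma smooth_line_derive1 f : smooth_line f -> smooth_line (f^`()%classic).
Proof.
move=> Cf k; have [g fg Cg] := Cf k.+1.
apply: Cn_ext Cg => x; have [_ dg] := fg x.
by rewrite derive1E dg.
Qed.

Lemma smooth_line_iter f k : smooth_line f -> smooth_line (iter k (@derive1 _ _) f).
Proof.
by move=> Cf; elim: k => // k IH; rewrite iterS; exact: smooth_line_derive1.
Qed.

Lemma smooth_line_continuous f : smooth_line f -> continuous f.
Proof.
move=> /smooth_line_is_derive fd x.
by apply: differentiable_continuous; apply/derivable1_diffP; have [] := fd x.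
Qed.

Lemma derive1_step_out x : 1 < `|x| -> (@step R)^`()%classic x = 0.
Proof.
rewrite ltr_normr => /orP[x1|x1]; rewrite derive1E.
  rewrite (@near_eq_derive R R R _ (cst (1 : R))) ?derive_cst//.
  near=> y; rewrite step1//; apply: ltW; near: y; exact: lt_nbhsr.
rewrite (@near_eq_derive R R R _ (cst (0 : R))) ?derive_cst//.
near=> y; rewrite step0//; apply: ltW; near: y; apply: lt_nbhsl; lra.
Unshelve. all: by end_near. Qed.

Lemma derive1_step_bound :
  exists2 C : R, 1 <= C & forall x, `|(@step R)^`()%classic x| <= C.
Proof.
have cs : continuous (@step R)^`()%classic.
  exact/smooth_line_continuous/smooth_line_derive1/smooth_line_step.
have [||c _ Hc] := @EVT_max R (fun x => `|(@step R)^`()%classic x|) (-1) 1.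
- by rewrite lerN10_le1 || lra.
- apply: continuous_subspaceT => x.
  by apply: continuous_comp; [exact: cs|exact: norm_continuous].
exists (1 + `|(@step R)^`()%classic c|); first by rewrite lerDl.
move=> x; have [x1|x1] := ltrP 1 `|x|.
  by rewrite derive1_step_out// normr0 addr_ge0.
apply: le_trans (Hc x _) _; last by rewrite lerDr.
by rewrite in_itv/= -ler_norml.
Qed.

End smooth_line_derive.

(** * Products of one-variable functions *)

Section coordinates.
Variables (R : realType) (n : nat).
Local Notation V := 'rV[R]_n.
Implicit Types (F : V -> R) (x v : V) (f : 'I_n -> R -> R).

Local Notation e_ i := (delta_mx ord0 i : V).

(** Restricting to the line through [x] makes the one-variable chain rule and product rule available
    for partial derivatives. *)
Lemma is_derive_lineP F x v (d : R) :
  is_derive x v F d <-> is_derive (0 : R) 1 (fun h : R => F (h *: v + x)) d.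
Proof.
have E : (fun h : R => h^-1 *: ((F \o shift x) (h *: v) - F x)) =
         (fun h : R => h^-1 *: (((fun h : R => F (h *: v + x)) \o shift 0) (h *: 1)
            - F (0 *: v + x))).
  by apply/funext => h /=; rewrite addr0 [h%:A]mulr1 scale0r add0r.
by split=> -[]; rewrite /derivable /derive; [rewrite E|rewrite -E]; split.
Qed.

Definition prodf f x := \prod_i f i (x ord0 i).

Lemma prodf_line f x i (h : R) :
  prodf f (h *: e_ i + x) = f i (h + x ord0 i) * \prod_(j | j != i) f j (x ord0 j).
Proof.
rewrite /prodf (bigD1 i)//= !mxE !eqxx mulr1; congr (_ * _).
by apply: eq_bigr => j ji; rewrite !mxE eqxx (negbTE ji) mulr0 add0r.
Qed.

Lemma is_derive_prodf f i x (d : R) :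
  is_derive (x ord0 i) 1 (f i) d ->
  is_derive x (e_ i) (prodf f) (d * \prod_(j | j != i) f j (x ord0 j)).
Proof.
move=> fd; apply/is_derive_lineP.
have fd' : is_derive (0 : R) 1 (fun h => f i (1 * h + x ord0 i)) d.
  have dA : is_derive (0 : R) 1 (fun h : R => 1 * h + x ord0 i) 1.
    have := is_deriveD (is_deriveZ (1 : R) (is_derive_id (0 : R) (1 : R)))
      (is_derive_cst (x ord0 i) (0 : R) (1 : R)).
    by move=> /is_derive_ext; apply=> //; rewrite addr0 [_ *: _]mulr1.
  have fd0 : is_derive (1 * 0 + x ord0 i) 1 (f i) d by rewrite mulr0 add0r.
  have := @is_derive1_comp _ (f i) (fun h => 1 * h + x ord0 i) _ _ _ fd0 dA.
  by move=> /is_derive_ext; apply=> //; rewrite mulr1.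
set c := \prod_(j | _) _.
have := is_deriveZ c fd'; move=> /is_derive_ext; apply.
  by move=> h; rewrite prodf_line -/c [LHS](_ : _ = c * f i (1 * h + x ord0 i)) // mul1r mulrC.
by rewrite mulrC.
Qed.

Lemma partial_prodf f i x : (forall j, smooth_line (f j)) ->
  is_derive x (e_ i) (prodf f)
    (prodf (fun j => if j == i then (f j)^`()%classic else f j) x).
Proof.
move=> fs; have := is_derive_prodf (smooth_line_is_derive (fs i) (x ord0 i)).
congr is_derive.
rewrite /prodf [RHS](bigD1 i)//= eqxx; congr (_ * _).
by apply: eq_bigr => j ji; rewrite (negbTE ji).
Qed.

Lemma continuous_prodf f : (forall j, continuous (f j)) -> continuous (prodf f).
Proof.
move=> fc; rewrite /prodf => x.
elim: (index_enum _) => [|j s IH].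
  by rewrite (_ : (fun _ => _) = cst 1); [exact: cst_continuous|apply/funext => y; rewrite big_nil].
rewrite (_ : (fun _ => _) = fun y : V => f j (y ord0 j) * \prod_(i <- s) f i (y ord0 i)).
  apply: (@continuousM _ _ (fun y : V => f j (y ord0 j))) => //.
  by apply: continuous_comp; [exact: coord_continuous|exact: fc].
by apply/funext => y; rewrite big_cons.
Qed.

(** Each [partial j] differentiates only the factor [j], so a mixed derivative of a tensor product
    is again a tensor product and only multiplicities in [s] matter. *)
Lemma foldr_partial_prodf f s : (forall j, smooth_line (f j)) ->
  foldr (@partial R n) (prodf f) s =
  prodf (fun j => iter (count_mem j s) (@derive1 R R) (f j)).
Proof.
move=> fs; elim: s => //= i s ->.
apply/funext => x; rewrite /partial.
have := @partial_prodf (fun j => iter (count_mem j s) (@derive1 R R) (f j)) i x.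
case; first by move=> j; exact: smooth_line_iter.
move=> _ ->; congr (prodf _ x); apply/funext => j.
by rewrite eq_sym; case: eqVneq => //= _; rewrite add1n.
Qed.

Lemma smooth_prodf f : (forall j, smooth_line (f j)) -> smooth (prodf f).
Proof.
move=> fs s; rewrite foldr_partial_prodf//; split=> [|i x].
  by apply: continuous_prodf => j; apply: smooth_line_continuous; exact: smooth_line_iter.
by have [] := @partial_prodf _ i x (fun j => smooth_line_iter (count_mem j s) (fs j)).
Qed.

Definition cbox (a b : 'I_n -> R) : set V := [set x | forall i, a i <= x ord0 i <= b i].
Definition obox (a b : 'I_n -> R) : set V := [set x | forall i, a i < x ord0 i < b i].

Lemma compact_cbox a b : compact (cbox a b).
Proof.
have := @rV_compact _ n (fun i => `[a i, b i]%classic) (fun i => @segment_compact _ _ _).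
by congr compact; apply/seteqP; split=> x /= H i; have := H i; rewrite in_itv.
Qed.

Lemma closed_cbox a b : closed (cbox a b).
Proof. by apply: compact_closed; [exact: norm_hausdorff|exact: compact_cbox]. Qed.

Lemma test_prodf (G : set V) f a b : (forall j, smooth_line (f j)) ->
  (forall j t, f j t != 0 -> a j <= t <= b j) -> cbox a b `<=` G ->
  test_function G (prodf f).
Proof.
move=> fs fab abG; rewrite /test_function.
have sub : closure [set x | prodf f x != 0] `<=` cbox a b.
  rewrite [X in _ `<=` X]((closure_id _).1 (@closed_cbox a b)).
  apply: closure_subset => x /=; rewrite /prodf => /prodf_neq0 H i.
  exact/fab/H.
split; first exact: smooth_prodf.
  by apply: subclosed_compact sub; [exact: closed_closure|exact: compact_cbox].
exact: subset_trans abG.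
Qed.

Lemma continuous_measurable_rV F : continuous F -> measurable_fun setT F.
Proof.
move=> /continuousP cF; apply: (measurability _ (RGenOpens.measurableE R)).
move=> _ [_ [a [b ->] <-]]; rewrite setTI; apply: open_measurable_rV.
by apply: cF; exact: interval_open.
Qed.

Lemma measurable_obox a b : measurable (obox a b).
Proof.
rewrite (_ : obox a b = \bigcap_(i in [set: 'I_n]) (rV_coord i @^-1` `]a i, b i[%classic)).
  apply: fin_bigcap_measurable => [|i _]; first exact: finite_finset.
  by rewrite -[X in measurable X]setTI; apply: measurable_rV_coord.
by apply/seteqP; split=> x /= H i => [_|]; have := H i; rewrite /rV_coord /= in_itv/=; auto.
Qed.

Lemma lebesgue_obox a b : (forall i, a i <= b i) ->
  lebesgue_rV (obox a b) = (\prod_i (b i - a i))%:E.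
Proof.
move=> ab.
have := @lebesgue_rV_box R n (fun i => `]a i, b i[%classic) (fun i => measurable_itv _).
rewrite (_ : mkset _ = obox a b); last first.
  by apply/seteqP; split=> x /= H i; have := H i; rewrite in_itv.
move=> ->; rewrite -prodEFin; apply: eq_bigr => i _.
by rewrite lebesgue_measure_itv/= lte_fin; case: ltgtP (ab i) => // -> _; rewrite subrr.
Qed.

Lemma lebesgue_cbox a b : (forall i, a i <= b i) ->
  lebesgue_rV (cbox a b) = (\prod_i (b i - a i))%:E.
Proof.
move=> ab.
have := @lebesgue_rV_box R n (fun i => `[a i, b i]%classic) (fun i => measurable_itv _).
rewrite (_ : mkset _ = cbox a b); last first.
  by apply/seteqP; split=> x /= H i; have := H i; rewrite in_itv.
move=> ->; rewrite -prodEFin; apply: eq_bigr => i _.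
by rewrite lebesgue_measure_itv/= lte_fin; case: ltgtP (ab i) => // -> _; rewrite subrr.
Qed.

Lemma ballE (c : V) (r : R) : 0 < r ->
  ball c r = obox (fun i => c ord0 i - r) (fun i => c ord0 i + r).
Proof.
move=> r0; apply/seteqP; split=> [x [_ H] i|x H].
  by have := H ord0 i; rewrite /ball/= distrC ltr_distl.
split=> // j i; rewrite (ord1 j); have := H i.
by rewrite /ball/= distrC ltr_distl.
Qed.

Lemma lebesgue_ball (c : V) (r : R) : 0 < r ->
  lebesgue_rV (ball c r) = ((2 * r) ^+ n)%:E.
Proof.
move=> r0; rewrite ballE// lebesgue_obox; last by move=> i; lra.
rewrite (eq_bigr (fun=> 2 * r)); last by move=> i _; lra.
by rewrite big_const_ord iter_mulr_1.
Qed.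

Lemma open_ball_rV (c : V) (r : R) : open (ball c r).
Proof. exact: ball_open. Qed.

Lemma measurable_ball_rV (c : V) (r : R) : measurable (ball c r).
Proof. by apply: open_measurable_rV; exact: open_ball_rV. Qed.

End coordinates.

(** * Fubini's theorem on row vectors *)

Section bounded_support.
Variables (R : realType) (n : nat).
Local Notation V := 'rV[R]_n.
Local Notation mu := (@lebesgue_rV R n).

Definition cube0 (r : R) : set V := cbox (fun=> - r) (fun=> r).

Lemma measurable_cbox (a b : 'I_n -> R) : measurable (@cbox R n a b).
Proof.
rewrite -[cbox a b]setCK; apply: measurableC; apply: open_measurable_rV.
exact/closed_openC/closed_cbox.
Qed.

Lemma lebesgue_cube_lty (r : R) : (mu (cube0 r) < +oo)%E.
Proof.
have [r0|r0] := leP 0 r.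
  by rewrite lebesgue_cbox ?ltry// => i; lra.
apply: (@le_lt_trans _ _ (mu (cube0 0))).
  apply: le_measure; rewrite ?inE; [exact: measurable_cbox..|].
  by move=> x H i; have := H i => /andP[? ?]; lra.
by rewrite lebesgue_cbox ?ltry// => i; lra.
Qed.

Lemma bounded_support_integrable (f : V -> R) (M r : R) :
  measurable_fun setT f -> (forall x, `|f x| <= M) ->
  (forall x, f x != 0 -> cube0 r x) ->
  mu.-integrable setT (EFin \o f).
Proof.
move=> mf fM fr; set D := cube0 r in fr.
have mD : measurable D by exact: measurable_cbox.
have fE : EFin \o f = (EFin \o f) \_ D.
  apply/funext => x; rewrite patchE; case: ifPn => //= xD.
  case: (eqVneq (f x) 0) => [->//|/fr fx].
  by move: xD; rewrite notin_setE.
rewrite fE -integrable_mkcond//.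
apply: measurable_bounded_integrable => //.
- exact: lebesgue_cube_lty.
- exact: measurable_funS mf.
- exists M; split; first exact: num_real.
  by move=> N MN x _ /=; apply: le_trans (fM x) (ltW MN).
Qed.

Lemma continuous_support_bounded (f : V -> R) (r : R) :
  continuous f -> (forall x, f x != 0 -> cube0 r x) ->
  exists2 M, 0 <= M & forall x, `|f x| <= M.
Proof.
move=> cf fr; set D := cube0 r in fr.
have cD : compact D by exact: compact_cbox.
have := @continuous_compact _ _ f D (continuous_subspaceT cf) cD.
move=> /compact_bounded[M [_ HM]].
exists (`|M| + 1); first by rewrite addr_ge0.
move=> x; case: (eqVneq (f x) 0) => [->|fx]; first by rewrite normr0 addr_ge0.
apply: (HM (`|M| + 1)); last by exists x => //; exact: fr.
by rewrite ltr_pwDr// ler_norm.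
Qed.

Lemma continuous_support_integrable (f : V -> R) (r : R) :
  continuous f -> (forall x, f x != 0 -> cube0 r x) ->
  mu.-integrable setT (EFin \o f).
Proof.
move=> cf fr; have [M _ HM] := continuous_support_bounded cf fr.
by apply: bounded_support_integrable HM fr; exact: continuous_measurable_rV.
Qed.

End bounded_support.

Section fubini_rV.
Variables (R : realType) (n : nat).
Local Notation mu := (@lebesgue_rV R n.+1).
Local Notation nu := (@lebesgue_rV R n).
Local Notation cons := (@rV_cons R n).
Local Open Scope ereal_scope.

Lemma ge0_integral_rV_cons (f : 'rV[R]_n.+1 -> \bar R) :
  measurable_fun setT f -> (forall x, 0 <= f x) ->
  \int[mu]_x f x = \int[@lebesgue_measure R \x nu]_z f (cons z).
Proof.
move=> mf f0; rewrite -[LHS]/(\int[pushforward (@lebesgue_measure R \x nu) cons]_x f x).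
by rewrite (ge0_integral_pushforward (@measurable_rV_cons R n)).
Qed.

Lemma integrable_rV_cons (f : 'rV[R]_n.+1 -> \bar R) :
  mu.-integrable setT f -> (@lebesgue_measure R \x nu).-integrable setT (f \o cons).
Proof.
move=> /integrableP[mf foo]; apply/integrableP; split.
  by apply: measurableT_comp => //; exact: measurable_rV_cons.
apply: le_lt_trans foo; rewrite ge0_integral_rV_cons//.
exact: measurableT_comp.
Qed.

Lemma integral_rV_cons (f : 'rV[R]_n.+1 -> \bar R) :
  mu.-integrable setT f ->
  \int[mu]_x f x = \int[@lebesgue_measure R \x nu]_z f (cons z).
Proof.
move=> intf; rewrite -[LHS]/(\int[pushforward (@lebesgue_measure R \x nu) cons]_x f x).
rewrite (integral_pushforward (@measurable_rV_cons R n))//.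
- by have /integrableP[] := intf.
- by rewrite preimage_setT; exact: integrable_rV_cons.
Qed.

Lemma fubini_rV12 (f : 'rV[R]_n.+1 -> \bar R) :
  mu.-integrable setT f ->
  \int[mu]_x f x = \int[@lebesgue_measure R]_t \int[nu]_x f (cons (t, x)).
Proof.
move=> intf; rewrite integral_rV_cons//.
by rewrite -integral12_prod_meas1//; exact: integrable_rV_cons.
Qed.

Lemma fubini_rV21 (f : 'rV[R]_n.+1 -> \bar R) :
  mu.-integrable setT f ->
  \int[mu]_x f x = \int[nu]_x \int[@lebesgue_measure R]_t f (cons (t, x)).
Proof.
move=> intf; rewrite integral_rV_cons//.
by rewrite -integral21_prod_meas1//; exact: integrable_rV_cons.
Qed.

End fubini_rV.

Section integral_partial.
Variable R : realType.

Lemma integral_derive_line (F f : R -> R) (a b : R) : a < b ->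
  (forall t : R, is_derive t 1 F (f t)) -> continuous f ->
  (forall t, f t != 0 -> a <= t <= b) ->
  (\int[@lebesgue_measure R]_t (f t)%:E = (F b - F a)%:E)%E.
Proof.
move=> ab Ff cf supp.
have cF : continuous F.
  by move=> x; apply: differentiable_continuous; apply/derivable1_diffP; have [] := Ff x.
have -> : (fun t => (f t)%:E) = (fun t => (f t)%:E) \_ `[a, b]%classic.
  apply/funext => t; rewrite patchE; case: ifPn => // tab.
  case: (eqVneq (f t) 0) => [->//|/supp tab'].
  by move: tab; rewrite notin_setE /= in_itv/=.
rewrite -integral_mkcond (continuous_FTC2 (F := F))//.
- exact: continuous_subspaceT.
- split.
  + by move=> x _; have [] := Ff x.
  + exact/cvg_at_right_filter/cF.
  + exact/cvg_at_left_filter/cF.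
- by move=> x _; rewrite derive1E; have [_ ->] := Ff x.
Qed.

Lemma rV_cons_shift n (h t : R) (v x : 'rV[R]_n) i :
  rV_cons (t, h *: delta_mx ord0 i + x) =
  h *: delta_mx ord0 (lift ord0 i) + rV_cons (t, x) :> 'rV[R]_n.+1.
Proof.
apply/rowP => j; rewrite !mxE eqxx /=; case: unliftP => [k ->|->] /=.
  by rewrite !mxE (inj_eq (@lift_inj _ ord0)) eqxx.
by rewrite ?(negbTE (neq_lift _ _)) mulr0 add0r.
Qed.

Lemma rV_cons_shift0 n (h t : R) (x : 'rV[R]_n) :
  rV_cons (h + t, x) = h *: delta_mx ord0 ord0 + rV_cons (t, x) :> 'rV[R]_n.+1.
Proof.
apply/rowP => j; rewrite !mxE eqxx /=; case: unliftP => [k ->|->] /=.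
  by rewrite ?(negbTE (neq_lift _ _)) mulr0 add0r.
by rewrite mulr1.
Qed.

Lemma continuous_rV_cons n (t : R) : continuous (fun x : 'rV[R]_n => rV_cons (t, x)).
Proof.
move=> x A /nbhs_ballP[e /= e0 eA]; apply/nbhs_ballP; exists e => // y [_ xy].
apply: eA; split=> // i j.
by rewrite !mxE; case: unliftP => [k _|_] /=; [exact: xy|exact: ballxx].
Qed.

Lemma continuous_rV_cons0 n (x : 'rV[R]_n) : continuous (fun t : R => rV_cons (t, x)).
Proof.
move=> t A /nbhs_ballP[e /= e0 eA]; apply/nbhs_ballP; exists e => // s ts.
apply: eA; split=> // i j.
by rewrite !mxE; case: unliftP => [k _|_] /=; [exact: ballxx|exact: ts].
Qed.

(** Induction on the dimension by Fubini. If [i] is not the first coordinate, that coordinate is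
    frozen and the induction hypothesis applies to each slice; otherwise the inner integral runs
    along the first coordinate and vanishes by the fundamental theorem of calculus. *)
Lemma integral_partial n (F f : 'rV[R]_n -> R) i r : 0 < r ->
  (forall x, is_derive x (delta_mx ord0 i) F (f x)) -> continuous f ->
  (forall x, (F x != 0) || (f x != 0) -> cube0 r x) ->
  (\int[@lebesgue_rV R n]_x (f x)%:E = 0)%E.
Proof.
elim: n F f i => [F f []//|n IH F f i r0 Ff cf supp].
have intf : (@lebesgue_rV R n.+1).-integrable setT (EFin \o f).
  by apply: continuous_support_integrable cf _ => x fx; apply: supp; rewrite fx orbT.
case: (unliftP ord0 i) => [j ij|i0].
  rewrite (fubini_rV12 intf) integral0_eq// => t _ /=.
  apply: (IH (fun x => F (rV_cons (t, x))) _ j) => //.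
  - move=> x; apply/is_derive_lineP.
    have /is_derive_lineP := Ff (rV_cons (t, x)).
    by move=> /is_derive_ext; apply=> // h /=; rewrite rV_cons_shift// ij.
  - by move=> x; apply: continuous_comp; [exact: continuous_rV_cons|exact: cf].
  - move=> x /supp H k; have := H (lift ord0 k).
    by rewrite mxE liftK.
rewrite (fubini_rV21 intf) integral0_eq// => x _ /=.
have out t : ~~ (- r <= t <= r) -> F (rV_cons (t, x)) = 0 /\ f (rV_cons (t, x)) = 0.
  move=> H; suff : ~~ ((F (rV_cons (t, x)) != 0) || (f (rV_cons (t, x)) != 0)).
    by rewrite negb_or !negbK => /andP[/eqP-> /eqP->].
  apply: contraNN H => /supp/(_ ord0).
  by rewrite mxE unlift_none.
have D (t : R) : is_derive t 1 (fun t => F (rV_cons (t, x))) (f (rV_cons (t, x))).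
  have /is_derive_lineP := Ff (rV_cons (t, x)).
  rewrite i0 => D.
  have dA : is_derive t 1 (fun s : R => s - t) 1.
    have := is_deriveD (is_derive_id t (1 : R)) (is_derive_cst (- t) t (1 : R)).
    by move=> /is_derive_ext; apply=> //; rewrite addr0.
  have D' : is_derive (t - t) 1 (fun h => F (h *: delta_mx ord0 ord0 + rV_cons (t, x)))
      (f (rV_cons (t, x))) by rewrite subrr.
  have := @is_derive1_comp _ _ (fun s => s - t) _ _ _ D' dA.
  move=> /is_derive_ext; apply; last by rewrite mulr1.
  by move=> s /=; rewrite -rV_cons_shift0 subrK.
have C : continuous (fun t => f (rV_cons (t, x))).
  by move=> t; apply: continuous_comp; [exact: continuous_rV_cons0|exact: cf].
(* The interval is enlarged by 1 because [F] is only assumed to vanish outside the closed cube; at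
   the new endpoints it is certainly 0. *)
have S t : f (rV_cons (t, x)) != 0 -> - r - 1 <= t <= r + 1.
  move=> ft; suff : - r <= t <= r by move=> /andP[? ?]; lra.
  by apply: contraNT ft => /out[_ ->].
have ab : - r - 1 < r + 1 by lra.
rewrite (integral_derive_line ab D C S).
have /out[-> _] : ~~ (- r <= r + 1 <= r) by apply/negP => /andP[_]; lra.
have /out[-> _] : ~~ (- r <= - r - 1 <= r) by apply/negP => /andP[]; lra.
by rewrite subrr.
Qed.

Lemma integral_prodf n (f : 'I_n -> R -> R) r : (forall i, continuous (f i)) ->
  (forall i t, f i t != 0 -> - r <= t <= r) ->
  (\int[@lebesgue_rV R n]_x (prodf f x)%:E =
    (\prod_i fine (\int[@lebesgue_measure R]_t (f i t)%:E))%:E)%E.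
Proof.
elim: n f => [f cf supp|n IH f cf supp].
  rewrite big_ord0 (eq_integral (cst 1%E)); last by move=> x _; rewrite /prodf big_ord0.
  by rewrite integral_cst//= mul1e diracE mem_set.
have sup x : prodf f x != 0 -> cube0 r x.
  by move=> /prodf_neq0 H i; exact/supp/H.
have intf : (@lebesgue_rV R n.+1).-integrable setT (EFin \o prodf f).
  exact: continuous_support_integrable (continuous_prodf cf) sup.
have int1 : (@lebesgue_measure R).-integrable setT (EFin \o f ord0).
  have -> : EFin \o f ord0 = (EFin \o f ord0) \_ `[- r, r]%classic.
    apply/funext => t; rewrite patchE; case: ifPn => // tab.
    case: (eqVneq (f ord0 t) 0) => [/= ->//|/supp tab'].
    by move: tab; rewrite notin_setE /= in_itv/=.
  rewrite -integrable_mkcond//; apply: continuous_compact_integrable.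
    exact: segment_compact.
  exact/continuous_subspaceT.
rewrite (fubini_rV12 intf) /=.
under eq_integral => t _.
  rewrite (_ : (fun x => _) = fun x => ((f ord0 t)%:E *
     (prodf (fun i => f (lift ord0 i)) x)%:E)%E); last first.
    apply/funext => x; rewrite /prodf big_ord_recl mxE unlift_none EFinM.
    by congr (_ * (_)%:E)%E; apply: eq_bigr => i _; rewrite mxE liftK.
  rewrite integralZl//; last first.
    apply: (@continuous_support_integrable _ _ _ r).
      by apply: continuous_prodf => i; exact: cf.
    by move=> x /prodf_neq0 H i; exact/supp/H.
  rewrite IH//; last by move=> i; exact: supp.
  over.
rewrite integralZr// big_ord_recl EFinM fineK//.
exact: integrable_fin_num.
Qed.

End integral_partial.

(** * The fundamental lemma of the calculus of variations *)

Section boxes.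
Variables (R : realType) (n : nat).
Local Notation V := 'rV[R]_n.
Local Notation mu := (@lebesgue_rV R n).

Definition oboxes : set (set V) := [set A | exists a b, A = obox a b].

Lemma oboxI (a b a' b' : 'I_n -> R) : @obox R n a b `&` obox a' b' =
  obox (fun i => Num.max (a i) (a' i)) (fun i => Num.min (b i) (b' i)).
Proof.
apply/seteqP; split=> [x [H H'] i|x H].
  by have := H i; have := H' i => /= /andP[a1 b1] /andP[a2 b2]; rewrite gt_max lt_min a1 a2 b1 b2.
by split=> i; have /= := H i; rewrite gt_max lt_min => /andP[/andP[a1 a2] /andP[b1 b2]];
  rewrite ?a1 ?a2 ?b1 ?b2.
Qed.

(** Boxes are stable under intersection, so Dynkin induction from boxes reaches all Borel sets. A
    slab in one coordinate is a countable union of boxes that grow in the other coordinates. *)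
Lemma measurable_oboxes : @measurable _ V = <<s oboxes >>.
Proof.
apply/seteqP; split; last first.
  apply: smallest_sub; first exact: sigma_algebra_measurable.
  by move=> _ [a [b ->]]; exact: measurable_obox.
change (g_sigma_preimage (@rV_coord R n) `<=` <<s oboxes>>).
apply: smallest_sub; first exact: smallest_sigma_algebra.
move=> A; rewrite -bigcup_seq => -[i _ [B mB <-]]; rewrite setTI.
pose S := [set B | <<s oboxes >> (@rV_coord R n i @^-1` B)].
suff : @measurable _ (measurableTypeR R) `<=` S by apply.
have -> : @measurable _ (measurableTypeR R) = <<s @RGenOpens.G R >>.
  exact: RGenOpens.measurableE.
have [s0 sC sU] := smallest_sigma_algebra setT oboxes.
apply: smallest_sub.
  split; rewrite /S /=.
  - by rewrite preimage_set0.
  - by move=> X SX; rewrite setTD preimage_setC -setTD; exact: sC.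
  - by move=> F SF; rewrite preimage_bigcup; exact: sU.
move=> _ [x [y ->]]; rewrite /S /=.
have -> : @rV_coord R n i @^-1` `]x, y[%classic =
    \bigcup_k obox (fun j => if j == i then x else - k%:R)
                   (fun j => if j == i then y else k%:R).
  apply/seteqP; split=> [z /=|z [k _] /(_ i)]; last first.
    by rewrite eqxx /rV_coord /= in_itv.
  rewrite /rV_coord in_itv /= => zi.
  pose M := \sum_j `|z ord0 j|.
  exists (Num.truncn M).+1 => // j; case: eqVneq => [->//|ji].
  rewrite -ltr_norml; apply: le_lt_trans (truncnS_gt M).
  by rewrite /M (bigD1 j)//= lerDl sumr_ge0.
by apply: sU => k; apply: sub_sigma_algebra; do 2 eexists.
Qed.

Lemma open_bigcup_cubes (G : set V) : open G ->
  exists (P : set nat) (W : nat -> ('I_n -> R) * ('I_n -> R)),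
    (forall k, P k -> cbox (W k).1 (W k).2 `<=` G) /\
    G `<=` \bigcup_(k in P) obox (W k).1 (W k).2.
Proof.
move=> oG.
pose w (ck : 'rV[rat]_n * nat) : ('I_n -> R) * ('I_n -> R) :=
  (fun i => ratr (ck.1 ord0 i) - ck.2.+1%:R^-1, fun i => ratr (ck.1 ord0 i) + ck.2.+1%:R^-1).
(* Rational cubes are indexed by [nat] through [pickle], so that almost-everywhere statements on
   them can be gathered by [ae_foralln]. *)
have [W WK] : exists W, forall ck, W (pickle ck) = w ck.
  by exists (fun k => w (odflt (0, 0%N) (unpickle k))) => ck; rewrite pickleK.
exists [set k | cbox (W k).1 (W k).2 `<=` G], W; split=> // x Gx.
have /nbhs_ballP[e /= e0 eG] : nbhs x G by exact: open_nbhs_nbhs.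
have [k ke] : exists k, k.+1%:R^-1 < e / 2.
  have e20 : 0 < e / 2 by rewrite divr_gt0.
  exists (Num.truncn (e / 2)^-1); rewrite invf_plt ?posrE//.
  by rewrite truncnS_gt.
pose r : R := k.+1%:R^-1.
have r0 : 0 < r by rewrite /r invr_gt0.
have /choice[c cE] (i : 'I_n) : exists c : rat, x ord0 i - r < ratr c < x ord0 i + r.
  have /rat_in_itvoo[c] : x ord0 i - r < x ord0 i + r by lra.
  by rewrite in_itv/= => H; exists c.
have WE := WK (\row_i c i, k).
move: (pickle _) WE => m WE.
exists m; rewrite /= WE; last first.
  by move=> i; rewrite /= mxE -/r; have /andP[? ?] := cE i; apply/andP; split; lra.
move=> y Hy; apply: eG; split=> // j i; rewrite (ord1 j).
rewrite -/r in ke; have := Hy i; rewrite /= mxE -/r => /andP[? ?]; have /andP[? ?] := cE i.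
by rewrite /ball/= ltr_distlC; apply/andP; split; lra.
Qed.

End boxes.

Section fundamental_lemma.
Variables (R : realType) (n : nat).
Local Notation V := 'rV[R]_n.
Local Notation mu := (@lebesgue_rV R n).
Variables (G : set V) (h : V -> R).
Hypotheses (oG : open G) (hG : loc_integrable G h).
Hypothesis h0 : forall phi, test_function G phi ->
  \int[mu]_(x in G) (h x * phi x) = 0.

Lemma integrable_sub_cbox (a b : 'I_n -> R) A : measurable A -> cbox a b `<=` G ->
  A `<=` cbox a b -> mu.-integrable A (EFin \o h).
Proof.
move=> mA abG Aab; apply: integrableS Aab _ => //; first exact: measurable_cbox.
by have [_] := hG; apply=> //; exact: compact_cbox.
Qed.

(** A smooth approximation from inside of the indicator of []a i, b i[]: the first factor is step(k
    (t - a) - 1), equal to 0 for t <= a and to 1 once t - a >= 2/k, and the second is its mirror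
    image at b. *)
Definition box_bump (a b : 'I_n -> R) (k : nat) (i : 'I_n) (t : R) : R :=
  step (k%:R * t + (- k%:R * a i - 1)) * step (- k%:R * t + (k%:R * b i - 1)).

Lemma box_bump_out a b k i t : ~~ (a i < t < b i) -> box_bump a b k i t = 0.
Proof.
rewrite negb_and -!leNgt /box_bump => /orP[ta|bt].
  rewrite step0 ?mul0r// mulNr -subr_le0.
  have : k%:R * (t - a i) <= 0 by rewrite mulr_ge0_le0// subr_le0.
  lra.
rewrite [X in _ * X]step0 ?mulr0// mulNr -subr_le0.
have : k%:R * (b i - t) <= 0 by rewrite mulr_ge0_le0// subr_le0.
lra.
Qed.

Lemma box_bump_in a b i t : a i < t < b i ->
  \forall k \near \oo, box_bump a b k i t = 1.
Proof.
move=> /andP[ta bt].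
pose c := Num.min (t - a i) (b i - t).
have c0 : 0 < c by rewrite lt_min !subr_gt0 ta.
near=> k.
have kc : 2 <= k%:R * c.
  rewrite -ler_pdivrMr//; near: k; exact: nbhs_infty_ger.
have k1 : k%:R * c <= k%:R * (t - a i) by rewrite ler_wpM2l// ge_min lexx.
have k2 : k%:R * c <= k%:R * (b i - t) by rewrite ler_wpM2l// ge_min lexx orbT.
rewrite /box_bump !step1 ?mulr1// !mulNr; lra.
Unshelve. all: by end_near. Qed.

Lemma box_bump01 a b k i t : 0 <= box_bump a b k i t <= 1.
Proof. by rewrite mulr_ge0 ?step_ge0//= mulr_ile1 ?step_ge0 ?step_le1. Qed.

Lemma prodf_box_bump_cvg a b x :
  prodf (box_bump a b k) x @[k --> \oo] --> (\1_(obox a b) x : R).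
Proof.
rewrite indicE; case: (boolP (x \in obox a b)) => [/set_mem xab|/negP xab] /=.
  apply: cvg_near_cst.
  have : \forall k \near \oo, forall i, box_bump a b k i (x ord0 i) = 1.
    apply: filter_forall => i; exact: box_bump_in.
  by apply: filterS => k Hk; rewrite /prodf big1.
apply: cvg_near_cst; apply: nearW => k.
have [i /negP xi] : exists i, ~ (a i < x ord0 i < b i).
  by apply: contrapT => /forallNP H; apply: xab; rewrite inE => i; apply: contrapT; exact: H.
apply/eqP; rewrite /prodf prodf_seq_eq0; apply/hasP; exists i.
  exact: mem_index_enum.
by rewrite box_bump_out ?eqxx.
Qed.

(** The products of [box_bump] are test functions with values in [0, 1] that converge to the
    indicator of the open box; dominated convergence, with [|h|] on the closed box as dominating
    function, carries [h0] to the limit. *)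
Lemma integral_obox0 a b : cbox a b `<=` G ->
  (\int[mu]_(x in obox a b) (h x)%:E = 0)%E.
Proof.
move=> abG; set D := cbox a b.
have mD : measurable D by exact: measurable_cbox.
have iD : mu.-integrable D (EFin \o h) by exact: (integrable_sub_cbox _ abG).
have mhD : measurable_fun D h by have /integrableP[/measurable_EFinP] := iD.
have smo k i : smooth_line (box_bump a b k i).
  by move=> m; apply: CnM; apply: Cn_affine; exact: smooth_line_step.
have tk k : test_function G (prodf (box_bump a b k)).
  apply: (@test_prodf _ _ _ _ a b) => // j t; apply: contraNT => H.
  by rewrite box_bump_out//; apply: contra H => /andP[/ltW -> /ltW ->].
pose f k x := (h x * prodf (box_bump a b k) x)%:E.
have fout k x : ~ D x -> prodf (box_bump a b k) x = 0.
  move=> Dx; have [i xi] : exists i, ~~ (a i <= x ord0 i <= b i).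
    apply: contrapT => /forallNP H; apply: Dx => i; apply: contrapT => /negP; exact: H.
  apply/eqP; rewrite /prodf prodf_seq_eq0; apply/hasP.
  exists i; rewrite ?mem_index_enum// box_bump_out ?eqxx//.
  by apply: contra xi => /andP[/ltW -> /ltW ->].
have f01 k x : `|prodf (box_bump a b k) x| <= 1.
  rewrite /prodf; elim/big_ind : _ => [|u v u1 v1|i _].
  - by rewrite normr1.
  - by rewrite normrM mulr_ile1.
  - by have /andP[? ?] := box_bump01 a b k i (x ord0 i); rewrite ger0_norm.
have mphi k : measurable_fun D (prodf (box_bump a b k)).
  apply: (@measurable_funS _ _ _ _ setT) => //; apply: continuous_measurable_rV.
  by apply: continuous_prodf => i; exact: smooth_line_continuous.
have mf k : measurable_fun D (f k).
  by apply/measurable_EFinP; exact: measurable_funM.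
have fk0 k : (\int[mu]_(x in D) f k x = 0)%E.
  have := h0 (tk k); rewrite /Rintegral.
  rewrite (integral_mkcond G) (_ : _ \_ G = (f k) \_ D); last first.
    apply/funext => x; rewrite !patchE.
    case: ifPn => [xG|/negP xG]; case: ifPn => [xD|/negP xD] //.
      by rewrite fout ?mulr0// => Dx; apply: xD; rewrite inE.
    by exfalso; apply: xG; exact/mem_set/abG/set_mem.
  rewrite -integral_mkcond.
  have : mu.-integrable D (f k).
    apply: le_integrable iD => //= x Dx.
    by rewrite lee_fin normrM ler_piMr.
  by move=> /(integrable_fin_num mD) fin H; rewrite -(fineK fin) H.
have cvf x : D x -> f k x @[k --> \oo] --> (EFin \o (h \* \1_(obox a b))) x.
  move=> _; apply: cvg_EFin; first exact: nearW.
  by apply: cvgM; [exact: cvg_cst|exact: prodf_box_bump_cvg].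
have mlim : measurable_fun D (EFin \o (h \* \1_(obox a b))).
  apply/measurable_EFinP/measurable_funM => //.
  by apply: measurable_indic; exact: measurable_obox.
have dom : {ae mu, forall x k, D x -> (`|f k x| <= (EFin \o (Num.norm \o h)) x)%E}.
  by apply: aeW => x k _; rewrite /= lee_fin normrM ler_piMr.
have [_ _] := dominated_convergence mD mf mlim (aeW _ cvf) (integrable_norm iD) dom.
rewrite (_ : [sequence _]_n = cst 0%E); last by apply/funext => k /=; exact: fk0.
move=> /(cvg_unique (@ereal_hausdorff _) (cvg_cst 0%E)) => H.
rewrite [RHS]H [RHS](integral_mkcond D) [LHS](integral_mkcond (obox a b)).
apply: eq_integral => x _; rewrite !patchE /= indicE.
case: ifPn => [xo|_]; case: ifPn => [|/negP xD] //=; rewrite ?mulr1 ?mulr0 //.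
exfalso; apply: xD; move/set_mem : xo => xo; apply/mem_set => i.
by have /andP[/ltW -> /ltW ->] := xo i.
Qed.

Lemma fundamental_lemma : {ae mu, forall x, G x -> h x = 0}.
Proof.
have [P [W [WG GW]]] := open_bigcup_cubes oG.
suff H k : {ae mu, forall x, P k -> obox (W k).1 (W k).2 x -> h x = 0}.
  have := ae_foralln H; apply: filterS => x Hx /GW[k Pk Wx].
  exact: (Hx k Pk Wx).
have [Pk|nPk] := pselect (P k); last by apply: aeW => x /nPk.
have {}WG := WG k Pk.
set a := (W k).1; set b := (W k).2; set D := obox a b.
have mD : measurable D by exact: measurable_obox.
have Dab : D `<=` cbox a b by move=> x Dx i; have /andP[/ltW -> /ltW ->//] := Dx i.
have iD : mu.-integrable D (EFin \o h) by exact: (integrable_sub_cbox mD WG Dab).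
(* Dynkin's theorem passes from boxes to all Borel sets; an integrable function whose integral
   vanishes over every measurable subset of [D] is 0 almost everywhere there. *)
have key A : measurable A -> (\int[mu]_(x in A `&` D) (h x)%:E = 0)%E.
  move=> mA; have := mA; rewrite measurable_oboxes.
  apply: (@dynkin_induction _ _ (@oboxes R n)
    (fun A => (\int[mu]_(x in A `&` D) (h x)%:E = 0)%E)) => //.
  - exact: measurable_oboxes.
  - by move=> _ _ [a1 [b1 ->]] [a2 [b2 ->]]; rewrite oboxI; do 2 eexists.
  - by rewrite setTI integral_obox0//; exact: WG.
  - move=> _ [a1 [b1 ->]]; rewrite oboxI integral_obox0// => x H.
    apply: WG => i; have := H i.
    by rewrite ge_max le_min => /andP[/andP[_ ->] /andP[_ ->]].
  - move=> S mS S0 /=.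
    have : (\int[mu]_(x in D) (h x)%:E = 0)%E by rewrite integral_obox0//; exact: WG.
    rewrite -{1}[D](setUIDK _ S) integral_setU.
    + by rewrite [D `&` S]setIC S0 add0e setDE setIC.
    + exact: measurableI.
    + exact: measurableD.
    + by rewrite setUIDK; have /integrableP[] := iD.
    + by apply/disj_set2P/seteqP; split=> // x [[_ Sx] [_]].
  - move=> F mF tF F0; rewrite setI_bigcupl integral_bigcup//.
    + by rewrite eseries0.
    + exact: trivIset_setIr.
    + by move=> i; exact: measurableI.
    + rewrite -setI_bigcupl; apply: integrableS iD => //.
      by apply: measurableI => //; exact: bigcupT_measurable.
have := @integral_ae_eq _ _ _ mu D mD (cst 0%E) (EFin \o h) iD (measurable_cst _).
move=> /(_ _)[E ED mE|N [mN N0 NN]].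
  by rewrite integral_cst//= mul0e -{1}(setIidl ED) key.
exists N; split=> // x /= xH; apply: NN => /= H; apply: xH => _ Dx.
by have [] := H Dx.
Qed.

End fundamental_lemma.

(** * Weak gradients *)

Section weak_gradient.
Variables (R : realType) (n : nat).
Local Notation V := 'rV[R]_n.
Local Notation mu := (@lebesgue_rV R n).
Implicit Types (G : set V) (u f phi : V -> R) (g : V -> V).

Lemma coord_le_norm (x : V) i : `|x ord0 i| <= `|x|.
Proof.
rewrite [leRHS]/Num.norm /= mx_normrE; apply/bigmax_geP; right => /=.
by exists (ord0, i).
Qed.

Lemma bounded_cube0 (B : set V) : bounded_set B -> exists r, B `<=` @cube0 R n r.
Proof.
move=> [M [_ HM]]; exists (`|M| + 1) => x Bx i.
rewrite -ler_norml; apply: le_trans (coord_le_norm x i) _.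
by apply: (HM (`|M| + 1)) => //; rewrite ltr_pwDr// ler_norm.
Qed.

Lemma compact_cube0 (K : set V) : compact K -> exists r, K `<=` @cube0 R n r.
Proof. by move=> /compact_bounded; exact: bounded_cube0. Qed.

Lemma measurable_compact_rV (K : set V) : compact K -> measurable K.
Proof.
move=> cK; rewrite -[K]setCK; apply: measurableC; apply: open_measurable_rV.
by apply: closed_openC; apply: compact_closed => //; exact: norm_hausdorff.
Qed.

Lemma compact_lty (K : set V) : compact K -> (mu K < +oo)%E.
Proof.
move=> cK; have [r Kr] := compact_cube0 cK.
apply: le_lt_trans (lebesgue_cube_lty n r); apply: le_measure => //; rewrite inE.
  exact: measurable_compact_rV.
exact: measurable_cbox.
Qed.

Lemma loc_integrable_continuous G f : measurable G -> continuous f -> loc_integrable G f.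
Proof.
move=> mG cf; split.
  by apply: measurable_funS (continuous_measurable_rV cf).
move=> K cK KG; apply: measurable_bounded_integrable.
- exact: measurable_compact_rV.
- exact: compact_lty.
- by apply: measurable_funS (continuous_measurable_rV cf).
- have := @continuous_compact _ _ f K (continuous_subspaceT cf) cK.
  move=> /compact_bounded[M [Mr HM]]; exists M; split=> // N MN x Kx.
  by apply: HM MN _ _; exists x.
Qed.

Section test_function.
Variables (G : set V) (phi : V -> R).
Hypothesis tphi : test_function G phi.

Lemma test_function_continuous : continuous phi.
Proof. by have [/(_ [::])[]] := tphi. Qed.

Lemma test_function_partial_continuous i : continuous (partial i phi).
Proof. by have [/(_ [:: i])[]] := tphi. Qed.

Lemma test_function_is_derive i x : is_derive x (delta_mx ord0 i) phi (partial i phi x).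
Proof. by have [/(_ [::])[_ /(_ i x)]] := tphi; split. Qed.

Let K := closure [set x | phi x != 0].

Lemma test_function_out x : ~ K x -> phi x = 0 /\ forall i, partial i phi x = 0.
Proof.
move=> Kx; have nz : \forall y \near x, phi y = 0.
  have oK : open (~` K) by apply: closed_openC; exact: closed_closure.
  have : nbhs x (~` K) by exact: open_nbhs_nbhs.
  apply: filterS => y Ky; apply/eqP; apply: contrapT => /negP py; apply: Ky.
  exact: subset_closure.
split; first exact: nbhs_singleton nz.
move=> i; rewrite /partial (@near_eq_derive _ _ _ phi (cst (0 : R))) ?derive_cst//.
Qed.

Lemma test_function_cube : exists r, forall x, K x -> @cube0 R n r x.
Proof. by have [_ cK _] := tphi; exact: compact_cube0. Qed.

Lemma test_function_bounded : exists2 M, 0 <= M & forall x, `|phi x| <= M.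
Proof.
have [r Kr] := test_function_cube.
apply: (@continuous_support_bounded _ _ _ r); first exact: test_function_continuous.
by move=> x px; apply: Kr; exact: subset_closure.
Qed.

Lemma test_function_partial_bounded i : exists2 M, 0 <= M & forall x, `|partial i phi x| <= M.
Proof.
have [r Kr] := test_function_cube.
apply: (@continuous_support_bounded _ _ _ r); first exact: test_function_partial_continuous.
move=> x px; apply: Kr; apply: contrapT => /test_function_out[_ /(_ i)] p0.
by rewrite p0 eqxx in px.
Qed.

(* [psi] is [phi] or one of its partial derivatives. *)
Lemma loc_integrable_mul f psi : measurable G -> loc_integrable G f -> continuous psi ->
  (exists2 M, 0 <= M & forall x, `|psi x| <= M) ->
  (forall x, ~ K x -> psi x = 0) ->
  mu.-integrable G (EFin \o (f \* psi)).
Proof.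
move=> mG [mf If] cpsi [M M0 HM] psi0; have [_ cK KG] := tphi.
have mK : measurable K by exact: measurable_compact_rV.
rewrite (_ : EFin \o _ = (EFin \o (f \* psi)) \_ K); last first.
  apply/funext => x; rewrite patchE; case: ifPn => //= /negP xK.
  by rewrite psi0 ?mulr0// => Kx; apply: xK; rewrite inE.
apply/(integrable_mkcond _ mG).
rewrite (_ : _ \_ G = (EFin \o (f \* psi)) \_ K); last first.
  apply/funext => x; rewrite !patchE; case: ifPn => //= /negP xG; case: ifPn => // /set_mem/KG xG'.
  by exfalso; apply: xG; rewrite inE.
apply/(integrable_mkcond _ mK).
have IK := If K cK KG.
have IM : mu.-integrable K (fun x => (M%:E * (EFin \o f) x)%E) by apply: integrableZl.
apply: le_integrable IM => //.
  apply/measurable_EFinP; apply: measurable_funM; first exact: measurable_funS mf.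
  by apply: measurable_funS (continuous_measurable_rV cpsi).
move=> x Kx; rewrite /= lee_fin !normrM (ger0_norm M0) mulrC.
by rewrite ler_wpM2r.
Qed.

End test_function.

Lemma integrable_mul_test G f phi : measurable G -> loc_integrable G f ->
  test_function G phi -> mu.-integrable G (EFin \o (f \* phi)).
Proof.
move=> mG If tphi; apply: (loc_integrable_mul tphi) => //.
- exact: test_function_continuous tphi.
- exact: test_function_bounded tphi.
- by move=> x /test_function_out[].
Qed.

Lemma integrable_mul_partial G f phi i : measurable G -> loc_integrable G f ->
  test_function G phi -> mu.-integrable G (EFin \o (f \* partial i phi)).
Proof.
move=> mG If tphi; apply: (loc_integrable_mul tphi) => //.
- exact: test_function_partial_continuous tphi _.
- exact: test_function_partial_bounded tphi _.
- by move=> x /test_function_out[_].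
Qed.

Lemma loc_integrableB G f1 f2 : measurable G -> loc_integrable G f1 ->
  loc_integrable G f2 -> loc_integrable G (f1 \- f2).
Proof.
move=> mG [m1 i1] [m2 i2]; split; first exact: measurable_funB.
move=> K cK KG; have := integrableB (measurable_compact_rV cK) (i1 K cK KG) (i2 K cK KG).
by apply: eq_integrable => //; exact: measurable_compact_rV.
Qed.

Lemma weak_gradient_unique G u g1 g2 : open G ->
  is_weak_gradient G u g1 -> is_weak_gradient G u g2 ->
  {ae mu, forall x, G x -> g1 x = g2 x}.
Proof.
move=> oG w1 w2; have mG := open_measurable_rV oG.
have H i : {ae mu, forall x, G x -> g1 x ord0 i - g2 x ord0 i = 0}.
  have [l1 e1] := w1 i; have [l2 e2] := w2 i.
  apply: fundamental_lemma => //; first exact: loc_integrableB.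
  move=> phi tphi.
  under eq_Rintegral do rewrite mulrBl.
  rewrite RintegralB//; [|exact: integrable_mul_test l1 tphi|exact: integrable_mul_test l2 tphi].
  by apply/eqP; rewrite subr_eq0 -eqr_opp -e1// -e2.
have {}H : {ae mu, forall x, forall i : 'I_n, G x -> g1 x ord0 i - g2 x ord0 i = 0}.
  by apply: filter_forall.
apply: filterS H => x Hx Gx; apply/rowP => i; apply/eqP; rewrite -subr_eq0; apply/eqP.
exact: Hx.
Qed.

(** The function u phi has compact support in [G] and is continuously differentiable, so the
    integral of its partial derivative, given by the product rule, is 0 by [integral_partial]. *)
Lemma classical_is_weak_gradient G u g : open G ->
  (forall i x, is_derive x (delta_mx ord0 i) u (g x ord0 i)) ->
  continuous u -> (forall i, continuous (fun x => g x ord0 i)) ->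
  is_weak_gradient G u g.
Proof.
move=> oG ug cu cg i; have mG := open_measurable_rV oG.
have lu := loc_integrable_continuous mG cu.
have lg := loc_integrable_continuous mG (cg i).
split=> // phi tphi; have [_ _ KG] := tphi.
apply/eqP; rewrite -addr_eq0; apply/eqP.
rewrite -RintegralD//; [|exact: integrable_mul_partial|exact: integrable_mul_test].
rewrite Rintegral_mkcond.
pose F x := u x * phi x.
pose f x := u x * partial i phi x + g x ord0 i * phi x.
rewrite (_ : _ \_ G = f); last first.
  apply/funext => x; rewrite patchE; case: ifPn => // /negP Gx.
  have /test_function_out[p0 pi0] : ~ closure [set x | phi x != 0] x.
    by move=> /KG Gx'; apply: Gx; rewrite inE.
  by rewrite /f p0 pi0 !mulr0 addr0.
have [r Kr] := test_function_cube tphi.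
have cphi := test_function_continuous tphi.
have cpphi : continuous (partial i phi) .
  exact: (@test_function_partial_continuous _ _ tphi i).
have D x : is_derive x (delta_mx ord0 i) F (f x).
  have := is_deriveM (ug i x) (test_function_is_derive tphi i x).
  by congr is_derive; rewrite /f [g x _ _ * _]mulrC.
have C : continuous f.
  have C1 x : {for x, continuous (u * partial i phi)} by exact: continuousM (cu x) (cpphi x).
  have C2 x : {for x, continuous ((fun x => g x ord0 i) * phi)}.
    exact: continuousM (cg i x) (cphi x).
  by move=> x; exact: continuousD (C1 x) (C2 x).
(* [integral_partial] needs a positive radius, whereas [r] may be negative when the support is
   empty. *)
have S x : (F x != 0) || (f x != 0) -> cube0 (`|r| + 1) x.
  move=> xF; suff : cube0 r x.
    by move=> + j => /(_ j) /andP[? ?]; have := ler_norm r; move=> ?; apply/andP; split; lra.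
  apply: Kr; apply: contrapT => /test_function_out[p0 pi0].
  by move: xF; rewrite /F /f p0 pi0 !mulr0 addr0 eqxx.
by rewrite /Rintegral (integral_partial _ D C S)// ltr_pwDr.
Qed.

Lemma in_Lp_bounded (p M : R) G f : 0 < p -> measurable G -> (mu G < +oo)%E ->
  measurable_fun G f -> {ae mu, forall x, G x -> `|f x| <= M} -> in_Lp p G f.
Proof.
move=> p0 mG Goo mf fM; rewrite /in_Lp; apply/andP; split.
  by rewrite inE; exact: (measurable_restrictT _ mG).1 mf.
rewrite inE /= /finite_norm unlock poweR_lty//.
rewrite (eq_integral ((fun x => (`|f x| `^ p)%:E) \_ G)); last first.
  move=> x _; rewrite /= !patchE; case: ifPn => // _.
  by rewrite normr0 powR0 // gt_eqF.
rewrite -integral_mkcond.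
apply: (@le_lt_trans _ _ ((`|M| `^ p)%:E * mu G)%E); last first.
  by rewrite lte_mul_pinfty// lee_fin powR_ge0.
rewrite -[leLHS]gee0_abs; last by apply: integral_ge0 => x _; rewrite lee_fin powR_ge0.
apply: (le_trans (le_abse_integral _ _ _)) => //.
  apply/measurable_EFinP; apply: (@measurableT_comp _ _ _ _ _ _ (@powR R ^~ p)) => //.
  exact: measurableT_comp.
apply: integral_le_bound => //.
apply/measurable_EFinP; apply: (@measurableT_comp _ _ _ _ _ _ (@powR R ^~ p)) => //.
  exact: measurableT_comp.
apply: filterS fM => x H Gx; rewrite /= lee_fin ger0_norm ?powR_ge0//.
apply: ge0_ler_powR; rewrite ?nnegrE//; first exact: ltW.
exact: le_trans (H Gx) (ler_norm _).
Qed.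

Lemma weak_gradientP G u : weakly_differentiable G u ->
  is_weak_gradient G u (weak_gradient G u).
Proof. by move=> [_ [g wg]]; exact: (xgetPex (cst 0) (ex_intro _ g wg)). Qed.

Lemma eucl_norm_ge0 (v : V) : 0 <= eucl_norm v.
Proof. exact: sqrtr_ge0. Qed.

Lemma coord_le_eucl_norm (v : V) i : `|v ord0 i| <= eucl_norm v.
Proof.
rewrite /eucl_norm -sqrtr_sqr ler_wsqrtr// (bigD1 i)//= lerDl.
by apply: sumr_ge0 => j _; exact: sqr_ge0.
Qed.

Lemma eucl_norm_le_sum (v : V) : eucl_norm v <= \sum_i `|v ord0 i|.
Proof.
rewrite /eucl_norm -[leRHS]ger0_norm ?sumr_ge0// -sqrtr_sqr ler_wsqrtr//.
rewrite [leRHS]expr2 mulr_suml; apply: ler_sum => i _.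
rewrite -real_normK ?num_real// expr2 ler_wpM2l//.
by rewrite (bigD1 i)//= lerDl sumr_ge0.
Qed.

Lemma measurable_eucl_norm G g : measurable G ->
  (forall i, measurable_fun G (fun x => g x ord0 i)) ->
  measurable_fun G (fun x => eucl_norm (g x)).
Proof.
move=> mG mg; rewrite /eucl_norm.
apply: (@measurableT_comp _ _ _ _ _ _ (@Num.sqrt R)) => //.
  by apply: continuous_measurable_fun; exact: sqrt_continuous.
by apply: measurable_sum => i; apply: measurable_funX.
Qed.

(** [weak_gradient] is picked by choice, so it agrees with the classical gradient only almost
    everywhere; by [weak_gradient_unique] this is enough to compute the norm with the classical
    one. *)
Lemma sobolev_C1 (p r : R) G u g : 0 < p -> open G -> (mu G < +oo)%E ->
  (forall i x, is_derive x (delta_mx ord0 i) u (g x ord0 i)) ->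
  continuous u -> (forall i, continuous (fun x => g x ord0 i)) ->
  (forall x, u x != 0 -> cube0 r x) ->
  (forall i x, g x ord0 i != 0 -> cube0 r x) ->
  sobolev p G u /\ sobolev_norm p G u =
    ((\int[mu]_(x in G) (`|u x| `^ p + eucl_norm (g x) `^ p)%:E) `^ p^-1)%E.
Proof.
move=> p0 oG Goo ug cu cg su sg; have mG := open_measurable_rV oG.
have wg := classical_is_weak_gradient oG ug cu cg.
have wd : weakly_differentiable G u.
  by split; [exact: loc_integrable_continuous|exists g].
have wg' := weak_gradientP wd.
have uniq := weak_gradient_unique oG wg' wg.
have [M _ uM] := continuous_support_bounded cu su.
have mwg i : measurable_fun G (fun x => weak_gradient G u x ord0 i).
  by have [[]] := wg' i.
have mgi i : measurable_fun G (fun x => g x ord0 i).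
  by have [[]] := wg i.
have mu_ : measurable_fun G u by have [[]] := wd.
split.
  split=> //.
  - by apply: (@in_Lp_bounded _ M) => //; exact: aeW.
  - move=> i; have [Mi _ gM] := continuous_support_bounded (cg i) (sg i).
    apply: (@in_Lp_bounded _ Mi) => //.
    by apply: filterS uniq => x H /H ->.
have mpow h : measurable_fun G h -> measurable_fun G (fun x => h x `^ p).
  by move=> mh; apply: (@measurableT_comp _ _ _ _ _ _ (@powR R ^~ p)).
have mE (h : V -> V) : (forall i, measurable_fun G (fun x => h x ord0 i)) ->
    measurable_fun G (fun x => (`|u x| `^ p + eucl_norm (h x) `^ p)%:E).
  move=> mh; apply/measurable_EFinP; apply: measurable_funD; apply: mpow.
    exact: measurableT_comp.
  exact: measurable_eucl_norm.
have eqE : ae_eq mu G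
    (fun x => (`|u x| `^ p + eucl_norm (weak_gradient G u x) `^ p)%:E)
    (fun x => (`|u x| `^ p + eucl_norm (g x) `^ p)%:E).
  by apply: filterS uniq => x H /H ->.
by rewrite /sobolev_norm (ae_eq_integral _ _ mG (mE _ mwg) (mE _ mgi) eqE).
Qed.

End weak_gradient.

(** * Mollification over cubes *)

Section mollifier.
Variable R : realType.
Implicit Types c s t : R.

(** The averaging kernel [kbump c s] is taken to be the derivative of this rescaled step: its mass
    is then 1 by the fundamental theorem of calculus, and a bounded primitive is at hand for
    integration by parts. *)
Definition kstep c s t : R := step (s^-1 * t + (- (s^-1 * c))).
Definition kbump c s t : R := s^-1 * (@step R)^`()%classic (s^-1 * t + (- (s^-1 * c))).

Lemma smooth_kstep c s : smooth_line (kstep c s).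
Proof. by move=> k; apply: Cn_affine; exact: smooth_line_step. Qed.

Lemma smooth_kbump c s : smooth_line (kbump c s).
Proof.
by move=> k; apply: CnZ; apply: Cn_affine; exact/smooth_line_derive1/smooth_line_step.
Qed.

Lemma is_derive_kstep c s t : is_derive t 1 (kstep c s) (kbump c s t).
Proof.
have dA : is_derive t 1 (fun t : R => s^-1 * t + (- (s^-1 * c))) s^-1.
  have := is_deriveD (is_deriveZ s^-1 (is_derive_id t (1 : R)))
    (is_derive_cst (- (s^-1 * c)) t (1 : R)).
  by move=> /is_derive_ext; apply=> //; rewrite addr0 [_ *: _]mulr1.
have := @is_derive1_comp _ (@step R) (fun t => s^-1 * t + (- (s^-1 * c))) _ _ _
  (smooth_line_is_derive (@smooth_line_step R) (s^-1 * t + (- (s^-1 * c)))) dA.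
by move=> /is_derive_ext; apply=> //; rewrite mulrC.
Qed.

Lemma kstep_arg c s t : 0 < s -> (s^-1 * t + (- (s^-1 * c))) * s = t - c.
Proof. by move=> s0; field; rewrite gt_eqF. Qed.

Lemma kstep_le c s t : 0 < s -> t <= c - s -> kstep c s t = 0.
Proof.
move=> s0 tc; rewrite /kstep step0// -(ler_pM2r s0) kstep_arg//; lra.
Qed.

Lemma kstep_ge c s t : 0 < s -> c + s <= t -> kstep c s t = 1.
Proof.
move=> s0 tc; rewrite /kstep step1// -(ler_pM2r s0) kstep_arg//; lra.
Qed.

Lemma kbump_supp c s t : 0 < s -> kbump c s t != 0 -> c - s <= t <= c + s.
Proof.
move=> s0; apply: contraNT => H; rewrite /kbump derive1_step_out ?mulr0//.
rewrite -(ltr_pM2r s0) -[X in _ < _ * X]gtr0_norm// -normrM kstep_arg// mul1r.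
by rewrite ltNge; apply: contra H; rewrite ler_norml => /andP[? ?]; apply/andP; split; lra.
Qed.

Lemma integral_kbump c s : 0 < s -> (\int[@lebesgue_measure R]_t (kbump c s t)%:E = 1)%E.
Proof.
move=> s0; have ab : c - s < c + s by lra.
rewrite (integral_derive_line ab (is_derive_kstep c s)
  (smooth_line_continuous (smooth_kbump c s))).
  by rewrite kstep_ge// kstep_le// subr0.
by move=> t; exact: kbump_supp.
Qed.

Section dim.
Variable n : nat.
Local Notation V := 'rV[R]_n.
Local Notation mu := (@lebesgue_rV R n).
Implicit Types (x y z : V) (v : V -> R) (g : V -> V).

Definition mollifier y s : V -> R := prodf (fun i => kbump (y ord0 i) s).

Definition ccube y s : set V := cbox (fun i => y ord0 i - s) (fun i => y ord0 i + s).

Lemma mollifier_supp y s x : 0 < s -> mollifier y s x != 0 -> ccube y s x.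
Proof. by move=> s0 /prodf_neq0 H i; exact/kbump_supp/H. Qed.

Lemma test_mollifier y s : 0 < s -> test_function setT (mollifier y s).
Proof.
move=> s0; apply: (@test_prodf _ _ _ _ (fun i => y ord0 i - s) (fun i => y ord0 i + s)) => //.
  by move=> j; exact: smooth_kbump.
by move=> j t; exact: kbump_supp.
Qed.

Lemma integral_mollifier y s : 0 < s -> (\int[mu]_x (mollifier y s x)%:E = 1)%E.
Proof.
move=> s0; rewrite /mollifier (@integral_prodf _ _ _ (\sum_i `|y ord0 i| + s)).
- by rewrite big1// => i _; rewrite integral_kbump.
- by move=> i; exact/smooth_line_continuous/smooth_kbump.
- move=> i t /(kbump_supp s0) /andP[? ?].
  have : `|y ord0 i| <= \sum_i `|y ord0 i| by rewrite (bigD1 i)//= lerDl sumr_ge0.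
  by rewrite ler_norml => /andP[? ?]; apply/andP; split; lra.
Qed.

Definition mollify v y s : R := \int[mu]_x (v x * mollifier y s x).

(** Once the supporting cube lies in [P], the average is exactly [c]. Telescoping over scales can
    therefore stop after finitely many steps, without Lebesgue points. *)
Lemma mollify_cst v (P : set V) c y : loc_integrable setT v -> open P -> P y ->
  {ae mu, forall x, P x -> v x = c} ->
  exists2 s0, 0 < s0 & forall s, 0 < s -> s < s0 -> mollify v y s = c.
Proof.
move=> lv oP Py vc.
have /nbhs_ballP[e /= e0 eP] : nbhs y P by exact: open_nbhs_nbhs.
exists e => // s s0 se.
rewrite /mollify /Rintegral.
have mb : measurable_fun setT (mollifier y s).
  by apply: continuous_measurable_rV; exact: test_function_continuous (test_mollifier y s0).
rewrite (ae_eq_integral (fun x => (c%:E * (mollifier y s x)%:E)%E))//.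
- rewrite integralZl// ?integral_mollifier ?mule1//.
  have l1 := loc_integrable_continuous measurableT (@cst_continuous V _ (1 : R)).
  have := integrable_mul_test measurableT l1 (test_mollifier y s0).
  by apply: eq_integrable => // x _ /=; rewrite mul1r.
- by apply/measurable_EFinP; apply: measurable_funM => //; have [] := lv.
- by apply: emeasurable_funM => //; exact/measurable_EFinP.
- apply: filterS vc => x vx _; have [->|mx] := eqVneq (mollifier y s x) 0.
    by rewrite mulr0 mule0.
  rewrite vx// ?EFinM//; apply: eP; split=> // j i; rewrite (ord1 j).
  have /andP[? ?] := mollifier_supp s0 mx i.
  by rewrite /ball/= ltr_distlC; apply/andP; split; lra.
Qed.

Section comparison.
Variables (v : V -> R) (g : V -> V).
Hypotheses (lv : loc_integrable setT v) (vg : is_weak_gradient setT v g).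
Variables (Cs : R) (Cs1 : 1 <= Cs) (HCs : forall t : R, `|(@step R)^`()%classic t| <= Cs).
Variables (y1 y2 : V) (s1 s2 m : R) (a b : 'I_n -> R).
Hypotheses (m0 : 0 < m) (ms1 : m <= s1) (ms2 : m <= s2).
Hypothesis ab1 : ccube y1 s1 `<=` cbox a b.
Hypothesis ab2 : ccube y2 s2 `<=` cbox a b.

(* [hyb k] passes from the second kernel to the first one coordinate at a time, and
   [theta k] is a compactly supported primitive of [hyb k.+1 - hyb k] in the k-th
   variable; integrating it by parts against [v] brings in the weak gradient. *)
Let hyb (k : nat) (j : 'I_n) : R -> R :=
  if (j < k)%N then kbump (y1 ord0 j) s1 else kbump (y2 ord0 j) s2.

Let theta (k : 'I_n) (j : 'I_n) : R -> R :=
  if j == k then (fun t => kstep (y1 ord0 j) s1 t + -1 * kstep (y2 ord0 j) s2 t)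
  else hyb k j.

Let s10 : 0 < s1. Proof. exact: lt_le_trans ms1. Qed.
Let s20 : 0 < s2. Proof. exact: lt_le_trans ms2. Qed.

Let a1 j : a j <= y1 ord0 j - s1.
Proof.
have s_gt0 := s10.
have /ab1/(_ j) : ccube y1 s1 (\row_i (y1 ord0 i - s1)).
  by move=> i; rewrite mxE; apply/andP; split; lra.
by rewrite mxE => /andP[].
Qed.
Let b1 j : y1 ord0 j + s1 <= b j.
Proof.
have s_gt0 := s10.
have /ab1/(_ j) : ccube y1 s1 (\row_i (y1 ord0 i + s1)).
  by move=> i; rewrite mxE; apply/andP; split; lra.
by rewrite mxE => /andP[].
Qed.
Let a2 j : a j <= y2 ord0 j - s2.
Proof.
have s_gt0 := s20.
have /ab2/(_ j) : ccube y2 s2 (\row_i (y2 ord0 i - s2)).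
  by move=> i; rewrite mxE; apply/andP; split; lra.
by rewrite mxE => /andP[].
Qed.
Let b2 j : y2 ord0 j + s2 <= b j.
Proof.
have s_gt0 := s20.
have /ab2/(_ j) : ccube y2 s2 (\row_i (y2 ord0 i + s2)).
  by move=> i; rewrite mxE; apply/andP; split; lra.
by rewrite mxE => /andP[].
Qed.

Let hyb_smooth k j : smooth_line (hyb k j).
Proof. by rewrite /hyb; case: ifP => _; exact: smooth_kbump. Qed.

Let hyb_supp k j t : hyb k j t != 0 -> a j <= t <= b j.
Proof.
rewrite /hyb; case: ifP => _ /kbump_supp => [/(_ s10)|/(_ s20)] /andP[? ?].
  by have := a1 j; have := b1 j => ? ?; apply/andP; split; lra.
by have := a2 j; have := b2 j => ? ?; apply/andP; split; lra.
Qed.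

Let theta_smooth k j : smooth_line (theta k j).
Proof.
rewrite /theta; case: ifP => _; last exact: hyb_smooth.
by move=> l; apply: CnD; [|apply: CnZ]; exact: smooth_kstep.
Qed.

Let theta_supp k j t : theta k j t != 0 -> a j <= t <= b j.
Proof.
rewrite /theta; case: ifP => _; last exact: hyb_supp.
apply: contraNT; rewrite negb_and -!ltNge => /orP[ta|tb].
  have := a1 j; have := a2 j => ? ?.
  have -> : kstep (y1 ord0 j) s1 t = 0 by apply: kstep_le => //; lra.
  have -> : kstep (y2 ord0 j) s2 t = 0 by apply: kstep_le => //; lra.
  by rewrite mulr0 addr0.
(* To the right of both supports the two steps have reached the same value 1 and cancel. This is
   where the equal mass of the kernels makes the primitive compactly supported. *)
have := b1 j; have := b2 j => ? ?.
have -> : kstep (y1 ord0 j) s1 t = 1 by apply: kstep_ge => //; lra.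
have -> : kstep (y2 ord0 j) s2 t = 1 by apply: kstep_ge => //; lra.
by rewrite mulN1r subrr.
Qed.

Let test_hyb k : test_function setT (prodf (hyb k)).
Proof. exact: (test_prodf (hyb_smooth k) (@hyb_supp k)). Qed.

Let test_theta k : test_function setT (prodf (theta k)).
Proof. exact: (test_prodf (theta_smooth k) (@theta_supp k)). Qed.

Let partial_theta (k : 'I_n) x :
  partial k (prodf (theta k)) x = prodf (hyb k.+1) x - prodf (hyb k) x.
Proof.
have dk : is_derive (x ord0 k) 1 (theta k k)
    (kbump (y1 ord0 k) s1 (x ord0 k) - kbump (y2 ord0 k) s2 (x ord0 k)).
  rewrite /theta eqxx.
  have := is_deriveD (is_derive_kstep (y1 ord0 k) s1 (x ord0 k))
    (is_deriveZ (-1) (is_derive_kstep (y2 ord0 k) s2 (x ord0 k))).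
  by move=> /is_derive_ext; apply=> //; rewrite scaleN1r.
rewrite /partial; have [_ ->] := is_derive_prodf dk.
have E k' : prodf (hyb k') x =
    hyb k' k (x ord0 k) * \prod_(j | j != k) hyb k' j (x ord0 j).
  by rewrite /prodf (bigD1 k).
rewrite !E mulrBl; congr (_ * _ - _ * _).
- by rewrite /hyb ltnSn.
- apply: eq_bigr => j jk; rewrite /theta (negbTE jk) /hyb ltnS [in RHS]leq_eqVlt.
  by rewrite -(inj_eq val_inj) in jk; rewrite (negbTE jk).
- by rewrite /hyb ltnn.
- by apply: eq_bigr => j jk; rewrite /theta (negbTE jk).
Qed.

(** Each of the n - 1 kernel factors costs Cs / m, but the k-th factor is a difference of steps and
    is at most 1. Saving one power of m is the gain of one length scale in a Poincaré inequality. *)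
Let theta_bound (k : 'I_n) x : `|prodf (theta k) x| <= (Cs / m) ^+ n.-1.
Proof.
have Cm0 : 0 <= Cs / m by rewrite divr_ge0// ?(ltW m0)// (le_trans _ Cs1).
have hb j t : `|hyb k j t| <= Cs / m.
  rewrite /hyb; case: ifP => _; rewrite /kbump normrM gtr0_norm ?invr_gt0// mulrC;
  by apply: ler_pM; rewrite // ?invr_ge0 ?lef_pV2 ?posrE ?(ltW s10) ?(ltW s20).
rewrite /prodf (bigD1 k)//= normrM -[leRHS]mul1r.
apply: ler_pM => //.
  rewrite /theta eqxx mulN1r ler_norml.
  have := step_ge0 (s1^-1 * x ord0 k + - (s1^-1 * y1 ord0 k)).
  have := step_le1 (s1^-1 * x ord0 k + - (s1^-1 * y1 ord0 k)).
  have := step_ge0 (s2^-1 * x ord0 k + - (s2^-1 * y2 ord0 k)).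
  have := step_le1 (s2^-1 * x ord0 k + - (s2^-1 * y2 ord0 k)).
  by rewrite /kstep => *; apply/andP; split; lra.
rewrite normr_prod.
have -> : (Cs / m) ^+ n.-1 = \prod_(j < n | j != k) (Cs / m).
  by rewrite prodr_const cardC1 card_ord.
apply: ler_prod => j jk; rewrite normr_ge0/= /theta (negbTE jk); exact: hb.
Qed.

Let mg i : measurable_fun setT (fun x => g x ord0 i).
Proof. by have [[]] := vg i. Qed.

Let step_diff (k : 'I_n) :
  (`| \int[mu]_x (v x * prodf (hyb k.+1) x) - \int[mu]_x (v x * prodf (hyb k) x) |%:E <=
  ((Cs / m) ^+ n.-1)%:E * \int[mu]_(x in cbox a b) (eucl_norm (g x))%:E)%E.
Proof.
have mD := @measurable_cbox R n a b.
rewrite -RintegralB//; [|exact: integrable_mul_test lv (test_hyb _)..].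
under eq_Rintegral do rewrite -mulrBr -partial_theta.
have [lg ->//] := vg k.
rewrite normrN.
have ig := integrable_mul_test measurableT lg (test_theta k).
apply: (@le_trans _ _ (\int[mu]_x (`|g x ord0 k * prodf (theta k) x|)%:E)%E).
  rewrite (EFin_normr_Rintegral measurableT ig).
  by apply: (le_abse_integral mu measurableT); have /integrableP[] := ig.
rewrite (_ : (fun x => _) =
    (fun x => (`|g x ord0 k * prodf (theta k) x|)%:E) \_ (cbox a b)); last first.
  apply/funext => x; rewrite patchE; case: ifPn => // /negP xD.
  case: (eqVneq (prodf (theta k) x) 0) => [->|/prodf_neq0 H]; first by rewrite mulr0 normr0.
  by exfalso; apply: xD; rewrite inE => j; exact/(@theta_supp k)/H.
rewrite -integral_mkcond -ge0_integralZl//; last 3 first.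
- apply: measurable_funTS; apply/measurable_EFinP.
  exact: measurable_eucl_norm.
- by move=> x _; rewrite lee_fin eucl_norm_ge0.
- by rewrite lee_fin exprn_ge0// divr_ge0// ?(ltW m0)// (le_trans _ Cs1).
apply: ge0_le_integral => //.
- apply: measurable_funTS; apply/measurable_EFinP.
  apply: measurableT_comp => //; apply: measurable_funM => //.
  by apply: continuous_measurable_rV; exact: test_function_continuous (test_theta k).
- apply: measurable_funTS; apply/measurable_EFinP; apply: measurable_funM => //.
  exact: measurable_eucl_norm.
move=> x _; rewrite -EFinM lee_fin normrM mulrC ler_pM ?theta_bound//.
exact: coord_le_eucl_norm.
Qed.

(** This plays the part of the Poincaré inequality: the kernels are exchanged one coordinate at a
    time, and each of the n exchanges is an integration by parts against the weak gradient. *)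
Lemma mollify_comparison :
  (`| mollify v y1 s1 - mollify v y2 s2 |%:E <=
  (n%:R * (Cs / m) ^+ n.-1)%:E * \int[mu]_(x in cbox a b) (eucl_norm (g x))%:E)%E.
Proof.
pose I k := \int[mu]_x (v x * prodf (hyb k) x).
have -> : mollify v y1 s1 = I n.
  rewrite /mollify /I /mollifier; apply: eq_Rintegral => x _; congr (_ * _).
  by apply: eq_bigr => j _; rewrite /hyb ltn_ord.
have -> : mollify v y2 s2 = I 0%N by [].
rewrite -(telescope_sumr I (leq0n n)) big_mkord.
apply: (@le_trans _ _ (\sum_(k < n) `|I k.+1 - I k|%:E)%E).
  by rewrite sumEFin lee_fin ler_norm_sum.
apply: (le_trans (lee_sum _ (fun k _ => step_diff k))).
rewrite EFinM -muleA; set X := (_ * \int[mu]_(x in _) _)%E.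
have H k : (\sum_(i < k) X = k%:R%:E * X)%E.
  elim: k => [|k IH]; first by rewrite big_ord0 mul0e.
  by rewrite big_ord_recr IH -natr1 EFinD ge0_muleDl ?mul1e ?lee_fin.
by rewrite H.
Qed.

End comparison.
End dim.
End mollifier.

(** * Young's inequality, geometric series, and integrals over moving cubes *)

Section young_and_geometric_sums.
Variable R : realType.

(** Either t <= tau, or t^(1 - q) <= tau^(1 - q) since 1 - q <= 0. The free threshold lets the first
    term be absorbed with a prescribed share at every scale. *)
Lemma le_young (q tau t : R) : 1 <= q -> 0 < tau -> 0 <= t ->
  t <= tau + tau `^ (1 - q) * t `^ q.
Proof.
move=> q1 tau0 t0; have [tt|tt] := leP t tau.
  by apply: (le_trans tt); rewrite lerDl mulr_ge0 ?powR_ge0.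
have t0' : 0 < t by exact: lt_trans tt.
apply: (@le_trans _ _ (tau `^ (1 - q) * t `^ q)); last by rewrite lerDr ltW.
have -> : t `^ q = t * t `^ (q - 1).
  have {1}-> : q = 1 + (q - 1) by ring.
  rewrite [LHS]powRD; last by apply/implyP => _; rewrite gt_eqF.
  by rewrite powRr1.
rewrite mulrCA -[leLHS]mulr1 ler_wpM2l//.
rewrite -opprB powRN mulrC ler_pdivlMr ?powR_gt0// mul1r.
by apply: ge0_ler_powR; rewrite ?nnegrE ?subr_ge0 ?(ltW tau0) ?(ltW tt).
Qed.

Lemma sum_geom_le (r : R) N : 0 <= r -> r < 1 -> \sum_(0 <= k < N) r ^+ k <= (1 - r)^-1.
Proof.
move=> r0 r1; rewrite -[leRHS]mul1r ler_pdivlMr ?subr_gt0//.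
suff -> : (\sum_(0 <= k < N) r ^+ k) * (1 - r) = 1 - r ^+ N.
  by rewrite gerBl exprn_ge0.
elim: N => [|N IH]; first by rewrite big_geq// mul0r expr0 subrr.
by rewrite big_nat_recr//= mulrDl IH exprS; ring.
Qed.

Lemma nneseries_geom_le (D r : R) (u : nat -> \bar R) : 0 <= D -> 0 <= r -> r < 1 ->
  (forall k, 0 <= u k)%E -> (forall k, u k <= (D * r ^+ k)%:E)%E ->
  (\sum_(0 <= k <oo) u k <= (D / (1 - r))%:E)%E.
Proof.
move=> D0 r0 r1 u0 uD; apply: lime_le; first exact: is_cvg_nneseries.
apply: nearW => N; apply: (@le_trans _ _ (\sum_(0 <= k < N) (D * r ^+ k)%:E)%E).
  exact: lee_sum.
by rewrite sumEFin lee_fin -mulr_sumr ler_wpM2l// sum_geom_le.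
Qed.

End young_and_geometric_sums.

Section cube_averages.
Variables (R : realType) (n : nat).
Local Notation V := 'rV[R]_n.
Local Notation mu := (@lebesgue_rV R n).
Variables (E : V -> \bar R).
Hypotheses (mE : measurable_fun setT E) (E0 : forall z, (0 <= E z)%E).

Let B (s : R) : set (V * V) := [set yz | ccube yz.1 s yz.2].

Let mB s : measurable (B s).
Proof.
rewrite (_ : B s = \bigcap_(i in [set: 'I_n])
   ((fun yz : V * V => rV_coord i yz.2 - rV_coord i yz.1) @^-1` `[- s, s]%classic)).
  apply: fin_bigcap_measurable => [|i _]; first exact: finite_finset.
  rewrite -[X in measurable X]setTI.
  have mf : measurable_fun setT (fun yz : V * V => rV_coord i yz.2 - rV_coord i yz.1).
    apply: measurable_funB; apply: (measurableT_comp (measurable_rV_coord i)) => //.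
  exact: mf.
apply/seteqP; split=> -[y z] /= H i => [_|].
  by have := H i; rewrite /rV_coord /= in_itv/= => /andP[? ?]; apply/andP; split; lra.
by have := H i I; rewrite /rV_coord /= in_itv/= => /andP[? ?]; apply/andP; split; lra.
Qed.

Let F s (yz : V * V) : \bar R := (E yz.2 * (\1_(B s) yz)%:E)%E.

Let mF s : measurable_fun setT (F s).
Proof.
apply: emeasurable_funM; first exact: measurableT_comp.
by apply/measurable_EFinP; exact: measurable_indic.
Qed.

Let F0 s yz : (0 <= F s yz)%E.
Proof. by rewrite mule_ge0// lee_fin. Qed.

Let FE y s : (\int[mu]_(z in ccube y s) E z = \int[mu]_z F s (y, z))%E.
Proof.
rewrite integral_mkcond; apply: eq_integral => z _.
rewrite patchE /F indicE /=; case: ifPn => [/set_mem zy|/negP zy].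
  by rewrite mem_set ?mule1.
by rewrite memNset ?mule0// => zy'; apply: zy; rewrite inE.
Qed.

Lemma measurable_cube_integral s : measurable_fun setT (fun y => \int[mu]_(z in ccube y s) E z)%E.
Proof.
rewrite (_ : (fun y => _) = fun y => \int[mu]_z F s (y, z))%E; last first.
  by apply/funext => y; exact: FE.
exact: measurable_fun_fubini_tonelli_F (mF s) (F0 s).
Qed.

Lemma measurable_ccube (y : V) s : measurable (ccube y s).
Proof. exact: measurable_cbox. Qed.

Lemma lebesgue_ccube (y : V) (s : R) : 0 <= s -> mu (ccube y s) = ((2 * s) ^+ n)%:E.
Proof.
move=> s0; rewrite lebesgue_cbox; last by move=> i; lra.
rewrite (eq_bigr (fun=> 2 * s)); last by move=> i _; ring.
by rewrite prodr_const card_ord.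
Qed.

(** Tonelli's theorem and the symmetry of z in [ccube y s]: for fixed z the admissible y fill a cube
    of the same size. This is the good bound when the cubes are smaller than [S]. *)
Lemma integral_cube_integral (S : set V) s : measurable S -> 0 <= s ->
  (\int[mu]_(y in S) \int[mu]_(z in ccube y s) E z <=
   ((2 * s) ^+ n)%:E * \int[mu]_z E z)%E.
Proof.
move=> mS s0.
apply: (@le_trans _ _ (\int[mu]_y \int[mu]_z F s (y, z))%E).
  rewrite (eq_integral (fun y => \int[mu]_z F s (y, z))%E); last by move=> y _; exact: FE.
  apply: ge0_subset_integral => //.
    exact: measurable_fun_fubini_tonelli_F (mF s) (F0 s).
  by move=> y _; exact: integral_ge0.
rewrite (fubini_tonelli _ (mF s) (F0 s)) -ge0_integralZl//; last first.
  by rewrite lee_fin exprn_ge0// mulr_ge0.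
apply: ge0_le_integral => //.
- by move=> z _; exact: integral_ge0.
- exact: measurable_fun_fubini_tonelli_G (mF s) (F0 s).
- exact: measurable_funeM.
move=> z _; rewrite (eq_integral (fun y => (E z * (\1_(ccube z s) y)%:E)%E)); last first.
  move=> y _; rewrite /F /=; congr (_ * _%:E)%E; rewrite !indicE; congr (nat_of_bool _)%:R.
  by apply/idP/idP; rewrite !inE /B /= => H i; have := H i => /andP[? ?]; apply/andP; split; lra.
have mc := measurable_ccube z s.
rewrite ge0_integralZl//; last first.
  by apply/measurable_EFinP; exact: measurable_indic.
rewrite muleC integral_indic// setIT.
by rewrite -[X in (X * _)%E]/(mu (ccube z s)) lebesgue_ccube.
Qed.

(** The companion bound for cubes larger than [S]: each inner integral is at most the full one. *)
Lemma integral_cube_integral_le (S : set V) s : measurable S ->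
  (\int[mu]_(y in S) \int[mu]_(z in ccube y s) E z <= mu S * \int[mu]_z E z)%E.
Proof.
move=> mS; rewrite muleC -integral_cst//.
apply: ge0_le_integral => //.
- by move=> y _; exact: integral_ge0.
- by apply: measurable_funTS; exact: measurable_cube_integral.
- move=> y _; apply: ge0_subset_integral => //; exact: measurable_ccube.
Qed.

End cube_averages.

(** * The local lower bound *)

Section powers.
Variable R : realType.
Implicit Types x y : R.

(* Writing every positive quantity as an exponential turns an identity between real
   powers into a polynomial identity between exponents. *)
Lemma exists_expR x : 0 < x -> exists l, x = expR l.
Proof. by move=> x0; exists (ln x); rewrite lnK. Qed.

(** The smaller of A and B is at most each of their weighted geometric means. This interpolates
    between the two bounds on integrals over moving cubes and is the origin of the power [l]. *)
Lemma le_geometric_mean (x A B l : R) : 0 <= l <= 1 -> 0 < A -> 0 < B -> x <= A -> x <= B ->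
  x <= A `^ (1 - l) * B `^ l.
Proof.
move=> /andP[l0 l1] A0 B0 xA xB.
have powS X : 0 < X -> X = X `^ (1 - l) * X `^ l.
  move=> X0; rewrite -powRD; first by rewrite subrK powRr1 ?ltW.
  by apply/implyP => _; rewrite gt_eqF.
have [AB|/ltW BA] := leP A B.
  apply: (le_trans xA); rewrite [leLHS](powS _ A0) ler_wpM2l ?powR_ge0//.
  by apply: ge0_ler_powR; rewrite ?nnegrE ?(ltW A0) ?(ltW B0).
apply: (le_trans xB); rewrite [leLHS](powS _ B0) ler_wpM2r ?powR_ge0//.
by apply: ge0_ler_powR; rewrite ?nnegrE ?subr_ge0 ?(ltW A0) ?(ltW B0).
Qed.

(** Splits the coefficient at scale k into a constant, the scaling in a and rho, and the k-th power
    of the ratio of the geometric series. *)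
Lemma pow_scale (K kappa a rho q l theta : R) (m k : nat) :
  0 < K -> 0 < kappa -> 0 < a -> 0 < rho -> 0 < theta ->
  K * (rho / 2 ^+ k.+2) ^- m * (a * kappa * theta ^+ k / (rho / 2 ^+ k.+2)) `^ (1 - q) *
    ((2 * (rho / 2 ^+ k.+1)) ^+ m.+1) `^ l =
  (K * kappa `^ (1 - q) * (4 ^+ m.+1) `^ l * 4 `^ (- (q - m.+1%:R + m.+1%:R * l))) *
    (a `^ (1 - q) * rho `^ (q - m.+1%:R + m.+1%:R * l)) *
  (theta `^ (1 - q) * 2 `^ (- (q - m.+1%:R + m.+1%:R * l))) ^+ k.
Proof.
move=> /exists_expR[lK ->] /exists_expR[lk ->] /exists_expR[la ->] /exists_expR[lr ->].
move=> /exists_expR[lt ->].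
have -> : 4 = 2 ^+ 2 :> R by rewrite -natrX.
have /exists_expR[l2 ->] : 0 < 2 :> R by [].
rewrite -!(expRM, expRN, expRM_natl, expRD) -!natr1; congr expR; ring.
Qed.

Lemma pow_scale0 (K kappa a rho q l : R) (m : nat) :
  0 < K -> 0 < kappa -> 0 < a -> 0 < rho ->
  K * (rho / 2) ^- m * (a * kappa / rho) `^ (1 - q) * ((2 * rho) ^+ m.+1) `^ l =
  (K * 2 ^+ m * kappa `^ (1 - q) * (2 ^+ m.+1) `^ l) *
    (a `^ (1 - q) * rho `^ (q - m.+1%:R + m.+1%:R * l)).
Proof.
move=> /exists_expR[lK ->] /exists_expR[lk ->] /exists_expR[la ->] /exists_expR[lr ->].
have /exists_expR[l2 ->] : 0 < 2 :> R by [].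
rewrite -!(expRM, expRN, expRM_natl, expRD) -!natr1; congr expR; ring.
Qed.

Lemma powRM_factor (a S q l : R) : 0 < a -> 0 < S ->
  a `^ q * S `^ l = a * S * (a `^ (q - 1) * S `^ (l - 1)).
Proof.
move=> /exists_expR[la ->] /exists_expR[lS ->].
rewrite -!(expRM, expRN, expRM_natl, expRD); congr expR; ring.
Qed.

Lemma powRM_cancel (a S q l : R) : 0 < a -> 0 < S ->
  a `^ (1 - q) * S `^ (1 - l) * (a `^ (q - 1) * S `^ (l - 1)) = 1.
Proof.
move=> /exists_expR[la ->] /exists_expR[lS ->].
rewrite -!(expRM, expRN, expRM_natl, expRD) -[RHS]expR0; congr expR; ring.
Qed.

(** The ratio equals 2^(-gamma (q + 1) / (2 q)). The base theta = 2^(-gamma / (2 q)) is below 1, so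
    that the thresholds' contributions are summable, yet close enough to 1 that theta^(1 - q) does
    not destroy the decay 2^(-gamma). *)
Lemma pow_ratio_lt1 (q gamma : R) : 1 <= q -> 0 < gamma ->
  (2 `^ (- (gamma / (2 * q)))) `^ (1 - q) * 2 `^ (- gamma) < 1.
Proof.
move=> q1 g0.
suff H (u : R) : 0 < u ->
    (expR u `^ (- (gamma / (2 * q)))) `^ (1 - q) * expR u `^ (- gamma) < 1.
  by have := H (ln 2); rewrite lnK ?posrE//; apply; rewrite ln_gt0 ?ltr1n.
move=> u0; rewrite -!(expRM, expRD) -[ltRHS]expR0 ltr_expR.
rewrite -mulrA -mulrDr pmulr_rlt0//.
rewrite (_ : _ + _ = - (gamma * (q + 1) / (2 * q))); last by field; lra.
by rewrite oppr_lt0 divr_gt0// ?mulr_gt0//; lra.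
Qed.

End powers.

Section local_bound.
Variables (R : realType) (m : nat).
Local Notation n := m.+1.
Local Notation V := 'rV[R]_n.
Local Notation mu := (@lebesgue_rV R n).
Variables (q l : R).
Hypotheses (q1 : 1 <= q) (l01 : 0 <= l <= 1).
Let gamma := q - n%:R + n%:R * l.
Hypothesis gamma0 : 0 < gamma.

Lemma measurable_grad_pow (g : V -> V) :
  (forall i, measurable_fun setT (fun z => g z ord0 i)) ->
  measurable_fun setT (fun z => (eucl_norm (g z) `^ q)%:E).
Proof.
move=> mg; apply/measurable_EFinP.
apply: (@measurableT_comp _ _ _ _ _ _ (@powR R ^~ q)) => //.
exact: measurable_eucl_norm.
Qed.

Lemma integral_norm_young (g : V -> V) (D : set V) tau (E : V -> \bar R) :
  0 < tau -> measurable D ->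
  (forall i, measurable_fun setT (fun z => g z ord0 i)) ->
  measurable_fun setT E ->
  (forall z, D z -> (eucl_norm (g z) `^ q)%:E = E z) ->
  (\int[mu]_(z in D) (eucl_norm (g z))%:E <=
    tau%:E * mu D + (tau `^ (1 - q))%:E * \int[mu]_(z in D) E z)%E.
Proof.
move=> tau0 mD mg mE EE.
have mn : measurable_fun D (fun z => (eucl_norm (g z))%:E).
  by apply: measurable_funTS; apply/measurable_EFinP; exact: measurable_eucl_norm.
have mED : measurable_fun D E by exact: measurable_funTS.
have E0 z : D z -> (0 <= E z)%E by move=> Dz; rewrite -EE// lee_fin powR_ge0.
rewrite -integral_cst// -ge0_integralZl//; last by rewrite lee_fin powR_ge0.
rewrite -ge0_integralD//; last 3 first.
- by move=> z _; rewrite lee_fin ltW.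
- by move=> z Dz; rewrite mule_ge0 ?E0// lee_fin powR_ge0.
- exact: measurable_funeM.
apply: ge0_le_integral => //.
- by move=> z _; rewrite lee_fin eucl_norm_ge0.
- apply: emeasurable_funD; first exact: measurable_cst.
  exact: measurable_funeM.
move=> z Dz; rewrite -EE// -EFinM -EFinD lee_fin.
by apply: le_young => //; exact: eucl_norm_ge0.
Qed.

(* For y in S, [c] is the limit of the averages of [v] over the cubes of radii
   [s k = rho / 2 ^ (k + 1)] about y.  Each increment is split by Young's inequality
   [t <= tau + tau ^ (1 - q) * t ^ q], with thresholds [tau k] whose contributions add
   up to at most [a / 8]; the rest, integrated over S, is a geometric series because
   [gamma] is positive. *)
Lemma local_one_sided : exists2 C : R, 0 < C &
  forall (v : V -> R) (g : V -> V) x (rho a M c : R) (S : set V),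
  loc_integrable setT v -> is_weak_gradient setT v g ->
  0 < rho -> 0 < a -> 0 < M -> open S -> S `<=` ball x rho ->
  (M%:E <= mu S)%E -> {ae mu, forall z, S z -> v z = c} ->
  a / 2 <= `|c - mollify v x (rho / 2)| ->
  ((a `^ q * M `^ l)%:E <=
    (C * rho `^ gamma)%:E * \int[mu]_(z in ball x (2 * rho)) (eucl_norm (g z) `^ q)%:E)%E.
Proof.
have q0 : 0 < q by exact: lt_le_trans q1.
have [Cs Cs1 HCs] := derive1_step_bound R.
pose K : R := n%:R * Cs ^+ m.
have Cs0 : 0 < Cs by exact: lt_le_trans Cs1.
have K0 : 0 < K by rewrite mulr_gt0// exprn_gt0.
pose theta : R := 2 `^ (- (gamma / (2 * q))).
have theta0 : 0 < theta by exact: powR_gt0.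
have theta1 : theta < 1.
  rewrite /theta -[X in X `^ _](@lnK R 2) ?posrE// -expRM -[ltRHS]expR0 ltr_expR.
  by rewrite pmulr_rlt0 ?ln_gt0 ?ltr1n// oppr_lt0 divr_gt0// mulr_gt0.
(* Solved from the requirement that the threshold term at scale k be exactly (a / 8) (1 - theta)
   theta^k. The factor 4^n is the volume of a cube of radius [s k] in units of [s k.+1]. Likewise
   [kappas] makes the threshold term of the first comparison, over a cube of side 3 rho, exactly a /
   8. *)
pose kappa : R := (1 - theta) / (8 * K * 4 ^+ n).
have kappa0 : 0 < kappa by rewrite divr_gt0 ?subr_gt0// mulr_gt0 ?exprn_gt0// mulr_gt0.
pose kappas : R := (8 * K * 2 ^+ m * 3 ^+ n)^-1.
have kappas0 : 0 < kappas by rewrite invr_gt0 mulr_gt0 ?exprn_gt0// mulr_gt0 ?exprn_gt0// mulr_gt0.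
pose r : R := theta `^ (1 - q) * 2 `^ (- gamma).
have r0 : 0 <= r by rewrite mulr_ge0 ?powR_ge0.
have r1 : r < 1 by exact: pow_ratio_lt1.
pose D1 : R := K * kappa `^ (1 - q) * (4 ^+ n) `^ l * 4 `^ (- gamma).
pose D2 : R := K * 2 ^+ m * kappas `^ (1 - q) * (2 ^+ n) `^ l.
have D10 : 0 < D1.
  by do 3 (apply: mulr_gt0; last by rewrite powR_gt0 ?exprn_gt0).
have D20 : 0 < D2.
  do 2 (apply: mulr_gt0; last by rewrite powR_gt0 ?exprn_gt0).
  by rewrite mulr_gt0 ?exprn_gt0.
exists (4 * (D2 + D1 / (1 - r))).
  by rewrite mulr_gt0// addr_gt0// divr_gt0// subr_gt0.
move=> v g x rho a M c S lv vg rho0 a0 M0 oS Sx MS vc ab.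
set b := mollify _ _ _ in ab.
have mg i : measurable_fun setT (fun z => g z ord0 i) by have [[]] := vg i.
have mf := measurable_grad_pow mg.
set f := fun z => (eucl_norm (g z) `^ q)%:E in mf *.
have f0 z : (0 <= f z)%E by rewrite lee_fin powR_ge0.
set J := (\int[mu]_(z in _) _)%E.
have J0 : (0 <= J)%E by apply: integral_ge0 => z _; exact: f0.
have Cr0 : 0 < 4 * (D2 + D1 / (1 - r)) * rho `^ gamma.
  by rewrite mulr_gt0 ?powR_gt0// mulr_gt0// addr_gt0// divr_gt0// subr_gt0.
have [Jy|Joo] := eqVneq J +oo%E.
  by rewrite Jy gt0_muley ?leey// lte_fin.
have Jfin : J \is a fin_num by rewrite ge0_fin_numE// ltey.
pose Gq := fine J; have JE : J = Gq%:E by rewrite fineK.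
have Gq0 : 0 <= Gq by exact: fine_ge0.
rewrite JE -EFinM lee_fin.
have mball := measurable_ball_rV x (2 * rho).
(* Cutting the integrand off outside the ball lets Tonelli's theorem be applied on the whole space,
   where the total integral is [Gq]. *)
pose E := f \_ (ball x (2 * rho)).
have mE : measurable_fun setT E by apply/(measurable_restrictT _ mball); exact: measurable_funTS.
have E0 z : (0 <= E z)%E by rewrite /E patchE; case: ifP.
have intE : (\int[mu]_z E z = Gq%:E)%E by rewrite -JE /J /E -integral_mkcond.
have Ef z : ball x (2 * rho) z -> f z = E z by move=> xz; rewrite /E patchE mem_set.
pose s k : R := rho / 2 ^+ k.+1.
have s0 k : 0 < s k by rewrite divr_gt0 ?exprn_gt0.
have sS k : s k = 2 * s k.+1 by rewrite /s [2 ^+ k.+2]exprS; field; rewrite expf_neq0.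
have sle k : s k <= rho / 2.
  rewrite /s ler_pM2l// lef_pV2 ?posrE ?exprn_gt0// exprS ler_peMr//.
  by rewrite exprn_ege1// ler1n.
pose tau k : R := a * kappa * theta ^+ k / s k.+1.
have tau0 k : 0 < tau k by rewrite divr_gt0// mulr_gt0 ?exprn_gt0// mulr_gt0.
pose taus : R := a * kappas / rho.
have taus0 : 0 < taus by rewrite divr_gt0// mulr_gt0.
pose cc k : R := K * (s k.+1) ^- m * (tau k) `^ (1 - q).
have cc0 k : 0 <= cc k.
  by rewrite mulr_ge0 ?powR_ge0// mulr_ge0 ?(ltW K0)// invr_ge0 exprn_ge0// ltW.
pose G k y := (\int[mu]_(z in ccube y (s k)) E z)%E.
have G0 k y : (0 <= G k y)%E by exact: integral_ge0.
pose T0 : R := K * (rho / 2) ^- m * taus `^ (1 - q) * Gq.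
have T00 : 0 <= T0.
  rewrite mulr_ge0// mulr_ge0 ?powR_ge0// mulr_ge0 ?(ltW K0)// invr_ge0 exprn_ge0//.
  by rewrite divr_ge0// ltW.
have cmp y1 s1 y2 s2 mm A B : 0 < mm -> mm <= s1 -> mm <= s2 ->
    ccube y1 s1 `<=` cbox A B -> ccube y2 s2 `<=` cbox A B ->
    (`|mollify v y1 s1 - mollify v y2 s2|%:E <=
    (K * mm ^- m)%:E * \int[mu]_(z in cbox A B) (eucl_norm (g z))%:E)%E.
  move=> mm0 m1 m2 c1 c2.
  have := mollify_comparison lv vg Cs1 HCs mm0 m1 m2 c1 c2.
  by rewrite /= expr_div_n mulrA.
have near_cube y t : ball x rho y -> t <= rho / 2 ->
    ccube y t `<=` [set z : V | forall i, `|z ord0 i - x ord0 i| < 3 / 2 * rho].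
  move=> [_ xy] t2 z zy i; have := xy ord0 i; have /andP[? ?] := zy i.
  rewrite /ball/= !ltr_norml => /andP[? ?]; apply/andP; split; lra.
have in_ball (z : V) : (forall i, `|z ord0 i - x ord0 i| <= 3 / 2 * rho) -> ball x (2 * rho) z.
  move=> H; split=> [|j i]; first by rewrite mulr_gt0.
  by rewrite (ord1 j) /ball/= distrC; apply: le_lt_trans (H i) _; lra.
have top y : S y -> (`|mollify v y (s 0%N) - b|%:E <= (a / 8 + T0)%:E)%E.
  (* Radius 3/2 rho holds the cubes of radius rho / 2 about both x and y, since y is within rho of
     x, and still fits in the ball of radius 2 rho. *)
  move=> /Sx xy; pose D := ccube x (3 / 2 * rho).
  have s0E : s 0%N = rho / 2 by rewrite /s expr1.
  have rho20 : 0 < rho / 2 by rewrite divr_gt0.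
  have c1 : ccube y (s 0%N) `<=` D.
    rewrite s0E => z /(near_cube _ _ xy (lexx _)) H i.
    by have := H i; rewrite ltr_norml => /andP[? ?]; apply/andP; split; lra.
  have c2 : ccube x (rho / 2) `<=` D.
    by move=> z H i; have /andP[? ?] := H i; apply/andP; split; lra.
  have := cmp y (s 0%N) x (rho / 2) (rho / 2) _ _ rho20 _ (lexx _) c1 c2.
  rewrite s0E lexx => /(_ isT) /le_trans; apply.
  have Dball z : D z -> ball x (2 * rho) z.
    move=> H; apply: in_ball => i; have /andP[? ?] := H i.
    by rewrite ler_norml; apply/andP; split; lra.
  have mD : measurable D by exact: measurable_ccube.
  have hY := @integral_norm_young g D taus E taus0 mD mg mE (fun z Dz => Ef z (Dball z Dz)).
  have DG : (\int[mu]_(z in D) E z <= Gq%:E)%E.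
    by rewrite -intE; apply: ge0_subset_integral.
  have K1 : 0 <= K * (rho / 2) ^- m by rewrite mulr_ge0 ?(ltW K0)// invr_ge0 exprn_ge0// ltW.
  apply: (@le_trans _ _ ((K * (rho / 2) ^- m)%:E * ((taus * (3 * rho) ^+ n)%:E +
     (taus `^ (1 - q) * Gq)%:E))%E).
    rewrite lee_wpmul2l ?lee_fin//; apply: (le_trans hY).
    have muD : mu D = ((3 * rho) ^+ n)%:E.
      rewrite /D lebesgue_ccube; last by lra.
      by rewrite mulrA (_ : 2 * (3 / 2) = 3)//; lra.
    by rewrite muD !EFinM leeD2l// lee_wpmul2l// lee_fin powR_ge0.
  rewrite -EFinD -EFinM lee_fin mulrDr /T0 [X in _ + X]mulrA lerD2r.
  rewrite /taus /kappas le_eqVlt; apply/orP; left; apply/eqP.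
  rewrite !exprMn !exprVn !exprS; field.
  by rewrite !expf_neq0 ?gt_eqF.
have tele y k : S y -> (`|mollify v y (s k.+1) - mollify v y (s k)|%:E <=
    (a / 8 * (1 - theta) * theta ^+ k)%:E + (cc k)%:E * G k y)%E.
  move=> /Sx xy; pose D := ccube y (s k).
  have c1 : ccube y (s k.+1) `<=` D.
    move=> z H i; have /andP[? ?] := H i; have := sS k; have := s0 k.+1 => ? ?.
    by apply/andP; split; lra.
  have sk : s k.+1 <= s k by rewrite (sS k) ler_peMl ?ler1n// ltW.
  apply: (le_trans (cmp y (s k.+1) y (s k) (s k.+1) _ _ (s0 _) (lexx _) sk c1 (@subset_refl _ _))).
  have Dball z : D z -> ball x (2 * rho) z.
    by move=> /(near_cube _ _ xy (sle k)) H; apply: in_ball => i; exact/ltW/H.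
  have mD : measurable D by exact: measurable_ccube.
  have hY := @integral_norm_young g D (tau k) E (tau0 k) mD mg mE (fun z Dz => Ef z (Dball z Dz)).
  have K1 : 0 <= K * (s k.+1) ^- m by rewrite mulr_ge0 ?(ltW K0)// invr_ge0 exprn_ge0// ltW.
  apply: (@le_trans _ _ ((K * (s k.+1) ^- m)%:E * ((tau k * (2 * s k) ^+ n)%:E +
     (tau k `^ (1 - q))%:E * G k y))%E).
    rewrite lee_wpmul2l ?lee_fin//; apply: (le_trans hY).
    have muD : mu D = ((2 * s k) ^+ n)%:E by rewrite /D lebesgue_ccube// ltW.
    by rewrite muD -EFinM.
  rewrite ge0_muleDr ?mule_ge0 ?lee_fin ?powR_ge0//; last first.
    by rewrite mulr_ge0 ?(ltW (tau0 k))// exprn_ge0// mulr_ge0// ltW.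
  rewrite muleA -!EFinM /cc leeD2r// lee_fin.
  rewrite /tau /kappa le_eqVlt; apply/orP; left; apply/eqP.
  rewrite (sS k) mulrA; move: (s0 k.+1); move: (s k.+1) => t t0.
  rewrite (_ : 2 * 2 = 4); last by lra.
  rewrite !exprMn !exprS; field.
  by rewrite !expf_neq0 ?gt_eqF.
(* Of the gap a / 2, one share a / 8 is absorbed by the comparison with the cube about x and another
   by all the telescoping thresholds together. *)
have pointwise y : S y -> ((a / 4)%:E <= T0%:E + \sum_(0 <= k <oo) (cc k)%:E * G k y)%E.
  move=> Sy; have [t t0 Ht] := mollify_cst lv oS Sy vc.
  have [N sN] : exists N, s N < t.
    exists (Num.truncn (rho / t)); rewrite /s ltr_pdivrMr ?exprn_gt0// mulrC -ltr_pdivrMr//.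
    apply: (lt_trans (truncnS_gt _)); rewrite -natrX ltr_nat.
    exact: ltn_expl.
  have cE := Ht _ (s0 N) sN.
  have cs0 k : (0 <= (cc k)%:E * G k y)%E by rewrite mule_ge0 ?lee_fin.
  have H1 : ((a / 2)%:E <= (a / 8 + T0)%:E + \sum_(0 <= k < N)
      ((a / 8 * (1 - theta) * theta ^+ k)%:E + (cc k)%:E * G k y))%E.
    apply: (@le_trans _ _ (`|mollify v y (s 0%N) - b| +
        \sum_(0 <= k < N) `|mollify v y (s k.+1) - mollify v y (s k)|)%:E).
      rewrite lee_fin (le_trans ab)//.
      have -> : c - b = (mollify v y (s 0%N) - b) +
          \sum_(0 <= k < N) (mollify v y (s k.+1) - mollify v y (s k)).
        by rewrite (telescope_sumr (fun k => mollify v y (s k)))// cE; ring.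
      by rewrite (le_trans (ler_normD _ _))// lerD2l ler_norm_sum.
    rewrite EFinD leeD ?top// -sumEFin; apply: lee_sum => k _; exact: tele.
  have H2 : (\sum_(0 <= k < N) ((a / 8 * (1 - theta) * theta ^+ k)%:E + (cc k)%:E * G k y) <=
      (a / 8)%:E + \sum_(0 <= k <oo) (cc k)%:E * G k y)%E.
    rewrite big_split/= leeD//; last exact: nneseries_lim_ge.
    rewrite sumEFin lee_fin -mulr_sumr.
    have := sum_geom_le N (ltW theta0) theta1; move: (\sum_(_ <= _ < _) _) => X HX.
    have {}HX : (1 - theta) * X <= 1 by rewrite mulrC -ler_pdivlMr ?subr_gt0// mul1r.
    have := ler_wpM2l (ltW a0) HX; lra.
  have := le_trans H1 (leeD2l _ H2).
  have : (0 <= \sum_(0 <= k <oo) (cc k)%:E * G k y)%E by exact: nneseries_ge0.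
  case: (\sum_(0 <= k <oo) _)%E => [X| |] //= X0.
    by rewrite -!EFinD !lee_fin => ?; lra.
  by move=> _; rewrite addey// leey.
have mS : measurable S by exact: open_measurable_rV.
have Slt : (mu S <= ((2 * rho) ^+ n)%:E)%E.
  rewrite -(lebesgue_ball x rho0); apply: le_measure => //; rewrite inE//.
  exact: measurable_ball_rV.
pose sigma := fine (mu S).
have SE : mu S = sigma%:E by rewrite fineK// ge0_fin_numE//; apply: (le_lt_trans Slt); rewrite ltry.
have Msig : M <= sigma by rewrite -lee_fin -SE.
have sig0 : 0 < sigma by exact: lt_le_trans Msig.
have siglt : sigma <= (2 * rho) ^+ n by rewrite -lee_fin -SE.
(* Here both Tonelli bounds are interpolated with weight [l]; the factor (2 s k)^(n l) is what makes
   the exponent of the scale equal to gamma. *)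
have intG k : (\int[mu]_(y in S) G k y <=
    (sigma `^ (1 - l) * ((2 * s k) ^+ n) `^ l * Gq)%:E)%E.
  have s2 : 0 < (2 * s k) ^+ n by rewrite exprn_gt0// mulr_gt0.
  have [H|/ltW H] := leP sigma ((2 * s k) ^+ n).
    apply: (le_trans (integral_cube_integral_le mE E0 _ mS)).
    rewrite intE SE -EFinM lee_fin ler_wpM2r//.
    exact: le_geometric_mean.
  apply: (le_trans (integral_cube_integral mE E0 mS (ltW (s0 k)))).
  rewrite intE -EFinM lee_fin ler_wpM2r//.
  exact: le_geometric_mean.
have integrated : a / 4 * sigma <= T0 * sigma +
    D1 * (a `^ (1 - q) * rho `^ gamma) * sigma `^ (1 - l) * Gq / (1 - r).
  have mG k : measurable_fun S (G k).
    by apply: measurable_funTS; exact: measurable_cube_integral.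
  have mcG k : measurable_fun S (fun y => (cc k)%:E * G k y)%E by exact: measurable_funeM.
  have cs0 k y : (0 <= (cc k)%:E * G k y)%E by rewrite mule_ge0 ?lee_fin.
  rewrite -lee_fin EFinD !EFinM -SE -integral_cst//.
  apply: (@le_trans _ _ (\int[mu]_(y in S) (T0%:E + \sum_(0 <= k <oo) (cc k)%:E * G k y))%E).
    apply: ge0_le_integral => //.
    - by move=> y _; rewrite lee_fin divr_ge0// ltW.
    - apply: emeasurable_funD => //.
      exact: ge0_emeasurable_sum.
  rewrite ge0_integralD//; last 2 first.
  - by move=> y _; exact: nneseries_ge0.
  - exact: ge0_emeasurable_sum.
  rewrite integral_cst// leeD2l// integral_nneseries//.
  rewrite -!EFinM; apply: nneseries_geom_le => //.
  - by rewrite mulr_ge0// mulr_ge0 ?powR_ge0// mulr_ge0 ?(ltW D10)// mulr_ge0 ?powR_ge0.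
  - by move=> k; exact: integral_ge0.
  move=> k; rewrite ge0_integralZl//; last by rewrite lee_fin.
  apply: (@le_trans _ _ ((cc k)%:E * (sigma `^ (1 - l) * ((2 * s k) ^+ n) `^ l * Gq)%:E)%E).
    by rewrite lee_wpmul2l ?lee_fin.
  rewrite -EFinM lee_fin le_eqVlt; apply/orP; left; apply/eqP.
  have := @pow_scale R K kappa a rho q l theta m k K0 kappa0 a0 rho0 theta0.
  rewrite -/(s k) -/(s k.+1) -/(tau k) -/(cc k) -/gamma -/D1 -/r => H.
  rewrite [LHS](_ : _ = cc k * ((2 * s k) ^+ n) `^ l * (sigma `^ (1 - l) * Gq)); last by ring.
  by rewrite H; ring.
have T0s : T0 * sigma <= D2 * (a `^ (1 - q) * rho `^ gamma) * sigma `^ (1 - l) * Gq.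
  have H := @pow_scale0 R K kappas a rho q l m K0 kappas0 a0 rho0.
  rewrite -/gamma -/D2 -/taus in H; rewrite -H /T0.
  have sg : sigma <= sigma `^ (1 - l) * ((2 * rho) ^+ n) `^ l.
    by apply: le_geometric_mean => //; rewrite exprn_gt0// mulr_gt0.
  rewrite [leRHS](_ : _ = K * (rho / 2) ^- m * taus `^ (1 - q) * Gq *
     (sigma `^ (1 - l) * ((2 * rho) ^+ n) `^ l)); last by ring.
  by rewrite ler_wpM2l.
apply: (@le_trans _ _ (a `^ q * sigma `^ l)).
  rewrite ler_wpM2l ?powR_ge0//; have /andP[l0 _] := l01.
  by apply: ge0_ler_powR; rewrite ?nnegrE ?(ltW M0) ?(ltW sig0).
(* [Q] is the inverse of the factor a^(1 - q) sigma^(1 - l) carried by every term on the right of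
   [integrated]. *)
rewrite powRM_factor//; set Q := a `^ (q - 1) * _.
have Q0 : 0 < Q by rewrite mulr_gt0 ?powR_gt0.
have H1 : a * sigma <=
    4 * (D2 + D1 / (1 - r)) * rho `^ gamma * Gq * (a `^ (1 - q) * sigma `^ (1 - l)).
  rewrite [leRHS](_ : _ = 4 * (D2 * (a `^ (1 - q) * rho `^ gamma) * sigma `^ (1 - l) * Gq +
     D1 * (a `^ (1 - q) * rho `^ gamma) * sigma `^ (1 - l) * Gq / (1 - r))); last by ring.
  lra.
apply: (le_trans (ler_wpM2r (ltW Q0) H1)).
by rewrite -[leLHS]mulrA /Q powRM_cancel // mulr1.
Qed.

End local_bound.

(** * The two-sided lower bound and cut-off functions on cubes *)

Section two_sided.
Variables (R : realType) (m : nat).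
Local Notation n := m.+1.
Local Notation V := 'rV[R]_n.
Local Notation mu := (@lebesgue_rV R n).

(** The average of [v] about x cannot be closer than a / 2 to both a and 0; the one-sided bound is
    applied to the set carrying the farther value. *)
Lemma local_lower_bound (q l : R) : 1 <= q -> 0 <= l <= 1 -> 0 < q - n%:R + n%:R * l ->
  exists2 C : R, 0 < C & forall (v : V -> R) (g : V -> V) x (rho a M : R) (P Z : set V),
  loc_integrable setT v -> is_weak_gradient setT v g ->
  0 < rho -> 0 < a -> 0 < M ->
  open P -> P `<=` ball x rho -> (M%:E <= mu P)%E -> {ae mu, forall z, P z -> v z = a} ->
  open Z -> Z `<=` ball x rho -> (M%:E <= mu Z)%E -> {ae mu, forall z, Z z -> v z = 0} ->
  ((a `^ q * M `^ l)%:E <= (C * rho `^ (q - n%:R + n%:R * l))%:E *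
    \int[mu]_(z in ball x (2 * rho)) (eucl_norm (g z) `^ q)%:E)%E.
Proof.
move=> q1 l01 gamma0; have [C C0 H] := local_one_sided q1 l01 gamma0.
exists C => // v g x rho a M P Z lv vg rho0 a0 M0 oP Px MP vP oZ Zx MZ vZ.
set b := mollify v x (rho / 2).
have [ab|ab] := leP (a / 2) `|a - b|.
  exact: (H v g x rho a M a P).
apply: (H v g x rho a M 0 Z) => //.
by move: ab; rewrite -/b !ltr_norml sub0r normrN ler_normr => /andP[? ?]; apply/orP; left; lra.
Qed.

Lemma cutoff : exists2 C1 : R, 1 <= C1 & forall (x : V) (r1 r2 : R), 0 < r2 -> r2 < r1 ->
  exists (phi : V -> R) (g : 'I_n -> V -> R),
  [/\ forall i z, is_derive z (delta_mx ord0 i) phi (g i z),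
      continuous phi /\ (forall i, continuous (g i)),
      (forall z, ball x r2 z -> phi z = 1) /\ (forall z, 0 <= phi z <= 1),
      forall z, phi z != 0 -> ball x r1 z &
      forall i z, (g i z != 0 -> ball x r1 z) /\ `|g i z| <= C1 / (r1 - r2)].
Proof.
have [Cs Cs1 HCs] := derive1_step_bound R.
exists (8 * Cs); first by lra.
move=> x r1 r2 r20 r12.
(* Transitions of half-width [s] centred at distance [h] run from h - s = r2 to h + s = (r1 + r2) /
   2, which leaves a margin inside the open ball of radius r1. The bound 2 Cs / s on each derivative
   is 8 Cs / (r1 - r2). *)
pose s := (r1 - r2) / 4; have s0 : 0 < s by rewrite divr_gt0// subr_gt0.
pose h := (r1 + 3 * r2) / 4.
pose chi (i : 'I_n) (t : R) : R :=
  kstep (x ord0 i - h) s t * (1 + -1 * kstep (x ord0 i + h) s t).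
have chis i : smooth_line (chi i).
  move=> k; apply: CnM; first exact: smooth_kstep.
  apply: CnD; last by apply: CnZ; exact: smooth_kstep.
  (* The constant 1 is obtained as a step evaluated at the constant point 2. *)
  by apply: Cn_ext (Cn_affine 0 2 (smooth_kstep 0 1 k)) => t; rewrite mul0r add0r kstep_ge//; lra.
have kst c t : 0 <= kstep c s t <= 1 by rewrite /kstep step_ge0 step_le1.
have kbm c t : `|kbump c s t| <= Cs / s.
  by rewrite /kbump normrM gtr0_norm ?invr_gt0// mulrC ler_wpM2r// invr_ge0 ltW.
have chi01 i t : 0 <= chi i t <= 1.
  have /andP[? ?] := kst (x ord0 i - h) t; have /andP[? ?] := kst (x ord0 i + h) t.
  by rewrite /chi; apply/andP; split; [apply: mulr_ge0|apply: mulr_ile1] => //; lra.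
have hs1 : h + s < r1 by rewrite /h /s; lra.
have hs2 : h - s = r2 by rewrite /h /s; lra.
have chi1 i t : `|t - x ord0 i| < r2 -> chi i t = 1.
  rewrite ltr_norml => /andP[? ?]; rewrite /chi kstep_ge//; last by lra.
  by rewrite kstep_le// ?mulr0 ?addr0 ?mulr1//; lra.
have chi0 i t : h + s <= `|t - x ord0 i| -> chi i t = 0.
  rewrite ler_normr => /orP[?|?]; rewrite /chi.
    by rewrite [X in _ * (1 + -1 * X)]kstep_ge ?mulr1 ?subrr ?mulr0//; lra.
  by rewrite kstep_le ?mul0r//; lra.
pose dchi i := (chi i)^`()%classic.
have dchiE i t : dchi i t = kbump (x ord0 i - h) s t * (1 - kstep (x ord0 i + h) s t)
    - kstep (x ord0 i - h) s t * kbump (x ord0 i + h) s t.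
  rewrite /dchi derive1E.
  have d1 := is_derive_kstep (x ord0 i - h) s t.
  have d2 : is_derive t 1 (fun t => 1 + -1 * kstep (x ord0 i + h) s t) (- kbump (x ord0 i + h) s t).
    have := is_deriveD (is_derive_cst (1 : R) t (1 : R))
      (is_deriveZ (-1) (is_derive_kstep (x ord0 i + h) s t)).
    by move=> /is_derive_ext; apply=> //; rewrite add0r scaleN1r.
  have [_ ->] := is_deriveM d1 d2.
  by rewrite /GRing.scale/=; ring.
have dchi_bound i t : `|dchi i t| <= 2 * (Cs / s).
  rewrite dchiE (le_trans (ler_normB _ _))// mulr2n mulrDl mul1r.
  rewrite [X in X + _]normrM [X in _ + X]normrM.
  have /andP[? ?] := kst (x ord0 i - h) t; have /andP[? ?] := kst (x ord0 i + h) t.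
  apply: lerD; [rewrite -[leRHS]mulr1|rewrite -[leRHS]mul1r]; apply: ler_pM => //.
    by rewrite ger0_norm; lra.
  by rewrite ger0_norm.
have dchi0 i t : h + s < `|t - x ord0 i| -> dchi i t = 0.
  move=> ht; rewrite /dchi derive1E (@near_eq_derive R R R _ (cst (0 : R))) ?derive_cst//.
  near=> u; rewrite chi0//; apply: ltW.
  near: u; have : {for t, continuous (fun u : R => `|u - x ord0 i|)}.
    by apply: cvg_norm; apply: cvgB => //; exact: cvg_cst.
  by move=> /(_ _ (lt_nbhsr ht)).
exists (prodf chi), (fun i => prodf (fun j => if j == i then dchi j else chi j)).
have smd i j : smooth_line (if j == i then dchi j else chi j).
  by case: ifP => _ //; exact: smooth_line_derive1.
have inball (z : V) : (forall i, `|z ord0 i - x ord0 i| <= h + s) -> ball x r1 z.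
  move=> H; split=> [|j i]; first exact: lt_trans r12.
  by rewrite (ord1 j) /ball/= distrC; exact: le_lt_trans (H i) hs1.
split.
- by move=> i z; exact: partial_prodf.
- split; first by apply: continuous_prodf => i; exact: smooth_line_continuous.
  by move=> i; apply: continuous_prodf => j; exact: smooth_line_continuous.
- split=> [z [_ xz]|z].
    by rewrite /prodf big1// => i _; apply: chi1; rewrite distrC; exact: xz.
  rewrite /prodf; elim/big_ind : _ => [|u w /andP[u0 u1] /andP[w0 w1]|i _//].
    by rewrite ler01 lexx.
  by rewrite mulr_ge0//= mulr_ile1.
- move=> z /prodf_neq0 H; apply: inball => i.
  by rewrite leNgt; apply: contra (H i isT) => /ltW /chi0 ->; rewrite eqxx.
move=> i z; split.
  move=> /prodf_neq0 H; apply: inball => j; rewrite leNgt; apply: contra (H j isT).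
  by case: ifP => _ ?; [rewrite dchi0|rewrite chi0// ltW].
rewrite /prodf (bigD1 i)//= eqxx normrM.
rewrite (_ : 8 * Cs / (r1 - r2) = 2 * (Cs / s) * 1); last first.
  by rewrite /s; field; rewrite subr_eq0 gt_eqF.
apply: ler_pM => //.
elim/big_ind : _ => [|u w u1 w1|j ji].
- by rewrite normr1.
- by rewrite normrM mulr_ile1.
- by rewrite (negbTE ji); have /andP[? ?] := chi01 j (z ord0 j); rewrite ger0_norm.
Unshelve. all: by end_near. Qed.

End two_sided.

(** * Covering and choice of radii *)

Section vitali.
Variables (R : realType) (n : nat).
Local Notation V := 'rV[R]_n.

Lemma seq_max (T : eqType) (r : T -> R) (s : seq T) : s != [::] ->
  exists2 i, i \in s & forall j, j \in s -> r j <= r i.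
Proof.
elim: s => // i [|j s] IH _.
  by exists i => [|k]; rewrite inE => // /eqP ->.
have [k ks Hk] := IH isT.
have [ik|/ltW ki] := leP (r i) (r k).
  by exists k => [|l]; rewrite inE ?ks ?orbT// => /predU1P[->//|/Hk].
exists i => [|l]; rewrite inE ?eqxx// => /predU1P[->//|/Hk lk].
exact: le_trans ki.
Qed.

(** Greedy selection: a ball of largest radius is kept, those meeting it are discarded, and the rest
    is treated by induction. A discarded ball is no larger than the one it meets, hence lies in its
    threefold dilation. *)
Lemma vitali_finite (rad : V -> R) (s : seq V) : (forall x, x \in s -> 0 < rad x) ->
  exists D : seq V, [/\ uniq D, {subset D <= s},
    forall x y, x \in D -> y \in D -> x != y -> ball x (rad x) `&` ball y (rad y) = set0 &
    forall x, x \in s -> exists2 y, y \in D & ball x (rad x) `<=` ball y (3 * rad y)].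
Proof.
have [k] := ubnP (size s); elim: k s => // k IH s sk rad0.
have [->|s0] := eqVneq s [::]; first by exists [::].
have [y ys ymax] := seq_max rad s0.
pose meets x := `[< ball x (rad x) `&` ball y (rad y) !=set0 >].
have my : meets y.
  by apply/asboolP; exists y; split; apply: ballxx; exact: rad0.
pose s' := [seq x <- s | ~~ meets x].
have s's : {subset s' <= s} by move=> x; rewrite mem_filter => /andP[].
have [||D [uD Ds' tD cD]] := IH s'.
- rewrite -ltnS; apply: leq_trans sk; rewrite ltnS size_filter -(count_predC meets s).
  rewrite -[X in (X < _)%N]add0n ltn_add2r -has_count.
  by apply/hasP; exists y.
- by move=> x /s's; exact: rad0.
have dis x : x \in D -> ball x (rad x) `&` ball y (rad y) = set0.
  move=> /Ds'; rewrite mem_filter => /andP[/asboolPn + _].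
  by move=> /nonemptyPn.
exists (y :: D); split.
- rewrite /= uD andbT; apply/negP => /Ds'.
  by rewrite mem_filter my.
- by move=> x; rewrite inE => /predU1P[->//|/Ds'/s's].
- move=> x z; rewrite !inE => /predU1P[->|xD] /predU1P[->|zD] //.
  + by rewrite eqxx.
  + by move=> _; rewrite setIC dis.
  + by move=> _; rewrite dis.
  + exact: tD.
move=> x xs; have [mx|mx] := boolP (meets x).
  exists y; first by rewrite mem_head.
  have /asboolP[z [xz yz]] := mx.
  move=> w xw; have := ball_triangle (ball_triangle yz (ball_sym xz)) xw.
  by apply: le_ball; have := ymax x xs; lra.
have [|z zD xz] := cD x; first by rewrite mem_filter mx.
by exists z => //; rewrite inE zD orbT.
Qed.

End vitali.

(** * The volume of the domain in small cubes and the choice of radii *)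

Section volume.
Variables (R : realType) (m : nat).
Local Notation n := m.+1.
Local Notation V := 'rV[R]_n.
Local Notation mu := (@lebesgue_rV R n).
Variables (Omega : set V).
Hypothesis oO : open Omega.

Definition vol (x : V) (r : R) : R := fine (mu (Omega `&` ball x r)).

Lemma measurable_Oball x r : measurable (Omega `&` ball x r).
Proof. by apply: measurableI; [exact: open_measurable_rV|exact: measurable_ball_rV]. Qed.

Lemma Oball_lty x r : (mu (Omega `&` ball x r) < +oo)%E.
Proof.
have [r0|r0] := leP r 0.
  rewrite (_ : ball x r = set0) ?setI0 ?measure0//.
  by apply/seteqP; split=> // z [rp _]; move: (lt_le_trans rp r0); rewrite ltxx.
apply: (@le_lt_trans _ _ (mu (ball x r))); last by rewrite lebesgue_ball// ltry.
apply: le_measure; rewrite ?inE; [exact: measurable_Oball|exact: measurable_ball_rV|].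
exact: subIsetr.
Qed.

Lemma volE x r : mu (Omega `&` ball x r) = (vol x r)%:E.
Proof. by rewrite fineK// ge0_fin_numE// Oball_lty. Qed.

#[local] Opaque vol.

Lemma vol_mono x r r' : r <= r' -> vol x r <= vol x r'.
Proof.
move=> rr; rewrite -lee_fin -!volE; apply: le_measure; rewrite ?inE;
  [exact: measurable_Oball..|].
by apply: setIS; exact: le_ball.
Qed.

Lemma vol_le x r : 0 < r -> vol x r <= (2 * r) ^+ n.
Proof.
move=> r0; rewrite -lee_fin -volE -(lebesgue_ball x r0).
apply: le_measure; rewrite ?inE; [exact: measurable_Oball|exact: measurable_ball_rV|].
exact: subIsetr.
Qed.

Lemma vol_gt0 x r : closure Omega x -> 0 < r -> 0 < vol x r.
Proof.
move=> Ox r0; have [z [Oz xz]] := Ox _ (nbhsx_ballx x r r0).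
have oI : open (Omega `&` ball x r) by apply: openI => //; exact: open_ball_rV.
have /nbhs_ballP[e /= e0 eI] : nbhs z (Omega `&` ball x r) by exact: open_nbhs_nbhs.
rewrite -lte_fin -volE; apply: (@lt_le_trans _ _ (mu (ball z e))).
  by rewrite lebesgue_ball// lte_fin exprn_gt0// mulr_gt0.
apply: le_measure; rewrite ?inE; [exact: measurable_ball_rV|exact: measurable_Oball|].
exact: eI.
Qed.

Section radii.
Variable x : V.
Hypothesis Ox : closure Omega x.

Lemma pow2_small (c : R) : 0 < c -> exists k, 2 ^- k < c.
Proof.
move=> c0; exists (Num.truncn c^-1).+1.
rewrite invf_plt ?posrE ?exprn_gt0//; apply: (lt_trans (truncnS_gt _)).
by rewrite -natrX ltr_nat ltn_expl.
Qed.

(** If halving the radius never halved the volume below r0, the volume would decay at most linearly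
    in the radius along r1 / 2^k, against the bound (2 r)^n with n >= 2. *)
Lemma exists_doubling r0 : (2 <= n)%N -> 0 < r0 ->
  exists2 rho, 0 < rho < r0 & vol x (rho / 2) <= vol x rho / 2.
Proof.
move=> n2 r00; apply: contrapT => H.
(* The bound 2 r1 <= 1 makes (2 r1 / 2^k)^n at most (2^(-k))^2, which is less than the lower bound
   vol x r1 / 2^k as soon as 2^(-k) < vol x r1. *)
pose r1 := Num.min r0 1 / 2.
have mn0 : 0 < Num.min r0 1 by rewrite lt_min r00 ltr01.
have r10 : 0 < r1 by rewrite divr_gt0.
have mr0 : Num.min r0 1 <= r0 by rewrite ge_min lexx.
have m1 : Num.min r0 1 <= 1 by rewrite ge_min lexx orbT.
have r1r0 : r1 < r0 by rewrite /r1; lra.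
have r1h : 2 * r1 <= 1 by rewrite /r1; lra.
have H' rho : 0 < rho < r0 -> vol x rho / 2 < vol x (rho / 2).
  by move=> hr; rewrite ltNge; apply/negP => ?; apply: H; exists rho.
have lb k : vol x r1 / 2 ^+ k <= vol x (r1 / 2 ^+ k).
  elim: k => [|k IH]; first by rewrite expr0 !divr1.
  have hr : 0 < r1 / 2 ^+ k < r0.
    rewrite divr_gt0 ?exprn_gt0//=; apply: le_lt_trans r1r0.
    by rewrite ler_pdivrMr ?exprn_gt0// ler_peMr ?(ltW r10)// exprn_ege1// ler1n.
  have := H' _ hr; rewrite exprS invfM [2^-1 * _]mulrC !mulrA => /ltW; apply: le_trans.
  by rewrite ler_pM2r.
have [k Hk] := pow2_small (vol_gt0 Ox r10).
have rk0 : 0 < r1 / 2 ^+ k by rewrite divr_gt0 ?exprn_gt0.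
have := le_trans (lb k) (vol_le x rk0).
apply/negP; rewrite -ltNge.
have k1 : 2 * (r1 / 2 ^+ k) <= 2 ^- k.
  by rewrite mulrA ler_piMl// invr_ge0 exprn_ge0.
have k0 : 0 < 2 ^- k :> R by rewrite invr_gt0 exprn_gt0.
have kle1 : 2 ^- k <= 1 :> R by rewrite invf_le1 ?exprn_gt0// exprn_ege1// ler1n.
apply: (@le_lt_trans _ _ ((2 ^- k) ^+ 2)).
  apply: (@le_trans _ _ ((2 ^- k) ^+ n)).
    by rewrite lerXn2r// nnegrE ltW// mulr_gt0.
  by rewrite ler_wiXn2l// ltW.
by rewrite expr2 ltr_pM2r.
Qed.

Lemma half_step (a b w t : R) : a <= w / t -> 2 * b < a -> b <= w / (2 * t).
Proof. by rewrite invfM [2^-1 * _]mulrC mulrA => H1 H2; lra. Qed.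

(** The radii decrease from 3/8 rho towards rho / 4. As long as each step more than halves the
    volume, the first bound propagates; this cannot go on forever because the volume at radius rho /
    4 is positive, and the first failure is the wanted [j]. *)
Lemma exists_chain theta rho : 0 < theta < 1 -> 0 < rho ->
  exists j, vol x (rho / 8 * (2 + theta ^+ j)) <= vol x (rho / 2) / 2 ^+ j /\
    vol x (rho / 8 * (2 + theta ^+ j)) <= 2 * vol x (rho / 8 * (2 + theta ^+ j.+1)).
Proof.
move=> /andP[t0 t1] rho0.
have h8 : rho / 8 * (2 + 1) <= rho / 2 by lra.
have h4 k : rho / 4 <= rho / 8 * (2 + theta ^+ k).
  have : 0 <= rho * theta ^+ k by rewrite mulr_ge0 ?exprn_ge0// ltW.
  lra.
apply: contrapT => /forallNP H.
have ub j : vol x (rho / 8 * (2 + theta ^+ j)) <= vol x (rho / 2) / 2 ^+ j.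
  elim: j => [|j IH].
    by rewrite !expr0 divr1; apply: vol_mono; exact: h8.
  have /not_andP[//|/negP] := H j; rewrite -ltNge => h.
  by rewrite [2 ^+ j.+1]exprS; exact: half_step IH h.
have q0 : 0 < rho / 4 by rewrite divr_gt0.
have v0 := vol_gt0 Ox q0.
have h0 : 0 < vol x (rho / 2) by rewrite vol_gt0// divr_gt0.
have [k Hk] := pow2_small (divr_gt0 v0 h0).
have := ub k; apply/negP; rewrite -ltNge.
apply: (@lt_le_trans _ _ (vol x (rho / 4))).
  by rewrite mulrC -ltr_pdivlMr.
by apply: vol_mono; exact: h4.
Qed.

End radii.

(** The last inequality trades the narrowness of the transition layer for the smallness of the
    volume inside it, leaving a negative power of the volume fraction at scale rho. It is used with
    e = q/p - l. *)
Lemma good_cube (q e : R) : (2 <= n)%N -> 1 <= q -> 0 < e ->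
  exists2 c0 : R, 0 < c0 & forall x, closure Omega x -> forall r0, 0 < r0 -> exists rho r1 r2 : R,
  [/\ 0 < rho < r0, 0 < r2 < r1, r1 <= 3 / 8 * rho,
    vol x r1 <= 2 * vol x r2 /\ vol x (rho / 2) <= vol x rho / 2 &
    c0 * (vol x rho / rho ^+ n) `^ (- e) <=
      ((r1 - r2) / rho) `^ q * (rho ^+ n / vol x r1) `^ e].
Proof.
move=> n2 q1 e0; have q0 : 0 < q by exact: lt_le_trans q1.
(* With this ratio, [(theta ^ j) ^ q = 2 ^ (- j * e)] is exactly what the bound
   [vol x r1 <= vol x rho / 2 ^ j] makes up for. *)
pose theta : R := 2 `^ (- (e / q)).
have t0 : 0 < theta by exact: powR_gt0.
have t1 : theta < 1.
  rewrite /theta -[X in X `^ _](@lnK R 2) ?posrE// -expRM -[ltRHS]expR0 ltr_expR.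
  by rewrite pmulr_rlt0 ?ln_gt0 ?ltr1n// oppr_lt0 divr_gt0.
exists (((1 - theta) / 8) `^ q); first by apply: powR_gt0; rewrite divr_gt0 ?subr_gt0.
move=> x Ox r0 r00; have [rho /andP[rho0 rhor] dbl] := exists_doubling Ox n2 r00.
have t01 : 0 < theta < 1 by rewrite t0.
have rle t : t <= 1 -> rho / 8 * (2 + t) <= 3 / 8 * rho.
  by move=> tle; have := ler_wpM2l (ltW rho0) tle; lra.
have hr : rho / 2 <= rho by lra.
have [j [jv jd]] := exists_chain Ox t01 rho0.
set r1 := rho / 8 * (2 + theta ^+ j) in jv jd *.
set r2 := rho / 8 * (2 + theta ^+ j.+1) in jv jd *.
have tj : 0 < theta ^+ j by rewrite exprn_gt0.
have tj1 : theta ^+ j <= 1 by rewrite exprn_ile1 ?ltW.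
have r12 : r1 - r2 = rho * ((1 - theta) / 8 * theta ^+ j).
  by rewrite /r1 /r2 exprS; field.
have d0 : 0 < (1 - theta) / 8 by rewrite divr_gt0// subr_gt0.
have r10 : 0 < r1 by rewrite mulr_gt0 ?divr_gt0// addr_gt0.
exists rho, r1, r2; split.
- by rewrite rho0.
- rewrite mulr_gt0 ?divr_gt0 ?addr_gt0 ?exprn_gt0//=.
  by rewrite -subr_gt0 r12 mulr_gt0// mulr_gt0.
- exact: rle.
- by [].
have v1 : 0 < vol x r1 by exact: vol_gt0.
have v0 : 0 < vol x rho by exact: vol_gt0.
have vle : vol x r1 <= vol x rho / 2 ^+ j.
  apply: (le_trans jv); apply: ler_wpM2r; last exact: vol_mono.
  by rewrite invr_ge0 exprn_ge0.
rewrite r12 [rho * _]mulrC mulfK ?(gt_eqF rho0)//.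
move: {jv jd dbl} v1 v0 vle; move: (vol x r1) (vol x rho) => w W w0 W0 wW.
(* Replacing vol x r1 by its upper bound W / 2^j can only lower the right-hand side, since e > 0;
   after that the two sides are equal. *)
apply: (@le_trans _ _ (((1 - theta) / 8 * theta ^+ j) `^ q *
    (rho ^+ n / (W / 2 ^+ j)) `^ e)); last first.
  rewrite ler_wpM2l ?powR_ge0//; apply: ge0_ler_powR; rewrite ?nnegrE ?(ltW e0)//.
  - by rewrite !divr_ge0 ?exprn_ge0// ?(ltW rho0)// ltW.
  - by rewrite divr_ge0 ?exprn_ge0// ltW.
  - rewrite ler_pM2l ?exprn_gt0// lef_pV2 ?posrE//.
    by rewrite divr_gt0 ?exprn_gt0.
rewrite le_eqVlt; apply/orP; left; apply/eqP.
move: d0 rho0 W0; rewrite /theta.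
move=> /exists_expR[ld ->] /exists_expR[lr ->] /exists_expR[lv ->].
have /exists_expR[l2 ->] : 0 < 2 :> R by [].
rewrite -!(expRM, expRN, expRM_natl, expRD); congr expR.
by field; rewrite gt_eqF.
Qed.

End volume.

(** * The test function *)

Section finite_sums.
Variables (R : realType) (n : nat) (I : eqType).
Local Notation V := 'rV[R]_n.

Lemma is_derive_lincomb (D : seq I) (c d : I -> R) (f : I -> V -> R) (z v : V) :
  (forall x, is_derive z v (f x) (d x)) ->
  is_derive z v (fun z => \sum_(x <- D) c x * f x z) (\sum_(x <- D) c x * d x).
Proof.
move=> fd; elim: D => [|x D IH].
  rewrite (_ : (fun _ => _) = cst 0); last by apply/funext => y; rewrite big_nil.
  by rewrite big_nil; exact: is_derive_cst.
rewrite (_ : (fun _ => _) =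
    (fun z => c x * f x z) + (fun z => \sum_(x <- D) c x * f x z)); last first.
  by apply/funext => y; rewrite big_cons.
by rewrite big_cons; apply: is_deriveD; exact: is_deriveZ.
Qed.

Lemma continuous_lincomb (D : seq I) (c : I -> R) (f : I -> V -> R) :
  (forall x, continuous (f x)) -> continuous (fun z => \sum_(x <- D) c x * f x z).
Proof.
move=> cf; elim: D => [|x D IH].
  rewrite (_ : (fun _ => _) = cst 0); last by apply/funext => y; rewrite big_nil.
  exact: cst_continuous.
rewrite (_ : (fun _ => _) =
    (fun z => c x * f x z) + (fun z => \sum_(x <- D) c x * f x z)); last first.
  by apply/funext => y; rewrite big_cons.
move=> z; apply: continuousD; last exact: IH.
by apply: continuousM; [exact: cst_continuous|exact: cf].
Qed.

End finite_sums.

Lemma sum_seq1 (R : realType) (I : eqType) (D : seq I) (x : I) (f : I -> R) :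
  uniq D -> x \in D -> (forall y, y \in D -> y != x -> f y = 0) -> \sum_(y <- D) f y = f x.
Proof.
move=> uD xD f0; rewrite (bigD1_seq x)//= big_seq_cond big1 ?addr0// => y /andP[yD yx].
exact: f0.
Qed.

Lemma eucl_norm0 (R : realType) n : eucl_norm (0 : 'rV[R]_n) = 0.
Proof. by rewrite /eucl_norm big1 ?sqrtr0// => i _; rewrite mxE expr0n. Qed.

Section test_bumps.
Variables (R : realType) (m : nat).
Local Notation n := m.+1.
Local Notation V := 'rV[R]_n.
Local Notation mu := (@lebesgue_rV R n).
Variables (Omega : set V) (p : R).
Hypotheses (oO : open Omega) (Ofin : (mu Omega < +oo)%E) (p0 : 0 < p).

Let a (rho r1 r2 : V -> R) x := (r1 x - r2 x) * (rho x ^+ n / vol Omega x (r1 x)) `^ p^-1.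

(** The height is tuned so that slope^p times the volume of the support in Omega equals rho^n. By
    disjointness of the doubled balls at most one bump is nonzero at any point, so the contributions
    simply add up. *)
Lemma sobolev_bumps : exists2 K2 : R, 0 < K2 & forall (D : seq V) (rho r1 r2 : V -> R),
  uniq D ->
  (forall x, x \in D ->
    [/\ 0 < vol Omega x (r1 x), 0 < rho x < 1, 0 < r2 x < r1 x & r1 x <= rho x]) ->
  (forall x y, x \in D -> y \in D -> x != y -> ball x (2 * rho x) `&` ball y (2 * rho y) = set0) ->
  exists u : V -> R, [/\ sobolev p Omega u,
    (sobolev_norm p Omega u <= ((K2 * \sum_(x <- D) rho x ^+ n) `^ p^-1)%:E)%E,
    forall x, x \in D -> forall z, ball x (r2 x) z -> u z = a rho r1 r2 x &
    forall x, x \in D -> forall z, ball x (2 * rho x) z -> ~ ball x (r1 x) z -> u z = 0].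
Proof.
have [C1 C11 cut] := @cutoff R m.
have C10 : 0 < C1 by exact: lt_le_trans C11.
(* The 1 pays for |u|^p, and (n C1)^p for the gradient, whose Euclidean norm is at most the sum of
   its n coordinates in absolute value. *)
have [K2 K2E] : exists K2, K2 = 1 + (n%:R * C1) `^ p by eexists.
have K20 : 0 < K2 by rewrite K2E ltr_wpDr ?powR_ge0.
exists K2 => // D rho r1 r2 uD HD dD.
have cut' x : exists fg : (V -> R) * ('I_n -> V -> R), 0 < r2 x -> r2 x < r1 x ->
  [/\ forall i z, is_derive z (delta_mx ord0 i) fg.1 (fg.2 i z),
      continuous fg.1 /\ (forall i, continuous (fg.2 i)),
      (forall z, ball x (r2 x) z -> fg.1 z = 1) /\ (forall z, 0 <= fg.1 z <= 1),
      forall z, fg.1 z != 0 -> ball x (r1 x) z &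
      forall i z, (fg.2 i z != 0 -> ball x (r1 x) z) /\ `|fg.2 i z| <= C1 / (r1 x - r2 x)].
  have [h2|h2] := pselect (0 < r2 x); last by exists (cst 0, fun=> cst 0) => /h2.
  have [h1|h1] := pselect (r2 x < r1 x); last by exists (cst 0, fun=> cst 0) => _ /h1.
  by have [phi [g Hg]] := cut x (r1 x) (r2 x) h2 h1; exists (phi, g).
have {cut'} [fg Hfg] := choice cut'.
pose ok x := (0 < r2 x) && (r2 x < r1 x).
(* Zero functions are used where the radii are not ordered, so that regularity holds for every
   index, as the lemmas on linear combinations ask. *)
pose phi x : V -> R := if ok x then (fg x).1 else cst 0.
pose g x i : V -> R := if ok x then (fg x).2 i else cst 0.
have Hphi x i z : is_derive z (delta_mx ord0 i) (phi x) (g x i z).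
  rewrite /phi /g; case: ifPn => [/andP[h1 h2]|_]; last exact: is_derive_cst.
  by have [H _ _ _ _] := Hfg x h1 h2; exact: H.
have cphi x : continuous (phi x).
  rewrite /phi; case: ifPn => [/andP[h1 h2]|_]; last exact: cst_continuous.
  by have [_ [H _] _ _ _] := Hfg x h1 h2; exact: H.
have cg x i : continuous (g x i).
  rewrite /g; case: ifPn => [/andP[h1 h2]|_]; last exact: cst_continuous.
  by have [_ [_ H] _ _ _] := Hfg x h1 h2; exact: H.
have okD x : x \in D -> ok x by move=> /HD[_ _].
have phi1 x z : x \in D -> ball x (r2 x) z -> phi x z = 1.
  move=> /okD /[dup] o /andP[h1 h2]; rewrite /phi o.
  by have [_ _ [H _] _ _] := Hfg x h1 h2; exact: H.
have phi01 x z : 0 <= phi x z <= 1.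
  rewrite /phi; case: ifPn => [/andP[h1 h2]|_]; last by rewrite lexx ler01.
  by have [_ _ [_ H] _ _] := Hfg x h1 h2; exact: H.
have phis x z : phi x z != 0 -> ball x (r1 x) z.
  rewrite /phi; case: ifPn => [/andP[h1 h2]|_]; last by rewrite eqxx.
  by have [_ _ _ H _] := Hfg x h1 h2; exact: H.
have gs x i z : g x i z != 0 -> ball x (r1 x) z.
  rewrite /g; case: ifPn => [/andP[h1 h2]|_]; last by rewrite eqxx.
  by have [_ _ _ _ /(_ i z)[H _]] := Hfg x h1 h2; exact: H.
have gb x i z : x \in D -> `|g x i z| <= C1 / (r1 x - r2 x).
  move=> /okD /[dup] o /andP[h1 h2]; rewrite /g o.
  by have [_ _ _ _ /(_ i z)[_ H]] := Hfg x h1 h2; exact: H.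
have [A AE] : exists A, forall x, A x = a rho r1 r2 x by exists (a rho r1 r2).
have [u uE] : exists u, u = (fun z => \sum_(x <- D) A x * phi x z) by eexists.
have [gu guE] : exists gu : V -> V, forall z i, gu z ord0 i = \sum_(x <- D) A x * g x i z.
  by exists (fun z => \row_i \sum_(x <- D) A x * g x i z) => z i; rewrite mxE.
have other x y z : x \in D -> y \in D -> y != x -> ball x (2 * rho x) z -> ~ ball y (r1 y) z.
  move=> xD yD yx xz yz; have [_ /andP[ry _] _ r1y] := HD y yD.
  have : (ball y (2 * rho y) `&` ball x (2 * rho x)) z.
    by split=> //; apply: le_ball yz; lra.
  by rewrite dD.
have ux x z : x \in D -> ball x (2 * rho x) z -> u z = A x * phi x z.
  move=> xD xz; rewrite uE (sum_seq1 uD xD)// => y yD yx.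
  have [->|/phis yz] := eqVneq (phi y z) 0; first by rewrite mulr0.
  by have := other x y z xD yD yx xz yz.
have gux x z i : x \in D -> ball x (2 * rho x) z -> gu z ord0 i = A x * g x i z.
  move=> xD xz; rewrite guE (sum_seq1 uD xD)// => y yD yx.
  have [->|/gs yz] := eqVneq (g y i z) 0; first by rewrite mulr0.
  by have := other x y z xD yD yx xz yz.
have u0 z : (forall x, x \in D -> ~ ball x (r1 x) z) -> u z = 0.
  move=> H; rewrite uE big_seq big1// => x xD.
  by have [->|/phis/(H x xD)] := eqVneq (phi x z) 0; first by rewrite mulr0.
have gu0 z i : (forall x, x \in D -> ~ ball x (r1 x) z) -> gu z ord0 i = 0.
  move=> H; rewrite guE big_seq big1// => x xD.
  by have [->|/gs/(H x xD)] := eqVneq (g x i z) 0; first by rewrite mulr0.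
pose r : R := \sum_(x <- D) (`|x| + rho x).
have ball_cube x z : x \in D -> ball x (r1 x) z -> @cube0 R n r z.
  move=> xD [_ xz] i; have [_ /andP[rx _] _ r1x] := HD x xD.
  have xr : `|x| + rho x <= r.
    rewrite /r (bigD1_seq x)//= lerDl big_seq_cond sumr_ge0// => y /andP[yD _].
    by have [_ /andP[ry _] _ _] := HD y yD; rewrite addr_ge0// ltW.
  have xi := coord_le_norm x i.
  have := xz ord0 i; rewrite /ball/= ltr_norml => /andP[? ?].
  by move: xi; rewrite ler_norml => /andP[? ?]; apply/andP; split; lra.
have [su nu] : sobolev p Omega u /\ sobolev_norm p Omega u =
    ((\int[mu]_(x in Omega) (`|u x| `^ p + eucl_norm (gu x) `^ p)%:E) `^ p^-1)%E.
  apply: (@sobolev_C1 R n p r) => //.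
  - move=> i z; rewrite uE guE; apply: is_derive_lincomb => x; exact: Hphi.
  - by rewrite uE; exact: continuous_lincomb.
  - move=> i; rewrite (_ : (fun _ => _) = fun z => \sum_(x <- D) A x * g x i z).
      exact: continuous_lincomb.
    by apply/funext => z; rewrite guE.
  - move=> z; apply: contraNP => H; rewrite u0 ?eqxx// => x xD xz.
    by apply: H; exact: ball_cube xz.
  - move=> i z; apply: contraNP => H; rewrite gu0 ?eqxx// => x xD xz.
    by apply: H; exact: ball_cube xz.
have A0 x : x \in D -> 0 < A x.
  move=> /HD[v0 /andP[rx _] /andP[_ r12] _].
  rewrite AE; apply: mulr_gt0; first by rewrite subr_gt0.
  by apply: powR_gt0; apply: divr_gt0; [exact: exprn_gt0|exact: v0].
exists u; split; [exact: su| | |]; last 2 first.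
- move=> x xD z xz.
  have [_ /andP[rx _] /andP[_ r12] r1x] := HD x xD.
  have xz2 : ball x (2 * rho x) z by apply: le_ball xz; lra.
  by rewrite (ux x z xD xz2) (phi1 x z xD xz) mulr1 AE.
- move=> x xD z xz nz; rewrite (ux x z xD xz).
  have [e0|h] := eqVneq (phi x z) 0.
    by rewrite e0 mulr0.
  exfalso.
  exact: nz (phis x z h).
rewrite nu.
have [c cE] : exists c, forall x, c x = K2 * (A x / (r1 x - r2 x)) `^ p.
  by exists (fun x => K2 * (A x / (r1 x - r2 x)) `^ p).
have c0 x : 0 <= c x by rewrite cE mulr_ge0 ?powR_ge0 ?(ltW K20).
have bound z : `|u z| `^ p + eucl_norm (gu z) `^ p <=
    \sum_(x <- D) c x * \1_(ball x (r1 x)) z.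
  have [[x xD xz]|H] := pselect (exists2 x, x \in D & ball x (r1 x) z); last first.
    have H' x : x \in D -> ~ ball x (r1 x) z by move=> xD xz; apply: H; exists x.
    have pn0 : p != 0 by rewrite gt_eqF.
    rewrite (u0 z H').
    have -> : gu z = 0.
      by apply/rowP => i; rewrite (gu0 z i H') mxE.
    rewrite eucl_norm0 normr0 (powR0 pn0) add0r.
    by apply: sumr_ge0 => y _; apply: mulr_ge0; [exact: c0|rewrite indicE ler0n].
  have [v0 /andP[rx rx1] /andP[r20 r12] r1x] := HD x xD.
  have xz2 : ball x (2 * rho x) z by apply: le_ball xz; lra.
  apply: (@le_trans _ _ (c x)); last first.
    rewrite (bigD1_seq x xD uD) /= indicE (mem_set xz) mulr1 lerDl.
    by apply: sumr_ge0 => y _; apply: mulr_ge0; [exact: c0|rewrite indicE ler0n].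
  have d0 : 0 < r1 x - r2 x by rewrite subr_gt0.
  (* Since r1 <= rho < 1, the layer is thinner than 1 and the height is dominated by the slope. *)
  have Ad : A x <= A x / (r1 x - r2 x).
    by rewrite (ler_pdivlMr _ _ d0); apply: ler_piMr; [exact: ltW (A0 x xD)|lra].
  have Ad0 : 0 <= A x / (r1 x - r2 x) by apply: divr_ge0; [exact: ltW (A0 x xD)|exact: ltW].
  rewrite cE K2E mulrDl mul1r; apply: lerD.
    apply: ge0_ler_powR; rewrite ?nnegrE; [exact: ltW|exact: normr_ge0|exact: Ad0|].
    have /andP[f0 f1] := phi01 x z; have Ax0 := ltW (A0 x xD).
    rewrite (ux x z xD xz2) ger0_norm; last exact: mulr_ge0.
    by apply: le_trans Ad; apply: ler_piMr.
  have nC : 0 <= n%:R * C1 by apply: mulr_ge0; [exact: ler0n|exact: ltW].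
  rewrite -(powRM _ nC Ad0).
  apply: ge0_ler_powR; rewrite ?nnegrE; [exact: ltW|exact: eucl_norm_ge0|exact: mulr_ge0|].
  apply: (le_trans (eucl_norm_le_sum _)).
  apply: (@le_trans _ _ (\sum_(i < n) (C1 * (A x / (r1 x - r2 x))))).
    apply: ler_sum => i _; rewrite (gux x z i xD xz2) normrM (gtr0_norm (A0 x xD)).
    by rewrite mulrCA (ler_pM2l (A0 x xD)); exact: gb.
  by rewrite sumr_const card_ord -[leLHS]mulr_natl [leLHS]mulrA lexx.
have mO : measurable Omega by exact: open_measurable_rV.
have mgu i : measurable_fun setT (fun z => gu z ord0 i).
  rewrite (_ : (fun _ => _) = fun z => \sum_(x <- D) A x * g x i z).
    by apply: continuous_measurable_rV; exact: continuous_lincomb.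
  by apply/funext => z; rewrite guE.
have mpow (h : V -> R) : measurable_fun setT h -> measurable_fun setT (fun x => h x `^ p).
  by move=> mh; apply: (@measurableT_comp _ _ _ _ _ _ (@powR R ^~ p)).
have intb : (\int[mu]_(x in Omega) (`|u x| `^ p + eucl_norm (gu x) `^ p)%:E <=
    (K2 * \sum_(x <- D) rho x ^+ n)%:E)%E.
  have mball x : measurable_fun Omega (fun z => (c x)%:E * (\1_(ball x (r1 x)) z)%:E)%E.
    apply: measurable_funeM; apply/measurable_EFinP.
    by apply: measurable_indic; exact: measurable_ball_rV.
  have cpos x z : (0 <= (c x)%:E * (\1_(ball x (r1 x)) z)%:E)%E.
    by rewrite -EFinM lee_fin; apply: mulr_ge0; [exact: c0|rewrite indicE ler0n].
  apply: (@le_trans _ _ (\int[mu]_(z in Omega)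
      \sum_(x <- D) (c x)%:E * (\1_(ball x (r1 x)) z)%:E)%E).
    apply: ge0_le_integral; first exact: mO.
    - by move=> z _; rewrite lee_fin; apply: addr_ge0; exact: powR_ge0.
    - apply: measurable_funTS; apply/measurable_EFinP; apply: measurable_funD; apply: mpow.
        apply: measurableT_comp; first exact: normr_measurable.
        by apply: continuous_measurable_rV; rewrite uE; exact: continuous_lincomb.
      exact: measurable_eucl_norm measurableT mgu.
    - by apply: emeasurable_sum => x; exact: mball.
    - move=> z _; rewrite (eq_bigr (fun x => (c x * \1_(ball x (r1 x)) z)%:E)) => [|x _].
        by rewrite sumEFin lee_fin; exact: bound.
      by rewrite EFinM.
  rewrite (ge0_integral_sum _ mO mball (fun x z _ => cpos x z)).
  rewrite mulr_sumr -sumEFin big_seq [leRHS]big_seq; apply: lee_sum => x xD.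
  have [v0 /andP[rx rx1] /andP[r20 r12] r1x] := HD x xD.
  rewrite ge0_integralZl; [|exact: mO| | |]; last 3 first.
  - apply/measurable_EFinP; apply: measurable_indic; exact: measurable_ball_rV.
  - by move=> z _; rewrite lee_fin indicE ler0n.
  - by rewrite lee_fin; exact: c0.
  rewrite integral_indic; [|exact: mO|exact: measurable_ball_rV].
  rewrite [X in ((c x)%:E * X)%E](_ : _ = (vol Omega x (r1 x))%:E); last first.
    by rewrite setIC; exact: volE.
  rewrite -EFinM lee_fin.
  have d0 : r1 x - r2 x != 0 by apply: lt0r_neq0; rewrite subr_gt0.
  have pn0 : p != 0 by exact: lt0r_neq0.
  have vn0 : vol Omega x (r1 x) != 0 by exact: lt0r_neq0.
  have q0 : 0 <= rho x ^+ n / vol Omega x (r1 x).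
    by apply: divr_ge0; [apply: exprn_ge0; exact: ltW|exact: ltW].
  (* The p-th power of A / (r1 - r2) is rho^n / vol x r1, so multiplying by the volume leaves K2
     rho^n. *)
  rewrite cE AE /a [(r1 x - r2 x) * _]mulrC (mulfK d0) -powRrM (mulVf pn0) (powRr1 q0).
  by rewrite -mulrA (divfK vn0) lexx.
rewrite -poweR_EFin; apply: gt0_ler_poweR; last exact: intb.
- by rewrite invr_ge0 ltW.
- by rewrite in_itv/= leey andbT; apply: integral_ge0 => z _; rewrite lee_fin addr_ge0 ?powR_ge0.
- rewrite in_itv/= leey andbT lee_fin; apply: mulr_ge0; first exact: ltW.
  rewrite big_seq; apply: sumr_ge0 => x xD.
  by have [_ /andP[rx _] _ _] := HD x xD; apply: exprn_ge0; exact: ltW.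
Qed.

End test_bumps.

(** The left side is that of [local_lower_bound] for a bump of layer width [d] and volume [w].
    Extracting rho^gamma, which cancels there, leaves rho^n times a scale-invariant quantity. *)
Lemma pow_cube (R : realType) (q p l rho d w : R) (n : nat) :
  0 < rho -> 0 < d -> 0 < w -> p != 0 ->
  (d * (rho ^+ n / w) `^ p^-1) `^ q * (w / 2) `^ l =
  rho `^ (q - n%:R + n%:R * l) *
    (2 `^ (- l) * (rho ^+ n * ((d / rho) `^ q * (rho ^+ n / w) `^ (q / p - l)))).
Proof.
move=> /exists_expR[lr ->] /exists_expR[ld ->] /exists_expR[lw ->] p0.
have /exists_expR[l2 ->] : 0 < 2 :> R by [].
rewrite -!(expRM, expRN, expRM_natl, expRD); congr expR.
by field.
Qed.

Lemma sum_integral_disjoint (R : realType) (n : nat) (D : seq 'rV[R]_n) (rad : 'rV[R]_n -> R)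
    (f : 'rV[R]_n -> \bar R) :
  uniq D -> measurable_fun setT f -> (forall z, 0 <= f z)%E ->
  (forall x y, x \in D -> y \in D -> x != y -> ball x (rad x) `&` ball y (rad y) = set0) ->
  (\sum_(x <- D) \int[@lebesgue_rV R n]_(z in ball x (rad x)) f z =
    \int[@lebesgue_rV R n]_(z in \big[setU/set0]_(x <- D) ball x (rad x)) f z)%E.
Proof.
move=> uD mf f0 dD; rewrite ge0_integral_bigsetU//.
- by move=> x; exact: measurable_ball_rV.
- move=> x y /= xD yD /set0P xy; apply/eqP; apply: contraNT xy => xy.
  by rewrite dD ?eqxx.
- exact: measurable_funTS.
Qed.

Lemma measurable_bigsetU_ball (R : realType) (n : nat) (D : seq 'rV[R]_n) (rad : 'rV[R]_n -> R) :
  measurable (\big[setU/set0]_(x <- D) ball x (rad x)).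
Proof. by apply: bigsetU_measurable => x _; exact: measurable_ball_rV. Qed.

Lemma sum_measure_disjoint (R : realType) (n : nat) (D : seq 'rV[R]_n) (rad : 'rV[R]_n -> R)
    (B : set 'rV[R]_n) :
  uniq D -> measurable B ->
  (forall x y, x \in D -> y \in D -> x != y -> ball x (rad x) `&` ball y (rad y) = set0) ->
  (\sum_(x <- D) (@lebesgue_rV R n) (B `&` ball x (rad x)) <= (@lebesgue_rV R n) B)%E.
Proof.
move=> uD mB dD.
have mBi : measurable_fun setT (EFin \o (\1_B : 'rV[R]_n -> R)).
  by apply/measurable_EFinP; exact: measurable_indic.
rewrite (eq_bigr (fun x =>
    \int[@lebesgue_rV R n]_(z in ball x (rad x)) (EFin \o \1_B) z)%E); last first.
  by move=> x _; rewrite integral_indic//; exact: measurable_ball_rV.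
rewrite sum_integral_disjoint//; last by move=> z; rewrite lee_fin.
have -> : (@lebesgue_rV R n B = \int[@lebesgue_rV R n]_z (EFin \o \1_B) z)%E.
  by rewrite integral_indic// setIT.
apply: ge0_subset_integral => //; first exact: measurable_bigsetU_ball.
by move=> z _; rewrite lee_fin.
Qed.

Lemma ball_sub_ccube (R : realType) (n : nat) (x : 'rV[R]_n) (r s : R) : r <= s ->
  ball x r `<=` ccube x s.
Proof.
move=> rs z [_ xz] i; have := xz ord0 i.
by rewrite /ball/= distrC ltr_norml => /andP[h1 h2]; apply/andP; split; lra.
Qed.

(** * The energy estimate given by the extension property *)

Section energy.
Variables (R : realType) (m : nat).
Local Notation n := m.+1.
Local Notation V := 'rV[R]_n.
Local Notation mu := (@lebesgue_rV R n).
Variables (Omega : set V) (p q l : R).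
Hypotheses (oO : open Omega) (Ofin : (mu Omega < +oo)%E).
Hypotheses (q1 : 1 <= q) (p0 : 0 < p) (l01 : 0 <= l <= 1).
Hypothesis gamma0 : 0 < q - n%:R + n%:R * l.
Variables (Ext : (V -> R) -> (V -> R)) (CE : R).
Hypothesis CE0 : 0 < CE.
Hypothesis HE : forall u, sobolev p Omega u ->
  [/\ sobolev q setT (Ext u), Ext u = u %[ae mu in Omega] &
      (sobolev_norm q setT (Ext u) <= CE%:E * sobolev_norm p Omega u)%E].

Lemma open_corona (x : V) (r s : R) :
  open (Omega `&` ball x r `&` ~` ccube x s).
Proof.
apply: openI; first by apply: openI => //; exact: open_ball_rV.
by apply: closed_openC; exact: closed_cbox.
Qed.

(** The removed cube lies in the ball of radius rho / 2, which holds at most half of the volume.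
    Removing a closed cube keeps the set open, and radius 3/8 rho is enough to contain the support
    of the bump. *)
Lemma vol_corona (x : V) (rho : R) : 0 < rho ->
  vol Omega x (rho / 2) <= vol Omega x rho / 2 ->
  ((vol Omega x rho / 2)%:E <= mu (Omega `&` ball x rho `&` ~` ccube x (3 / 8 * rho)))%E.
Proof.
move=> rho0 dbl; set Z := _ `&` _.
have mZ : measurable Z by apply: open_measurable_rV; exact: open_corona.
have mB := measurable_Oball oO x (rho / 2).
have : (mu (Omega `&` ball x rho) <= mu (Z `|` (Omega `&` ball x (rho / 2))))%E.
  apply: le_measure; rewrite ?inE; [exact: measurable_Oball|exact: measurableU|].
  move=> z [Oz xz]; have [zc|zc] := pselect (ccube x (3 / 8 * rho) z).
    right; split=> //; split=> [|j i]; first by rewrite divr_gt0.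
    have /andP[? ?] := zc i; rewrite (ord1 j) /ball/= distrC ltr_norml.
    by clear dbl; apply/andP; split; lra.
  by left; split.
move=> /le_trans/(_ (measureU2 _ mZ mB)) H'.
have H : (mu (Omega `&` ball x rho) <= mu Z + mu (Omega `&` ball x (rho / 2)))%E by exact: H'.
rewrite !volE// in H.
have Zfin : mu Z \is a fin_num.
  rewrite ge0_fin_numE//; apply: le_lt_trans (Oball_lty oO x rho).
  apply: le_measure; rewrite ?inE; [exact: mZ|exact: measurable_Oball|].
  exact: subIsetl.
move: H; rewrite -(fineK Zfin) -EFinD !lee_fin.
by move: (vol _ _ _) (vol _ _ _) dbl => ? ? ? ?; lra.
Qed.

(** The local bounds are summed over disjoint balls, so that the right side is at most the q-th
    power of the norm of the extension; the p-th root in the norm of [u] turns it into the power q/p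
    of the sum of rho^n. *)
Lemma energy_bound : exists2 C4 : R, 0 < C4 & forall (D : seq V) (rho r1 r2 : V -> R),
  uniq D ->
  (forall x, x \in D -> [/\ 0 < vol Omega x (r1 x), 0 < rho x < 1, 0 < r2 x < r1 x,
     r1 x <= 3 / 8 * rho x & vol Omega x (r1 x) <= 2 * vol Omega x (r2 x) /\
       vol Omega x (rho x / 2) <= vol Omega x (rho x) / 2]) ->
  (forall x y, x \in D -> y \in D -> x != y -> ball x (2 * rho x) `&` ball y (2 * rho y) = set0) ->
  \sum_(x <- D) rho x ^+ n * (((r1 x - r2 x) / rho x) `^ q *
      (rho x ^+ n / vol Omega x (r1 x)) `^ (q / p - l)) <=
  C4 * (\sum_(x <- D) rho x ^+ n) `^ (q / p).
Proof.
have [K2 K20 HK] := sobolev_bumps oO Ofin p0.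
have [C C0 loc] := @local_lower_bound R m q l q1 l01 gamma0.
have q0 : 0 < q by exact: lt_le_trans q1.
have pn0 : p != 0 by exact: lt0r_neq0.
have qn0 : q != 0 by exact: lt0r_neq0.
have [C4 C4E] : exists C4, C4 = 2 `^ l * (C * (CE `^ q * K2 `^ (q / p))) by eexists.
exists C4.
  rewrite C4E; apply: mulr_gt0; first exact: powR_gt0.
  by apply: mulr_gt0 => //; apply: mulr_gt0; exact: powR_gt0.
move=> D rho r1 r2 uD HD dD.
have HD' x : x \in D -> [/\ 0 < vol Omega x (r1 x), 0 < rho x < 1, 0 < r2 x < r1 x & r1 x <= rho x].
  move=> /HD[v0 /andP[rx rx1] r12 r1x _]; split; rewrite ?rx//.
  by apply: (le_trans r1x); lra.
have [u [su nu u1 u0]] := HK D rho r1 r2 uD HD' dD.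
have [sv vu nv] := HE su.
set v := Ext u in sv vu nv.
have [wv Lv Lg] := sv.
have wg := weak_gradientP wv.
set g := weak_gradient setT v in Lg wg.
have lv : loc_integrable setT v by case: wv.
have mg i : measurable_fun setT (fun z => g z ord0 i) by have [[]] := wg i.
pose f z := (eucl_norm (g z) `^ q)%:E.
have mf : measurable_fun setT f by exact: measurable_grad_pow.
have f0 z : (0 <= f z)%E by rewrite lee_fin powR_ge0.
pose S := \sum_(x <- D) rho x ^+ n.
have S0 : 0 <= S.
  rewrite /S big_seq; apply: sumr_ge0 => x /HD[_ /andP[rx _] _ _ _].
  by apply: exprn_ge0; exact: ltW.
pose T := (\int[mu]_z f z)%E.
have T0 : (0 <= T)%E by apply: integral_ge0 => z _; exact: f0.
have TS : (T <= (CE `^ q * K2 `^ (q / p) * S `^ (q / p))%:E)%E.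
  set W := (\int[mu]_z (`|v z| `^ q + eucl_norm (g z) `^ q)%:E)%E.
  have mv : measurable_fun setT v by have [] := lv.
  have mpow (h : V -> R) : measurable_fun setT h -> measurable_fun setT (fun x => h x `^ q).
    by move=> mh; apply: (@measurableT_comp _ _ _ _ _ _ (@powR R ^~ q)).
  have TW : (T <= W)%E.
    apply: ge0_le_integral; first exact: measurableT.
    - by move=> z _; exact: f0.
    - exact: mf.
    - apply/measurable_EFinP; apply: measurable_funD; apply: mpow.
        by apply: measurableT_comp; [exact: normr_measurable|exact: mv].
      exact: measurable_eucl_norm measurableT mg.
    - by move=> z _; rewrite lee_fin lerDr powR_ge0.
  have W0 : (0 <= W)%E by exact: le_trans TW.
  have H : (W `^ q^-1 <= (CE * (K2 * S) `^ p^-1)%:E)%E.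
    apply: (le_trans nv); rewrite EFinM; apply: lee_wpmul2l; last exact: nu.
    by rewrite lee_fin ltW.
  have CK0 : 0 <= CE * (K2 * S) `^ p^-1 by apply: mulr_ge0; [exact: ltW|exact: powR_ge0].
  have {}H : (W <= ((CE * (K2 * S) `^ p^-1) `^ q)%:E)%E.
    have := @gt0_ler_poweR R q (ltW q0) (W `^ q^-1)%E (CE * (K2 * S) `^ p^-1)%:E _ _ H.
    rewrite !in_itv/= !leey !andbT poweR_ge0 lee_fin CK0 => /(_ isT isT).
    by rewrite -poweRrM mulVf// poweRe1.
  apply: (le_trans TW); apply: (le_trans H); rewrite lee_fin.
  rewrite powRM; [|exact: ltW|exact: powR_ge0].
  rewrite -powRrM powRM; [|exact: ltW|exact: S0].
  by rewrite mulrA [p^-1 * q]mulrC lexx.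
have Tfin : T \is a fin_num by rewrite ge0_fin_numE//; apply: le_lt_trans TS _; exact: ltry.
pose I x := (\int[mu]_(z in ball x (2 * rho x)) f z)%E.
have IT : (\sum_(x <- D) I x <= T)%E.
  rewrite /I sum_integral_disjoint//.
  by apply: ge0_subset_integral => //; exact: measurable_bigsetU_ball.
have each x : x \in D ->
    ((2 `^ (- l) * (rho x ^+ n * (((r1 x - r2 x) / rho x) `^ q *
      (rho x ^+ n / vol Omega x (r1 x)) `^ (q / p - l))))%:E <= C%:E * I x)%E.
  move=> xD; have [v0 /andP[rx rx1] /andP[r20 r12] r1x [dv dbl]] := HD x xD.
  have [_ _ _ r1r] := HD' x xD.
  have d0 : 0 < r1 x - r2 x by rewrite subr_gt0.
  have A0 : 0 < (r1 x - r2 x) * (rho x ^+ n / vol Omega x (r1 x)) `^ p^-1.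
    apply: mulr_gt0; first exact: d0.
    by apply: powR_gt0; apply: divr_gt0; [exact: exprn_gt0|exact: v0].
  have M0 : 0 < vol Omega x (r1 x) / 2 by exact: divr_gt0.
  (* Both sets have measure at least vol x r1 / 2: [P] because vol x r1 <= 2 vol x r2, and [Z] by
     [vol_corona] and r1 <= rho. They lie in Omega, where the extension equals [u]. *)
  pose P := Omega `&` ball x (r2 x).
  pose Z := Omega `&` ball x (rho x) `&` ~` ccube x (3 / 8 * rho x).
  have r2r : r2 x <= rho x by apply: (le_trans (ltW r12) r1r).
  have oP : open P by apply: openI; [exact: oO|exact: open_ball_rV].
  have oZ : open Z by exact: open_corona.
  have Px : P `<=` ball x (rho x).
    by move=> z [_ xz]; exact: le_ball r2r _ xz.
  have Zx : Z `<=` ball x (rho x) by move=> z [[_ xz] _].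
  have MP : ((vol Omega x (r1 x) / 2)%:E <= mu P)%E.
    by rewrite /P (volE oO) lee_fin ler_pdivrMr ?ltr0Sn// mulrC; exact: dv.
  have MZ : ((vol Omega x (r1 x) / 2)%:E <= mu Z)%E.
    apply: le_trans (vol_corona rx dbl); rewrite lee_fin; apply: ler_wpM2r.
      by rewrite invr_ge0.
    exact: vol_mono.
  have vP : {ae mu, forall z, P z ->
      v z = (r1 x - r2 x) * (rho x ^+ n / vol Omega x (r1 x)) `^ p^-1}.
    by apply: filterS vu => z Hz [Oz xz]; rewrite (Hz Oz) (u1 x xD z xz).
  have vZ : {ae mu, forall z, Z z -> v z = 0}.
    apply: filterS vu => z Hz [[Oz xz] zc]; rewrite (Hz Oz); apply: (u0 x xD).
      have r2' : rho x <= 2 * rho x by rewrite ler_peMl ?ler1n ?(ltW rx).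
      exact: le_ball r2' _ xz.
    by move=> xz1; apply: zc; exact: ball_sub_ccube r1x _ xz1.
  have := loc v g x (rho x) _ _ P Z lv wg rx A0 M0 oP Px MP vP oZ Zx MZ vZ.
  rewrite (pow_cube q l n rx d0 v0 pn0) -/(I x) [C * _]mulrC !EFinM -!muleA.
  have rg : (0 < (rho x `^ (q - n%:R + n%:R * l))%:E)%E by rewrite lte_fin powR_gt0.
  by rewrite lee_pmul2l.
have Ifin x : x \in D -> I x \is a fin_num.
  move=> xD; have I0 : (0 <= I x)%E by apply: integral_ge0 => z _; exact: f0.
  rewrite ge0_fin_numE//; apply: (@le_lt_trans _ _ T); last by rewrite -ge0_fin_numE.
  apply: le_trans IT; rewrite (bigD1_seq x xD uD) /= leeDl//.
  by apply: sume_ge0 => y _; apply: integral_ge0 => z _; exact: f0.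
have sumE : (\sum_(x <- D) (2 `^ (- l) * (rho x ^+ n * (((r1 x - r2 x) / rho x) `^ q *
      (rho x ^+ n / vol Omega x (r1 x)) `^ (q / p - l))))%:E <=
    (C * (CE `^ q * K2 `^ (q / p) * S `^ (q / p)))%:E)%E.
  apply: (@le_trans _ _ (\sum_(x <- D) C%:E * I x)%E).
    by rewrite big_seq [leRHS]big_seq; apply: lee_sum => x xD; exact: each.
  rewrite -ge0_sume_distrr; last by move=> x _; apply: integral_ge0 => z _; exact: f0.
  rewrite EFinM; apply: lee_wpmul2l; first by rewrite lee_fin ltW.
  exact: le_trans IT TS.
move: sumE; rewrite sumEFin lee_fin -mulr_sumr powRN.
rewrite mulrC ler_pdivrMr; last exact: powR_gt0.
move=> /le_trans; apply; rewrite C4E -/S.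
by rewrite le_eqVlt; apply/orP; left; apply/eqP; ring.
Qed.

End energy.

(** * Conclusion *)

Section neighborhoods.
Variables (R : realType) (n : nat).
Local Notation V := 'rV[R]_n.
Local Notation mu := (@lebesgue_rV R n).

Lemma measurable_neighborhood (A : set V) (r : R) : measurable (\bigcup_(x in A) ball x r).
Proof. by apply: open_measurable_rV; apply: bigcup_open => x _; exact: open_ball_rV. Qed.

(** The neighbourhoods of a closed set shrink to the set itself, which misses Omega; continuity of
    the measure from above concludes. Radii 1 / (k + 2) keep the result below 1. *)
Lemma small_neighborhood (Omega A : set V) (e : R) : open Omega -> (mu Omega < +oo)%E ->
  closed A -> Omega `&` A = set0 -> 0 < e ->
  exists2 r, 0 < r < 1 & (mu (Omega `&` \bigcup_(x in A) ball x r) <= e%:E)%E.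
Proof.
move=> oO Ofin cA OA e0.
pose F k := Omega `&` \bigcup_(x in A) ball x (k.+2%:R^-1 : R).
have mO := open_measurable_rV oO.
have mF k : measurable (F k) by apply: measurableI => //; exact: measurable_neighborhood.
have F0 : \bigcap_k F k = set0.
  apply/seteqP; split=> // z Fz; have [Oz _] := Fz 0%N I.
  suff Az : A z by rewrite -OA; split.
  rewrite ((closure_id A).1 cA) => B /nbhs_ballP[d /= d0 dB].
  have [k kd] : exists k, k.+2%:R^-1 < d.
    exists (Num.truncn d^-1); rewrite invf_plt ?posrE//.
    by apply: lt_trans (truncnS_gt _) _; rewrite ltr_nat.
  have [_ [x Ax xz]] := Fz k I.
  by exists x; split=> //; apply: dB; apply: ball_sym; exact: le_ball (ltW kd) _ xz.
have FO : (mu (F 0%N) < +oo)%E.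
  apply: le_lt_trans Ofin; apply: le_measure; rewrite ?inE//; exact: subIsetl.
have ndF : nonincreasing_seq F.
  apply/nonincreasing_seqP => k; apply/subsetPset => z [Oz [x Ax xz]]; split=> //.
  exists x => //; apply: le_ball xz.
  by rewrite lef_pV2 ?posrE// ler_nat.
have := nonincreasing_cvg_mu FO mF _ ndF.
rewrite F0 => /(_ measurable0); rewrite measure0.
move=> /fine_cvgP[_ /cvgrPdist_le /(_ _ e0)] [N _ /(_ N (leqnn N))] /=.
rewrite sub0r normrN ger0_norm ?fine_ge0// => H.
exists (N.+2%:R^-1); first by rewrite invr_gt0 ltr0n/= invf_lt1// ltr1n.
rewrite -[X in (X <= _)%E]fineK ?lee_fin//.
rewrite ge0_fin_numE//; apply: le_lt_trans FO; apply: le_measure; rewrite ?inE//.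
  exact: mF.
by move: (ndF 0%N N (leq0n N)) => /subsetPset.
Qed.

End neighborhoods.

(** For q < n the witness is the midpoint of 1 - q/n and q/p, an interval that p < q* makes
    nonempty; for q >= n it is half of q/p. *)
Lemma exists_exponent (R : realType) (n : nat) (p q : R) : (0 < n)%N ->
  1 <= q -> q < p -> (p%:E < sobolev_conjugate n q)%E ->
  exists l : R, [/\ 0 <= l <= 1, 0 < q - n%:R + n%:R * l & 0 < q / p - l].
Proof.
move=> n0 q1 qp; rewrite /sobolev_conjugate.
have q0 : 0 < q by exact: lt_le_trans q1.
have p0 : 0 < p by exact: lt_trans qp.
have N0 : 0 < n%:R :> R by rewrite ltr0n.
have qp0 : 0 < q / p by rewrite divr_gt0.
have qp1 : q / p < 1 by rewrite ltr_pdivrMr// mul1r.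
case: ifPn => [qn|]; last first.
  rewrite -leNgt => nq _; exists (q / p / 2); split; [|have : 0 < n%:R * (q / p / 2)|]; try lra.
  by rewrite mulr_gt0// divr_gt0.
rewrite lte_fin => H.
have d0 : 0 < n%:R - q by rewrite subr_gt0.
move: H; rewrite ltr_pdivlMr// => H.
have H' : n%:R - q < n%:R * (q / p).
  by rewrite mulrA ltr_pdivlMr// mulrC [ltRHS]mulrC.
exists ((q / p + (1 - q / n%:R)) / 2).
have qn1 : q / n%:R < 1 by rewrite ltr_pdivrMr// mul1r.
have qn0 : 0 < q / n%:R by rewrite divr_gt0.
have E : n%:R * ((q / p + (1 - q / n%:R)) / 2) = (n%:R * (q / p) + (n%:R - q)) / 2.
  by field; rewrite !gt_eqF.
have H2 : 1 - q / n%:R < q / p.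
  rewrite -(ltr_pM2l N0) mulrBr mulr1 (_ : n%:R * (q / n%:R) = q)//.
  by field; rewrite gt_eqF.
by split; rewrite ?E; lra.
Qed.

(** For t <= delta this is monotonicity, and for t > delta the left side is negative. Being affine
    in t, the bound can be summed against the weights rho^n when only the sum of the volumes is
    controlled. *)
Lemma le_powN_linear (R : realType) (e delta t : R) : 0 < e -> 0 < delta -> 0 < t ->
  delta `^ (- e) - delta `^ (- e) / delta * t <= t `^ (- e).
Proof.
move=> e0 d0 t0; have [td|dt] := leP t delta.
  apply: (@le_trans _ _ (delta `^ (- e))).
    by rewrite gerBl mulr_ge0 ?divr_ge0 ?powR_ge0// ltW.
  rewrite !powRN lef_pV2 ?posrE ?powR_gt0//.
  by apply: ge0_ler_powR; rewrite ?nnegrE ?(ltW e0) ?(ltW t0) ?(ltW d0).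
apply: (@le_trans _ _ 0); last exact: powR_ge0.
rewrite subr_le0 -mulrA ler_peMr ?powR_ge0// mulrC ler_pdivlMr// mul1r ltW//.
Qed.

Section covering.
Variables (R : realType) (n : nat).
Local Notation V := 'rV[R]_n.
Local Notation mu := (@lebesgue_rV R n).

Lemma vitali_compact (A : set V) (rad : V -> R) : compact A -> (forall x, A x -> 0 < rad x) ->
  exists D : seq V, [/\ uniq D, forall x, x \in D -> A x,
    forall x y, x \in D -> y \in D -> x != y -> ball x (rad x) `&` ball y (rad y) = set0 &
    A `<=` \big[setU/set0]_(x <- D) ball x (3 * rad x)].
Proof.
move=> cA rad0; move: (cA); rewrite compact_cover.
move=> /(_ V A (fun x => ball x (rad x))) [].
- by move=> x _; exact: open_ball_rV.
- by move=> x Ax; exists x => //; apply: ballxx; exact: rad0.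
move=> D' D'A AD'.
have HA x : x \in finmap.enum_fset D' -> A x by move=> /D'A; rewrite inE.
have [|D [uD DD' dD cD]] := @vitali_finite R n rad (finmap.enum_fset D').
  by move=> x /HA; exact: rad0.
exists D; split=> //; first by move=> x /DD'; exact: HA.
move=> z /AD'[x /= xD' xz]; have [y yD xy] := cD x xD'.
by rewrite -bigcup_seq; exists y => //; exact: xy.
Qed.

Lemma measure_bigsetU_ball_le (D : seq V) (rad : V -> R) : (forall x, x \in D -> 0 < rad x) ->
  (mu (\big[setU/set0]_(x <- D) ball x (rad x)) <= (\sum_(x <- D) (2 * rad x) ^+ n)%:E)%E.
Proof.
elim: D => [|x D IH] rad0; first by rewrite !big_nil measure0.
rewrite !big_cons EFinD.
apply: le_trans (measureU2 _ _ _) _; first exact: measurable_ball_rV.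
  exact: measurable_bigsetU_ball.
apply: leeD; first by rewrite -(lebesgue_ball x) ?rad0 ?mem_head.
by apply: IH => y yD; rewrite rad0// in_cons yD orbT.
Qed.

Lemma sum_pow_le (B : set V) (D : seq V) (rho : V -> R) : uniq D -> measurable B ->
  (mu B < +oo)%E -> (forall x, x \in D -> 0 < rho x /\ ball x (2 * rho x) `<=` B) ->
  (forall x y, x \in D -> y \in D -> x != y -> ball x (2 * rho x) `&` ball y (2 * rho y) = set0) ->
  \sum_(x <- D) rho x ^+ n <= fine (mu B).
Proof.
move=> uD mB Bfin HD dD; rewrite -lee_fin fineK ?ge0_fin_numE//.
apply: le_trans (@sum_measure_disjoint R n D (fun x => 2 * rho x) B uD mB dD).
rewrite -sumEFin big_seq [leRHS]big_seq; apply: lee_sum => x xD.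
have [r0 xB] := HD x xD.
rewrite (setIidr xB) lebesgue_ball ?mulr_gt0// lee_fin.
by apply: lerXn2r; rewrite ?nnegrE; lra.
Qed.

End covering.

Section conclusion.
Variables (R : realType) (m : nat).
Local Notation n := m.+1.
Local Notation V := 'rV[R]_n.
Local Notation mu := (@lebesgue_rV R n).
Variables (Omega : set V) (oO : open Omega).

Lemma sum_vol_le (A : set V) (D : seq V) (rho : V -> R) (r0 h : R) :
  uniq D -> (forall x, x \in D -> A x /\ 0 < rho x < r0) ->
  (forall x y, x \in D -> y \in D -> x != y -> ball x (2 * rho x) `&` ball y (2 * rho y) = set0) ->
  (mu (Omega `&` \bigcup_(x in A) ball x r0) <= h%:E)%E ->
  \sum_(x <- D) vol Omega x (rho x) <= h.
Proof.
move=> uD HD dD; set B := _ `&` _ => Bh.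
have mB : measurable B.
  by apply: measurableI; [exact: open_measurable_rV|exact: measurable_neighborhood].
rewrite -lee_fin; apply: le_trans Bh.
apply: le_trans (@sum_measure_disjoint R n D (fun x => 2 * rho x) B uD mB dD).
rewrite -sumEFin big_seq [leRHS]big_seq; apply: lee_sum => x xD.
have [Ax /andP[rx rr]] := HD x xD.
rewrite -volE//; apply: le_measure; rewrite ?inE.
- exact: measurable_Oball.
- by apply: measurableI => //; exact: measurable_ball_rV.
move=> z [Oz xz]; split; last by apply: le_ball xz; lra.
by split=> //; exists x => //; apply: le_ball xz; exact: ltW.
Qed.

(** [delta] is solved from c0 delta^(-e) a = C5 + 2. *)
Lemma small_contradiction (e c0 C5 a : R) : 0 < e -> 0 < c0 -> 0 < C5 -> 0 < a ->
  exists2 delta, 0 < delta & C5 + 1 < c0 * delta `^ (- e) * a.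
Proof.
move=> e0 c00 C50 a0; have X0 : 0 < (C5 + 2) / (c0 * a) by rewrite divr_gt0 ?mulr_gt0//; lra.
exists (((C5 + 2) / (c0 * a)) `^ (- e^-1)); first exact: powR_gt0.
rewrite -powRrM mulrNN mulVf ?gt_eqF// powRr1 ?ltW//.
rewrite mulrAC mulrC divfK ?mulf_neq0 ?gt_eqF//; lra.
Qed.

Variables (p q : R).
Hypotheses (n2 : (2 <= n)%N) (q1 : 1 <= q) (qp : q < p).
Hypothesis pq : (p%:E < sobolev_conjugate n q)%E.
Hypothesis ext : sobolev_extension_domain p q Omega.

Lemma boundary_null : mu (boundary Omega) = 0%E.
Proof.
have [_ bO [Ext [CE [CE0 _ HE]]]] := ext.
have [r rO] := bounded_cube0 bO.
have [A AE] : exists A, A = boundary Omega by eexists.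
rewrite -AE.
have AO : A `<=` closure Omega by rewrite AE; exact: subDsetl.
have cA : closed A.
  rewrite AE /boundary setDE; apply: closedI; first exact: closed_closure.
  by apply: open_closedC; exact: open_interior.
have OA : Omega `&` A = set0.
  rewrite AE; apply/seteqP; split=> // z [Oz [_ nOz]].
  by apply: nOz; exact: open_nbhs_nbhs.
have rA : A `<=` @cube0 R n r.
  apply: (subset_trans AO).
  rewrite ((closure_id (@cube0 R n r)).1 (@closed_cbox R n _ _)).
  exact: closureS.
have kA : compact A by apply: subclosed_compact rA => //; exact: compact_cbox.
have mA := measurable_compact_rV kA.
have Afin : (mu A < +oo)%E := compact_lty kA.
have Ofin : (mu Omega < +oo)%E.
  apply: le_lt_trans (lebesgue_cube_lty n r); apply: le_measure => //; rewrite inE.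
    exact: open_measurable_rV.
  exact: measurable_cbox.
apply/eqP; rewrite eq_le measure_ge0 andbT leNgt; apply/negP => A0.
have a0 : 0 < fine (mu A) by rewrite fine_gt0// A0 Afin.
have [l [l01 gamma0 e0]] := exists_exponent (ltn0Sn m) q1 qp pq.
have q0 : 0 < q by exact: lt_le_trans q1.
have p0 : 0 < p by exact: lt_trans qp.
have [C4 C40 HC4] := energy_bound oO Ofin q1 p0 l01 gamma0 CE0 HE.
have [c0 c00 Hc0] := @good_cube R m Omega oO q (q / p - l) n2 q1 e0.
move: (q / p - l) e0 HC4 Hc0 => e e0 HC4 Hc0.
(* All balls of radius 2 rho about points of [A] stay in this cube, as rho < r0 < 1; this bounds the
   sum of rho^n from above. *)
set B := @cube0 R n (r + 2).
have mB : measurable B by exact: measurable_cbox.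
have Bfin : (mu B < +oo)%E by exact: lebesgue_cube_lty.
have [C5 C5E] : exists C5, C5 = C4 * fine (mu B) `^ (q / p) + 1 by eexists.
have C50 : 0 < C5.
  rewrite C5E; apply: ltr_wpDl; last exact: ltr01.
  by apply: mulr_ge0; [exact: ltW|exact: powR_ge0].
have a'0 : 0 < fine (mu A) / 12 ^+ n by rewrite divr_gt0// exprn_gt0.
have [delta delta0 Hdelta] := small_contradiction e0 c00 C50 a'0.
set T := c0 * delta `^ (- e) in Hdelta.
have T0 : 0 < T by rewrite mulr_gt0// powR_gt0.
(* [c0], [C4] and [delta] are already fixed, so r0 may depend on them. The volume bound delta / T
   makes the linear correction T / delta times the sum of volumes at most 1. *)
have [r0 /andP[r00 r01] Hr0] := small_neighborhood oO Ofin cA OA (divr_gt0 delta0 T0).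
have /choice[rho /choice[r1 /choice[r2 Hr]]] (x : V) : exists rho r1 r2 : R, A x ->
    [/\ 0 < rho < r0, 0 < r2 < r1, r1 <= 3 / 8 * rho,
    vol Omega x r1 <= 2 * vol Omega x r2 /\ vol Omega x (rho / 2) <= vol Omega x rho / 2 &
    c0 * (vol Omega x rho / rho ^+ n) `^ (- e) <=
      ((r1 - r2) / rho) `^ q * (rho ^+ n / vol Omega x r1) `^ e].
  have [Ax|nAx] := pselect (A x); last by exists 0, 0, 0.
  by have [rho [r1 [r2 H]]] := Hc0 x (AO x Ax) r0 r00; exists rho, r1, r2.
have rho0 x : A x -> 0 < 2 * rho x.
  by move=> /Hr[/andP[? _] _ _ _ _]; rewrite mulr_gt0.
have [D [uD DA dD cD]] := vitali_compact kA rho0.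
have rho01 x : x \in D -> 0 < rho x < r0 by move=> /DA/Hr[].
(* The covering balls have radius 3 (2 rho), hence are cubes of side 12 rho. *)
have S1 : fine (mu A) / 12 ^+ n <= \sum_(x <- D) rho x ^+ n.
  rewrite ler_pdivrMr ?exprn_gt0// -lee_fin fineK ?ge0_fin_numE//.
  apply: le_trans (le_measure _ _ _ cD) _; rewrite ?inE//.
    exact: measurable_bigsetU_ball.
  apply: le_trans (measure_bigsetU_ball_le _) _.
    by move=> x /DA/rho0 ?; rewrite mulr_gt0.
  rewrite lee_fin mulr_suml le_eqVlt; apply/orP; left; apply/eqP.
  apply: eq_bigr => x _; rewrite -exprMn; congr (_ ^+ _); ring.
have S2 : \sum_(x <- D) rho x ^+ n <= fine (mu B).
  apply: (sum_pow_le uD mB Bfin _ dD) => x xD.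
  have /andP[rx rr] := rho01 x xD; split=> // z [_ xz] i.
  have /andP[h1 h2] := rA x (DA x xD) i; have := xz ord0 i.
  by rewrite /ball/= ltr_norml => /andP[h3 h4]; apply/andP; split; lra.
have S3 : \sum_(x <- D) vol Omega x (rho x) <= delta / T.
  apply: (sum_vol_le uD _ dD Hr0) => x xD; split; first exact: DA.
  exact: rho01.
have term x : x \in D -> T * rho x ^+ n - T / delta * vol Omega x (rho x) <=
    rho x ^+ n * (((r1 x - r2 x) / rho x) `^ q * (rho x ^+ n / vol Omega x (r1 x)) `^ e).
  move=> xD; have /andP[rx _] := rho01 x xD; have [_ _ _ _ Hx] := Hr x (DA x xD).
  have rn0 : 0 < rho x ^+ n by rewrite exprn_gt0.
  have v0 := vol_gt0 oO (AO x (DA x xD)) rx.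
  apply: (@le_trans _ _ (rho x ^+ n *
      (c0 * (vol Omega x (rho x) / rho x ^+ n) `^ (- e)))); last first.
    by rewrite ler_pM2l.
  apply: (@le_trans _ _ (rho x ^+ n * (c0 * (delta `^ (- e) -
      delta `^ (- e) / delta * (vol Omega x (rho x) / rho x ^+ n))))); last first.
    by rewrite !ler_pM2l// le_powN_linear// divr_gt0.
  rewrite /T le_eqVlt; apply/orP; left; apply/eqP.
  move: (vol _ _ _) (delta `^ _) => w d; field.
  by rewrite !gt_eqF.
have E1 : \sum_(x <- D) rho x ^+ n * (((r1 x - r2 x) / rho x) `^ q *
    (rho x ^+ n / vol Omega x (r1 x)) `^ e) <= C4 * (\sum_(x <- D) rho x ^+ n) `^ (q / p).
  apply: HC4 => // x xD; have Ax := DA x xD.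
  have [/andP[rx rr] /andP[r2x r12x] r1x vx _] := Hr x Ax; split=> //.
  - by apply: (vol_gt0 oO (AO x Ax)); exact: lt_trans r12x.
  - by rewrite rx; exact: lt_trans r01.
  - by rewrite r2x.
have E2 : (\sum_(x <- D) rho x ^+ n) `^ (q / p) <= fine (mu B) `^ (q / p).
  have s0 : 0 <= \sum_(x <- D) rho x ^+ n.
    by rewrite big_seq sumr_ge0// => x /rho01/andP[rx _]; rewrite exprn_ge0// ltW.
  apply: ge0_ler_powR => //; first by rewrite divr_ge0// ltW.
  exact: le_trans S2.
have E3 : \sum_(x <- D) (T * rho x ^+ n - T / delta * vol Omega x (rho x)) <=
    C4 * fine (mu B) `^ (q / p).
  apply: le_trans (le_trans E1 _); last by rewrite ler_pM2l.
  by rewrite big_seq [leRHS]big_seq; apply: ler_sum => x; exact: term.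
have E4 : T / delta * \sum_(x <- D) vol Omega x (rho x) <= 1.
  have -> : 1 = T / delta * (delta / T) by rewrite mulrA divfK ?divff ?gt_eqF.
  by rewrite ler_pM2l// divr_gt0.
have E5 : T * (fine (mu A) / 12 ^+ n) <= T * \sum_(x <- D) rho x ^+ n by rewrite ler_pM2l.
move: E3; rewrite sumrB -!mulr_sumr => E3.
(* With X = C4 |B|^(q/p), the estimates give T |A| / 12^n <= X + 1, whereas [delta] was chosen so
   that the left side exceeds C5 + 1 = X + 2. *)
move: E3 E4 E5 Hdelta; rewrite C5E.
move: (C4 * _) (T * \sum_(x <- D) _) (T / delta * _) (T * (_ / _)) => a b c d E3 E4 E5 E6.
have E7 : b <= a + c by rewrite -lerBlDr.
have : a + 1 + 1 < a + 1.
  apply: lt_le_trans E6 _; apply: (le_trans E5); apply: (le_trans E7).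
  by rewrite lerD2l.
by rewrite ltNge lerDl ler01.
Qed.

End conclusion.

Theorem theorem1p1 (R : realType) (n : nat) (Omega : set 'rV[R]_n) (p q : R) :
  (2 <= n)%N -> 1 <= q -> q < p -> (p%:E < sobolev_conjugate n q)%E ->
  sobolev_extension_domain p q Omega ->
  lebesgue_rV (boundary Omega) = 0%E.
Proof.
case: n Omega => [//|m] Omega n2 q1 qp pq ext.
have [[_ _ oO] _ _] := ext.
exact: (boundary_null oO n2 q1 qp pq ext).
Qed.
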